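(* Let $s,s_1,s_2\in\mathbb{R}$, $1<p<\infty$, $1<p_1,p_2<\infty$, $1\le r_1,r_2\le\infty$ and $0<\theta<1$. Put $s_*=(1-\theta)s_1+\theta s_2$, $\frac1{p_*}=\frac{1-\theta}{p_1}+\frac{\theta}{p_2}$, $\frac1{r_*}=\frac{1-\theta}{r_1}+\frac{\theta}{r_2}$. If there is a constant $C>0$ such that $$\|f\|_{F^{s,r_*}_{p,1}}\le C\,\|f\|_{F^{s_1,r_1}_{p_1,\infty}}^{1-\theta}\|f\|_{F^{s_2,r_2}_{p_2,\infty}}^{\theta}\quad\text{for all } f\in F^{s_1,r_1}_{p_1,\infty}\cap F^{s_2,r_2}_{p_2,\infty},$$ then one of the following conditions is satisfied: (i) $s_*=s$, $p_*=p$, $p_1\ne p_2$, $s_2-s_1\ne n/p_2-n/p_1$; (ii) $s_*>s$, $p_*=p$, $p_1\ne p_2$; (iii) $s_*-s=n/p_*-n/p>0$, $s_2-s_1\ne n/p_2-n/p_1$; (iv) $s_*-s>n/p_*-n/p>0$.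
   Context: All spaces are on $\mathbb{R}^n$; $\mathscr{S}$ is the Schwartz class and $\mathscr{S}'$ its dual. Lorentz spaces: for $1\le p<\infty$, $1\le q\le\infty$, $L^{p,q}$ is the space of measurable $f$ on $\mathbb{R}^n$ with finite quasi-norm $\|f\|_{L^{p,q}}=\left(p\int_0^\infty[\alpha\mu_f(\alpha)^{1/p}]^q\frac{d\alpha}{\alpha}\right)^{1/q}$ if $q<\infty$, and $\sup_{\alpha>0}\alpha\mu_f(\alpha)^{1/p}$ if $q=\infty$, where $\mu_f(\alpha)=|\{x:|f(x)|>\alpha\}|$. Inhomogeneous Triebel-Lizorkin-Lorentz spaces: fix $\{\psi_j\}_{j\ge0}\subset C_c^\infty(\mathbb{R}^n)$ with $\operatorname{supp}\psi_0\subset\{|\xi|\le2\}$, $\operatorname{supp}\psi_j\subset\{2^{j-1}\le|\xi|\le2^{j+1}\}$ for $j\ge1$, $\sup_{j,\xi}2^{j|\alpha|}|D^\alpha\psi_j(\xi)|<\infty$ for every multi-index $\alpha$, and $\sum_{j\ge0}\psi_j=1$ on $\mathbb{R}^n$. Let $\Delta_j f=(\psi_j\hat f)^\vee$ for $f\in\mathscr{S}'$. Then $F^{s,r}_{p,q}$ is the space of $f\in\mathscr{S}'$ with $$\|f\|_{F^{s,r}_{p,q}}=\Big\|\,\big\|\{2^{js}\Delta_jf\}_{j\ge0}\big\|_{l^r}\Big\|_{L^{p,q}}<\infty .$$ *)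

(* Defs.v *)
From HB Require Import structures.
From mathcomp Require Import all_boot all_order all_algebra.
From mathcomp Require Import complex.
From mathcomp Require Import all_classical all_reals all_analysis.

Set Implicit Arguments.
Unset Strict Implicit.
Unset Printing Implicit Defensive.
Import Order.TTheory GRing.Theory Num.Theory.
Import ComplexField.Normc.
Import numFieldNormedType.Exports.

Local Open Scope classical_set_scope.
Local Open Scope ring_scope.
Local Open Scope complex_scope.

(* The product sigma-algebra on row vectors, as the library does for
   [n.-tuple T]. *)
Definition row_display : measure_display -> measure_display.
Proof. exact. Qed.

Section row_measurable.
Context d (T : sigmaRingType d) (n : nat).

Let coord (i : 'I_n) (x : 'rV[T]_n) : T := x ord0 i.

Let row_set0 : g_sigma_preimage coord set0.
Proof. exact: sigma_algebra0. Qed.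

Let row_setC A : g_sigma_preimage coord A -> g_sigma_preimage coord (~` A).
Proof. exact: sigma_algebraC. Qed.

Let row_bigcup (F : (set 'rV[T]_n)^nat) :
  (forall i, g_sigma_preimage coord (F i)) ->
  g_sigma_preimage coord (\bigcup_i F i).
Proof. exact: sigma_algebra_bigcup. Qed.

HB.instance Definition _ := @isMeasurable.Build (row_display d)
  'rV[T]_n (g_sigma_preimage coord) row_set0 row_setC row_bigcup.

Lemma measurable_coord (i : 'I_n) :
  measurable_fun [set: 'rV[T]_n] (fun x : 'rV[T]_n => x ord0 i).
Proof.
move=> _ Y mY; rewrite setTI; apply: sub_sigma_algebra => /=.
rewrite -bigcup_seq/=; exists i => /=; first by rewrite mem_index_enum.
by exists Y => //; rewrite setTI.
Qed.

End row_measurable.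

Lemma measurable_fun_rowP d1 d2 (T1 : measurableType d1)
    (T2 : measurableType d2) n (f : T1 -> 'rV[T2]_n) :
  (forall i, measurable_fun [set: T1] (fun x => f x ord0 i)) ->
  measurable_fun [set: T1] f.
Proof.
move=> mf.
pose coord (i : 'I_n) (x : 'rV[T2]_n) := x ord0 i.
suff h : g_sigma_preimage (fun i => coord i \o f) `<=` measurable.
  move=> _ A mA; apply: h; rewrite g_sigma_preimage_comp.
  by exists A.
apply: smallest_sub; first exact: sigma_algebra_measurable.
case: n => [|n] in f mf coord *; first by rewrite big_ord0.
rewrite -bigcup_mkord_ord; apply: bigcup_sub => i Ii.
by move=> A [B mB <-]; exact: mf.
Qed.

Section lebesgue_rV.
Context {R : realType}.
Local Notation Rn n := 'rV[measurableTypeR R]_n.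

Definition cons_rV n (u : measurableTypeR R * Rn n) : Rn (1 + n) :=
  row_mx (\row_(_ < 1) u.1) u.2.

Lemma measurable_cons_rV n : measurable_fun [set: _] (@cons_rV n).
Proof.
apply: measurable_fun_rowP => i; rewrite /cons_rV.
case: (@split_ordP 1 n i) => k ->.
- under eq_fun do rewrite row_mxEl mxE.
  exact: measurable_fst.
- under eq_fun do rewrite row_mxEr.
  apply: (measurableT_comp (measurable_coord k)); exact: measurable_snd.
Qed.

Section lebesgue_step.
Context {n : nat} (mu : {sigma_finite_measure set (Rn n) -> \bar R}).

Definition lebesgue_step : set (Rn (1 + n)) -> \bar R :=
  pushforward (lebesgue_measure \x mu)%E (@cons_rV n).

Let step0 : lebesgue_step set0 = 0%E.
Proof. by rewrite /lebesgue_step /pushforward preimage_set0 measure0. Qed.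

Let step_ge0 A : (0 <= lebesgue_step A)%E.
Proof. exact: (measure_ge0 (lebesgue_measure \x mu)%E). Qed.

Let step_sigma_additive : semi_sigma_additive lebesgue_step.
Proof.
move=> F mF tF mUF; rewrite /lebesgue_step /pushforward preimage_bigcup.
have mc A : measurable A -> measurable (@cons_rV n @^-1` A).
  by move=> mA; rewrite -[X in measurable X]setTI; exact: measurable_cons_rV.
apply: measure_semi_sigma_additive.
- by move=> k; exact: mc.
- apply/trivIsetP => /= i j _ _ ij; rewrite -preimage_setI.
  by move/trivIsetP : tF => /(_ _ _ _ _ ij) ->//; rewrite preimage_set0.
- by rewrite -preimage_bigcup; exact: mc.
Qed.

HB.instance Definition _ := isMeasure.Build _ _ _ lebesgue_step
  step0 step_ge0 step_sigma_additive.

Let step_sigma_finite : sigma_finite setT lebesgue_step.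
Proof.
have mc : measurable_fun [set: Rn (1 + n)] (fun x => x ord0 (lshift n ord0)).
  exact: measurable_coord.
have mt : measurable_fun [set: Rn (1 + n)]
    (fun x => \row_i x ord0 (rshift 1 i) : Rn n).
  apply: measurable_fun_rowP => i; under eq_fun do rewrite mxE.
  exact: measurable_coord.
have /sigma_finiteP[F [TF ndF Foo]] :=
  sigma_finiteT (@lebesgue_measure R).
have /sigma_finiteP[G [TG ndG Goo]] := sigma_finiteT mu.
pose E k := [set x : Rn (1 + n) | F k (x ord0 (lshift n ord0))] `&`
  [set x : Rn (1 + n) | G k (\row_i x ord0 (rshift 1 i))].
exists E.
  apply/seteqP; split=> // x _.
  have [i _ Fi] : (\bigcup_i F i) (x ord0 (lshift n ord0)) by rewrite -TF.
  have [j _ Gj] : (\bigcup_i G i) (\row_i x ord0 (rshift 1 i)) by rewrite -TG.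
  exists (maxn i j) => //; split => /=.
    by move: Fi; exact/subsetPset/ndF/leq_maxl.
  by move: Gj; exact/subsetPset/ndG/leq_maxr.
move=> k; have [mF Fk] := Foo k; have [mG Gk] := Goo k; split.
  apply: measurableI; rewrite -[X in measurable X]setTI; [exact: mc|exact: mt].
rewrite /lebesgue_step /pushforward (_ : _ @^-1` _ = F k `*` G k).
  by rewrite product_measure1E// lte_mul_pinfty// ge0_fin_numE.
apply/seteqP; split=> -[a x]; rewrite /E/= /cons_rV row_mxEl mxE;
  rewrite (_ : \row_i _ = x)//;
  by apply/rowP => i; rewrite mxE row_mxEr.
Qed.

HB.instance Definition _ := Measure_isSigmaFinite.Build _ _ _ lebesgue_step
  step_sigma_finite.

End lebesgue_step.

(* n-dimensional Lebesgue measure on Borel sets, as an n-fold product. *)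
Fixpoint lebesgue_rV (n : nat) : {sigma_finite_measure set (Rn n) -> \bar R} :=
  if n is m.+1 then lebesgue_step (lebesgue_rV m) else \d_(0 : Rn 0).

Lemma lebesgue_rV_box n (A : 'I_n -> set (measurableTypeR R)) :
  (forall i, measurable (A i)) ->
  lebesgue_rV n [set x | forall i, A i (x ord0 i)] =
  (\prod_(i < n) lebesgue_measure (A i))%E.
Proof.
elim: n A => [A _|n IH A mA].
  by rewrite big_ord0 /= diracE mem_set//= => -[].
rewrite big_ord_recl -IH; last by move=> i; exact: mA.
rewrite /= /lebesgue_step /pushforward.
have mbox : measurable [set x : Rn n | forall i, A (lift ord0 i) (x ord0 i)].
  rewrite [X in measurable X](_ : _ = \bigcap_(i in [set: 'I_n])
      ((fun x : Rn n => x ord0 i) @^-1` A (lift ord0 i))).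
    apply: fin_bigcap_measurable => // i _.
    by rewrite -[X in measurable X]setTI; exact: measurable_coord.
  by apply/seteqP; split => x /= h i; [move=> _|]; exact: h.
rewrite -product_measure1E//; congr (_ _).
pose l0 : 'I_n.+1 := @lshift 1 n ord0; pose rs i : 'I_n.+1 := @rshift 1 n i.
have l0E : l0 = ord0 by exact: val_inj.
have rsE i : rs i = lift ord0 i by exact: val_inj.
have c0 a x : cons_rV (a, x) ord0 l0 = a by rewrite /cons_rV row_mxEl mxE.
have cS a x i : cons_rV (a, x) ord0 (rs i) = x ord0 i.
  by rewrite /cons_rV row_mxEr.
apply/seteqP; split => -[a x] /= h.
- by split => [|i]; [rewrite -(c0 a x) -l0E|rewrite -(cS a x) -rsE]; exact: h.
- move=> i; case: (@split_ordP 1 n i) => k ->.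
  + rewrite (ord1 k) -/l0 c0 l0E; exact: h.1.
  + rewrite -/(rs k) cS rsE; exact: h.2.
Qed.

End lebesgue_rV.

Section euclidean.
Context {R : realType} {n : nat}.
Local Notation Rn := 'rV[R]_n.

Definition dotrV (x y : Rn) : R := \sum_i x ord0 i * y ord0 i.

(* The library norm of ['rV[R]_n] is the sup norm. *)
Definition eucl_norm (x : Rn) : R := Num.sqrt (dotrV x x).

Definition monomial (a : 'I_n -> nat) (x : Rn) : R := \prod_i x ord0 i ^+ a i.

Definition order_of (a : 'I_n -> nat) : nat := \sum_i a i.

Definition partials (s : seq 'I_n) (f : Rn -> R) : Rn -> R :=
  foldr (fun i g => 'D_(delta_mx ord0 i) g) f s.

(* C^oo: all iterated partial derivatives, in any order, exist and are
   continuous. *)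
Definition smooth (f : Rn -> R) := forall s : seq 'I_n,
  continuous (partials s f) /\
  forall i x, derivable (partials s f) x (delta_mx ord0 i).

Definition partial (a : 'I_n -> nat) (f : Rn -> R) : Rn -> R :=
  partials (flatten [seq nseq (a i) i | i <- enum 'I_n]) f.

(* [R[i]] has no normed-module structure over [R] in the library, so analytic
   notions for complex-valued functions are taken on real and imaginary
   parts. *)
Definition ccontinuous (f : Rn -> R[i]) :=
  continuous (fun x => complex.Re (f x)) /\ continuous (fun x => complex.Im (f x)).

Definition csmooth (f : Rn -> R[i]) :=
  smooth (fun x => complex.Re (f x)) /\ smooth (fun x => complex.Im (f x)).

Definition cpartial (a : 'I_n -> nat) (f : Rn -> R[i]) (x : Rn) : R[i] :=
  partial a (fun y => complex.Re (f y)) x +i* partial a (fun y => complex.Im (f y)) x.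

Definition cintegrable (f : Rn -> R[i]) :=
  (lebesgue_rV n).-integrable setT (fun x => (complex.Re (f x))%:E) /\
  (lebesgue_rV n).-integrable setT (fun x => (complex.Im (f x))%:E).

Definition cintegral (f : Rn -> R[i]) : R[i] :=
  (\int[lebesgue_rV n]_x complex.Re (f x)) +i* (\int[lebesgue_rV n]_x complex.Im (f x)).

Definition support (f : Rn -> R[i]) : set Rn := closure [set x | f x != 0].

Definition test_function (f : Rn -> R[i]) := csmooth f /\ compact (support f).

Definition schwartz (f : Rn -> R[i]) := csmooth f /\
  forall a b : 'I_n -> nat, exists M : R,
    forall x, `|monomial a x| * normc (cpartial b f x) <= M.

Definition schwartz_seminorm (a b : 'I_n -> nat) (f : Rn -> R[i]) : R :=
  sup [set `|monomial a x| * normc (cpartial b f x) | x in [set: Rn]].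

(* A tempered distribution is given by a functional of which only the values at
   Schwartz functions are meaningful: it is linear there, and continuous for
   the topology of the seminorms, that is, bounded by a finite sum of them. *)
Definition tempered (T : (Rn -> R[i]) -> R[i]) :=
  (forall (c : R[i]) (f g : Rn -> R[i]), schwartz f -> schwartz g ->
    T (fun x => c * f x + g x) = c * T f + T g) /\
  exists (C : R) (N : nat), forall f, schwartz f ->
    normc (T f) <= C *
      \sum_(a : {ffun 'I_n -> 'I_N.+1}) \sum_(b : {ffun 'I_n -> 'I_N.+1})
        schwartz_seminorm (fun i => a i) (fun i => b i) f.

Definition cexpi (t : R) : R[i] := cos t +i* sin t.

Definition fourier (f : Rn -> R[i]) (xi : Rn) : R[i] :=
  cintegral (fun x => f x * cexpi (- (2 * pi * dotrV x xi))).

Definition inv_fourier (f : Rn -> R[i]) (x : Rn) : R[i] :=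
  cintegral (fun xi => f xi * cexpi (2 * pi * dotrV x xi)).

(* Operations on tempered distributions, by transposition. *)
Definition dfourier (T : (Rn -> R[i]) -> R[i]) : (Rn -> R[i]) -> R[i] :=
  fun phi => T (fourier phi).

Definition dinv_fourier (T : (Rn -> R[i]) -> R[i]) : (Rn -> R[i]) -> R[i] :=
  fun phi => T (inv_fourier phi).

Definition dmul (g : Rn -> R[i]) (T : (Rn -> R[i]) -> R[i]) :
    (Rn -> R[i]) -> R[i] :=
  fun phi => T (fun x => g x * phi x).

Definition represents (g : Rn -> R[i]) (T : (Rn -> R[i]) -> R[i]) :=
  forall phi, schwartz phi ->
    cintegrable (fun x => g x * phi x) /\
    T phi = cintegral (fun x => g x * phi x).

(* The continuous function that a distribution is given by. It is unique, and
   for the distributions [lp_block psi j f] below, whose Fourier transforms have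
   compact support, it exists by the Paley-Wiener-Schwartz theorem; the default
   value is thus not used for them. *)
Definition function_of (T : (Rn -> R[i]) -> R[i]) : Rn -> R[i] :=
  xget (fun=> 0) [set g | ccontinuous g /\ represents g T].

Record littlewood_paley (psi : nat -> Rn -> R[i]) : Prop := {
  lp_test : forall j, test_function (psi j);
  lp_support0 : support (psi 0%N) `<=` [set xi | eucl_norm xi <= 2];
  lp_support : forall j, (1 <= j)%N ->
    support (psi j) `<=` [set xi | 2 ^+ j.-1 <= eucl_norm xi <= 2 ^+ j.+1];
  lp_bound : forall a : 'I_n -> nat, exists M : R, forall j xi,
    2 ^+ (j * order_of a) * normc (cpartial a (psi j) xi) <= M;
  lp_sum : forall xi,
    normc (\sum_(j < N) psi j xi - 1) @[N --> \oo] --> (0 : R)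
}.

Definition lp_block (psi : nat -> Rn -> R[i]) (j : nat)
    (f : (Rn -> R[i]) -> R[i]) : (Rn -> R[i]) -> R[i] :=
  dinv_fourier (dmul (psi j) (dfourier f)).

End euclidean.

Section lorentz.
Context d (T : measurableType d) (R : realType).
Variable mu : {measure set T -> \bar R}.
Local Open Scope ereal_scope.

Definition distribution_function (f : T -> \bar R) (a : R) : \bar R :=
  mu [set x | a%:E < `|f x|].

(* Meaningful for [0 < p < +oo] and [0 < q <= +oo]; the value at [q = -oo] is a
   dummy. *)
Definition lorentz_norm (p : R) (q : \bar R) (f : T -> \bar R) : \bar R :=
  match q with
  | q%:E => (p%:E * \int[lebesgue_measure]_(a in `]0%R, +oo[)
      ((a%:E * distribution_function f a `^ p^-1) `^ q * (a^-1)%:E)) `^ q^-1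
  | +oo => ereal_sup [set a%:E * distribution_function f a `^ p^-1
                     | a in `]0%R, +oo[ ]
  | -oo => 0
  end.

End lorentz.

Section triebel_lizorkin_lorentz.
Context {R : realType} {n : nat}.
Variable psi : nat -> 'rV[R]_n -> R[i].
Local Open Scope ereal_scope.

(* The l^r norm is the library's L^r norm for the counting measure on [nat]. *)
Definition TLL_norm (s : R) (r : \bar R) (p : R) (q : \bar R)
    (f : ('rV[R]_n -> R[i]) -> R[i]) : \bar R :=
  lorentz_norm (lebesgue_rV n) p q (fun x =>
    'N[counting]_r [(fun j : nat =>
      (2 `^ (j%:R * s) * normc (function_of (lp_block psi j f) x))%:E)]).

Definition TLL (s : R) (r : \bar R) (p : R) (q : \bar R) :
    set (('rV[R]_n -> R[i]) -> R[i]) :=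
  [set f | tempered f /\ TLL_norm s r p q f < +oo].

End triebel_lizorkin_lorentz.

(* Main.v *)
Require Import Defs.
From mathcomp Require Import all_boot all_order all_algebra.
From mathcomp Require Import complex.
From mathcomp Require Import all_classical all_reals all_analysis measurable_realfun ess_sup_inf.
From mathcomp Require Import ring lra zify.
Set Implicit Arguments.
Unset Strict Implicit.
Unset Printing Implicit Defensive.
Import Order.TTheory GRing.Theory Num.Theory.
Import ComplexField.Normc.
Import numFieldNormedType.Exports.
Local Open Scope classical_set_scope.
Local Open Scope ring_scope.
Local Open Scope complex_scope.

(** The inequality is tested on lacunary superpositions
    [f = \sum_(i < N) t_i^(n/p - w) Phi(t_i x)] of dilates of one profile [Phi],
    the inverse Fourier transform of a bump in the annulus [6 <= |xi| <= 10],
    along two geometric sequences. If the frequencies ascend,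
    [t_i = 2^(L(a+i+1))], each dilate meets three dyadic blocks only, so that the
    factor [2^(ks)] of the norm acts on it as [t_i^w] with [w = s]. If they
    descend, [t_i = 2^(-L(a+i+1))], the whole spectrum lies where [psi_0 = 1];
    then block 0 alone is present and the smoothness acts as [w = 0].

    In both cases the i-th dilate makes the l^r norm at least of order
    [t_i^(n/p)] on the shell [|x| ~ 1/t_i], which has measure of order
    [t_i^(-n)]. The N levels are separated by a factor 2 and each contributes the
    same amount to the norm of L^(p,1), whence
    [TLL_norm_lacunary_ge]: this norm is at least [c N]. On the other hand, let
    [j] be 1 or 2 and let [w_j] be [s_j] or 0 accordingly. The sum over [k] of the
    weighted blocks dominates the l^(r_j) norm, and a geometric sum bounds it by
    a multiple of [B |x|^(-n/p_j)] where [B] bounds the powers [t_i^(a_j)],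
    [a_j = (w_j - n/p_j) - (w - n/p)]. This is the weak norm estimate
    [TLL_norm_lacunary_le]: no power of [N] is lost in L^(p_j,oo).

    With [N = 1] and [a] tending to infinity the inequality bounds
    [t^((1-theta) a_1 + theta a_2)] from below, along [t -> +oo] or [t -> 0]; with
    [N] tending to infinity it excludes [a_1 = a_2 = 0]
    ([interpolation_necessary]). For descending frequencies this says
    [n/p_* - n/p >= 0], and not [p_1 = p_2 = p]; for ascending ones
    [s_* - s >= n/p_* - n/p], and not
    [s_1 - n/p_1 = s_2 - n/p_2 = s - n/p]. The four conditions of the theorem
    are what these facts leave.

    That the blocks of [f] are the functions which the formula suggests is
    [function_of_block]. It rests on Fourier inversion up to a nonzero constant,
    which the estimates absorb: inversion follows from the multiplication
    formula and dilations, for transforms that are continuous, of compact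
    support and have an integrable inverse transform. The uniform decay of the
    block kernels comes from iterated finite differences of their symbols. *)

(** * Borel sets and affine changes of variables *)

Section measurability_of_continuous.
Context {R : realType} {n : nat}.
Local Notation Rn := 'rV[measurableTypeR R]_n.

(** A countable union of boxes with rational centres, since the sigma-algebra
    of row vectors is generated by the coordinates rather than by the open
    sets. *)
Lemma open_measurable_rV (U : set 'rV[R]_n) : open U -> measurable (U : set Rn).
Proof.
move=> oU.
pose box (q : 'rV[rat]_n) (k : nat) : set 'rV[R]_n :=
  [set y | forall i, `|y ord0 i - ratr (q ord0 i)| < k.+1%:R^-1].
pose B (c : 'rV[rat]_n * nat) : set 'rV[R]_n :=
  if `[< box c.1 c.2 `<=` U >] then box c.1 c.2 else set0.
have mB c : measurable (B c : set Rn).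
  rewrite /B; case: ifPn => _; last exact: measurable0.
  rewrite [X in measurable X](_ : _ = \bigcap_(i in [set: 'I_n])
      ((fun x : Rn => x ord0 i) @^-1`
         [set z | `|z - ratr (c.1 ord0 i)| < c.2.+1%:R^-1])).
    apply: fin_bigcap_measurable => // i _.
    rewrite -[X in measurable X]setTI; apply: measurable_coord => //.
    rewrite (_ : [set z | _] = ball (ratr (c.1 ord0 i) : R) (c.2.+1%:R^-1)).
      exact: measurable_ball.
    by apply/seteqP; split => z /=; rewrite /ball/= distrC.
  by apply/seteqP; split => x /= h i; [move=> _|]; exact: h.
suff -> : U = \bigcup_c B c.
  by apply: countable_bigcupT_measurable => // ; exact: countableP.
apply/seteqP; split => [x Ux|x [c _]]; last first.
  by rewrite /B; case: ifPn => // /asboolP h; exact: h.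
have /nbhs_ballP[e /= e0 eU] : nbhs x U by exact: open_nbhs_nbhs.
(* A box of half-width [1 / k.+1] around a point at distance less than [1 / k.+1]
   from [x] stays within [2 / k.+1] of [x]. *)
have [k ke] : exists k : nat, 2 / k.+1%:R < e.
  exists (Num.truncn (2 / e)); rewrite ltr_pdivrMr// mulrC -ltr_pdivrMr//.
  exact: truncnS_gt.
have k0 : 0 < k.+1%:R^-1 :> R by rewrite invr_gt0.
have hq i : exists q : rat, `|x ord0 i - ratr q| < k.+1%:R^-1.
  have /rat_in_itvoo[q] : x ord0 i < x ord0 i + k.+1%:R^-1 by rewrite ltrDl.
  rewrite in_itv/= => /andP[q1 q2]; exists q.
  by rewrite distrC gtr0_norm ?subr_gt0// ltrBlDl.
pose q : 'rV[rat]_n := \row_i projT1 (cid (hq i)).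
have bx : box q k x.
  by move=> i; rewrite /q mxE; case: cid.
exists (q, k) => //; rewrite /B/=; case: ifPn => // /asboolPn[].
move=> y by_; apply: eU; split => // i j; rewrite (ord1 i) /ball/=.
rewrite -(subrKA (ratr (q ord0 j))) (le_lt_trans (ler_normD _ _))//.
apply: lt_trans ke; rewrite mulr_natl mulr2n ltrD//.
by rewrite distrC; exact: by_.
Qed.

Lemma continuous_measurable_rV (f : 'rV[R]_n -> R) :
  continuous f -> measurable_fun [set: Rn] f.
Proof.
move=> cf; apply: (measurability _ (RGenOpens.measurableE R)).
move=> _ [_ [a [b ->] <-]]; rewrite setTI; apply: open_measurable_rV.
by move/continuousP : cf; apply; exact: interval_open.
Qed.

End measurability_of_continuous.

Section affine_change_of_variables.
Context {R : realType}.
Local Notation Rn n := 'rV[measurableTypeR R]_n.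
Local Open Scope ereal_scope.
Local Notation mu1 := (@lebesgue_measure R).

Lemma lebesgue_measure_affine (l v : R) (A : set (measurableTypeR R)) :
  (0 < l)%R -> measurable A ->
  pushforward mu1 (fun x : measurableTypeR R => (l * x + v)%R : measurableTypeR R) A
  = (l^-1)%:E * mu1 A.
Proof.
move=> l0 mA.
pose g (x : measurableTypeR R) : measurableTypeR R := (l * x + v)%R.
have mg : measurable_fun [set: measurableTypeR R] g.
  by apply: measurable_funD => //; exact: measurable_funM.
pose nu : {measure set (measurableTypeR R) -> \bar R} :=
  measure_function_pushforward__canonical__measure_function_Measure mu1 mg.
have : mu1 A = mscale (NngNum (ltW l0)) nu A.
  apply: (@lebesgue_measure_unique R (mscale (NngNum (ltW l0)) nu))
    => // _ [[a b]] _ <-.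
  rewrite /= /mscale /= /pushforward/= -/g.
  rewrite (_ : g @^-1` _ = `]((a - v) / l)%R, ((b - v) / l)%R]%classic); last first.
    apply/seteqP; split => x; rewrite /= !in_itv/= /g;
      by rewrite ltr_pdivrMr// ler_pdivlMr// ltrBlDr lerBrDr mulrC.
  rewrite !lebesgue_measure_itv/= !lte_fin ltr_pM2r ?invr_gt0// ltrD2r.
  case: ifPn => // _; last by rewrite mule0.
  rewrite -!EFinB -EFinM -mulrBl opprB addrA subrK mulrC divfK//.
  by rewrite gt_eqF.
move=> ->; rewrite /= /mscale/= muleA -EFinM mulVf ?mul1e//.
by rewrite gt_eqF.
Qed.

Lemma ge0_integral_affine1 (l v : R) (f : measurableTypeR R -> \bar R) :
  (0 < l)%R -> measurable_fun setT f -> (forall x, 0 <= f x) ->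
  \int[mu1]_x f (l * x + v)%R = (l^-1)%:E * \int[mu1]_x f x.
Proof.
move=> l0 mf f0.
pose g (x : measurableTypeR R) : measurableTypeR R := (l * x + v)%R.
have mg : measurable_fun [set: measurableTypeR R] g.
  by apply: measurable_funD => //; exact: measurable_funM.
have li0 : (0 <= l^-1)%R by rewrite invr_ge0 ltW.
have := ge0_integral_pushforward mg mu1 measurableT mf (fun x _ => f0 x).
rewrite preimage_setT => /esym ->.
rewrite -(@ge0_integral_mscale _ _ R mu1 setT measurableT (NngNum li0) f)//.
apply: eq_measure_integral => //= A mA _.
exact: lebesgue_measure_affine.
Qed.

Lemma ge0_integral_cons n (f : Rn n.+1 -> \bar R) :
  measurable_fun setT f -> (forall x, 0 <= f x) ->
  \int[lebesgue_rV n.+1]_x f x =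
  \int[mu1]_a \int[lebesgue_rV n]_x f (cons_rV (a, x)).
Proof.
move=> mf f0.
rewrite (@ge0_integral_pushforward _ _ _ _ R (@cons_rV R n)
  (@measurable_cons_rV R n) (mu1 \x lebesgue_rV n) setT f)//.
rewrite preimage_setT fubini_tonelli1//; last by move=> x; exact: f0.
by apply: measurableT_comp => //; exact: measurable_cons_rV.
Qed.

Lemma measurable_affine n (l : R) (v : Rn n) :
  measurable_fun [set: Rn n] (fun x => (l *: x + v)%R : Rn n).
Proof.
apply: measurable_fun_rowP => i; under eq_fun do rewrite !mxE.
apply: measurable_funD => //; apply: measurable_funM => //.
exact: measurable_coord.
Qed.

(** By induction on the dimension: Tonelli splits off one coordinate, on which
    the one-dimensional formula contributes a factor [l^-1]. *)
Lemma ge0_integral_affine n (l : R) (v : Rn n) (f : Rn n -> \bar R) :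
  (0 < l)%R -> measurable_fun setT f -> (forall x, 0 <= f x) ->
  \int[lebesgue_rV n]_x f (l *: x + v)%R =
  ((l ^+ n)^-1)%:E * \int[lebesgue_rV n]_x f x.
Proof.
move=> l0; elim: n => [|n IH] in v f *.
  move=> mf f0; rewrite expr0 invr1 mul1e; apply: eq_integral => x _.
  by congr f; apply/rowP => -[].
move=> mf f0.
have mfa : measurable_fun setT (fun x : Rn n.+1 => f (l *: x + v)%R).
  exact: (measurableT_comp mf (measurable_affine l v)).
rewrite !ge0_integral_cons//.
pose va : R := v ord0 (@lshift 1 n ord0).
pose vx : Rn n := \row_i v ord0 (@rshift 1 n i).
have E a x : (l *: cons_rV (a, x) + v)%R = cons_rV ((l * a + va)%R, (l *: x + vx)%R).
  apply/rowP => i; rewrite !mxE; case: (@split_ordP 1 n i) => k ->.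
    by rewrite !mxE (ord1 k).
  by rewrite !mxE.
have mc : measurable_fun setT (fun z => f (cons_rV z)).
  exact: (measurableT_comp mf (measurable_cons_rV (n := n))).
have mF := measurable_fun_fubini_tonelli_F (m2 := lebesgue_rV n) _ mc (fun x => f0 _).
have F0 a : 0 <= fubini_F (lebesgue_rV n) (fun z => f (cons_rV z)) a.
  by apply: integral_ge0 => x _; exact: f0.
pose G (a : measurableTypeR R) : \bar R :=
  fubini_F (lebesgue_rV n) (fun z => f (cons_rV z)) (l * a + va)%R.
have mG : measurable_fun setT G.
  apply: (measurableT_comp mF).
  by apply: measurable_funD => //; exact: measurable_funM.
transitivity (\int[mu1]_a (((l ^+ n)^-1)%:E * G a)).
  apply: eq_integral => a _; under eq_integral do rewrite E.
  rewrite (IH vx (fun x => f (cons_rV ((l * a + va)%R, x))))//.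
  exact: (measurable_fun_pair2 _ mc).
have ln0 : (0 <= (l ^+ n)^-1)%R by rewrite invr_ge0 exprn_ge0// ltW.
have G0 a : setT a -> 0 <= G a by move=> _; exact: F0.
rewrite (ge0_integralZl_EFin mu1 measurableT G0 mG ln0).
rewrite (ge0_integral_affine1 va l0 mF F0) muleA -EFinM exprS invfM.
by rewrite [in RHS]mulrC.
Qed.

End affine_change_of_variables.

(** * Real integrals, cubes, and an integrable majorant *)

Section integrals_on_rV.
Context {R : realType} {n : nat}.
Local Notation Rn := 'rV[measurableTypeR R]_n.
Local Notation mu := (@lebesgue_rV R n).
Local Notation integrable f := (mu.-integrable setT (EFin \o f)).

Lemma measurable_norm_rV : measurable_fun [set: Rn] (fun x : 'rV[R]_n => `|x|).
Proof. by apply: continuous_measurable_rV => x; exact: norm_continuous. Qed.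

Lemma measurable_affine_comp (l : R) (v : 'rV[R]_n) (f : Rn -> R) :
  measurable_fun setT f ->
  measurable_fun [set: Rn] (fun x : 'rV[R]_n => f (l *: x + v)).
Proof. by move=> mf; exact: (measurableT_comp mf (measurable_affine l v)). Qed.

Lemma integrable_affine (l : R) (v : 'rV[R]_n) (f : Rn -> R) :
  0 < l -> integrable f ->
  integrable (fun x : 'rV[R]_n => f (l *: x + v)).
Proof.
move=> l0 /integrableP[mf fi].
have mf' : measurable_fun setT f by exact/measurable_EFinP.
apply/integrableP; split.
  by apply/measurable_EFinP; exact: measurable_affine_comp.
have := @ge0_integral_affine R n l v (fun x => `|(f x)%:E|)%E l0 _ (fun=> abse_ge0 _).
move=> /= ->; last by apply/measurable_EFinP; exact: measurableT_comp.
by rewrite lte_mul_pinfty// lee_fin invr_ge0 exprn_ge0// ltW.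
Qed.

Lemma Rintegral_affine (l : R) (v : 'rV[R]_n) (f : Rn -> R) :
  0 < l -> integrable f ->
  \int[mu]_x f (l *: x + v) = (l ^+ n)^-1 * \int[mu]_x f x.
Proof.
move=> l0 fi; rewrite /Rintegral.
have -> : (\int[mu]_x (f (l *: x + v)%R)%:E =
          ((l ^+ n)^-1)%:E * \int[mu]_x (f x)%:E)%E.
  rewrite integralE [in RHS]integralE.
  have mf : measurable_fun setT (EFin \o f) by case/integrableP : fi.
  rewrite (_ : (\int[mu]_x _^\- x = ((l ^+ n)^-1)%:E * \int[mu]_x (EFin \o f)^\- x))%E; last first.
    rewrite -(ge0_integral_affine v l0 (measurable_funeneg mf)
      (fun x => funeneg_ge0 _ x)).
    by apply: eq_integral => x _; rewrite !funenegE.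
  rewrite (_ : (\int[mu]_x _^\+ x = ((l ^+ n)^-1)%:E * \int[mu]_x (EFin \o f)^\+ x))%E; last first.
    rewrite -(ge0_integral_affine v l0 (measurable_funepos mf)
      (fun x => funepos_ge0 _ x)).
    by apply: eq_integral => x _; rewrite !funeposE.
  rewrite [RHS]muleBr//.
  by rewrite fin_num_adde_defl// fin_numN; exact: integrable_neg_fin_num.
rewrite fineM//; exact: integrable_fin_num.
Qed.

Lemma rV_normP (x : 'rV[R]_n) (r : R) : 0 <= r ->
  (`|x| <= r) <-> (forall i, `|x ord0 i| <= r).
Proof.
move=> r0; rewrite (_ : `|x| = mx_norm x)// mx_normrE; split => [h i|h].
  by apply: le_trans h; exact: (le_bigmax _ (fun ij => `|x ij.1 ij.2|) (ord0, i)).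
by apply/bigmax_leP; split => // -[i j] _ /=; rewrite (ord1 i).
Qed.

Lemma coord_le_norm (x : 'rV[R]_n) i : `|x ord0 i| <= `|x|.
Proof. exact: (rV_normP x (normr_ge0 x)).1. Qed.

(** The norm of a row vector is the maximum of its coordinates in absolute
    value. *)
Lemma norm_attained (x : 'rV[R]_n) : 0 < `|x| -> exists i, `|x| = `|x ord0 i|.
Proof.
move=> x0; have [|[i' i] /= e] := @mx_norm_neq0 _ _ _ x.
  by rewrite -[mx_norm x]/(`|x|) gt_eqF.
by exists i; rewrite -[`|x|]/(mx_norm x) e (ord1 i').
Qed.

Definition cube (r : R) : set Rn := [set x : 'rV[R]_n | `|x| <= r].

Lemma measurable_cube (r : R) : measurable (cube r).
Proof.
rewrite (_ : cube r = (fun x : 'rV[R]_n => `|x|) @^-1` `]-oo, r]).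
  by rewrite -[X in measurable X]setTI; exact: measurable_norm_rV.
by apply/seteqP; split => x /=; rewrite in_itv/=.
Qed.

Lemma lebesgue_rV_cube (r : R) : 0 <= r ->
  mu (cube r) = ((2 * r) ^+ n)%:E.
Proof.
move=> r0; pose I (i : 'I_n) : set (measurableTypeR R) := `[- r, r]%classic.
rewrite (_ : cube r = [set x : Rn | forall i, I i (x ord0 i)]).
  rewrite lebesgue_rV_box; last by move=> i; exact: measurable_itv.
  rewrite (eq_bigr (fun=> (2 * r)%:E)); last first.
    move=> i _; rewrite lebesgue_measure_itv/= lte_fin.
    case: ifPn => [_|]; first by rewrite -EFinB opprK mulr_natl mulr2n.
    rewrite -leNgt => rr; congr EFin; lra.
  by rewrite prodEFin prodr_const card_ord.
apply/seteqP; split => x /= h.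
  by move=> i; rewrite /I/= in_itv/= -ler_norml; exact: (rV_normP x r0).1.
by apply/(rV_normP x r0) => i; have := h i; rewrite /I/= in_itv/= -ler_norml.
Qed.

Lemma integral_cube (r : R) : 0 <= r ->
  (\int[mu]_x (\1_(cube r) x)%:E = ((2 * r) ^+ n)%:E)%E.
Proof.
move=> r0; rewrite integral_indic//; last exact: measurable_cube.
by rewrite setIT; exact: lebesgue_rV_cube.
Qed.

(** The exponent [n.+1] is the first integer that makes this integrable; it
    will be the number of differences taken of a symbol. *)
Definition decay (x : 'rV[R]_n) : R := (1 + `|x|) ^- n.+1.

Lemma decay_gt0 x : 0 < decay x.
Proof. by rewrite invr_gt0 exprn_gt0// ltr_pwDl. Qed.

Lemma continuous_decay : continuous decay.
Proof.
have c1 : continuous (fun y : 'rV[R]_n => 1 + `|y|).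
  move=> x; have h : `|y| @[y --> x] --> `|x| by exact: norm_continuous.
  exact: (cvgD (cvg_cst (1 : R)) h).
have c2 : continuous (fun y : 'rV[R]_n => (1 + `|y|) ^+ n.+1).
  by move=> x; exact: continuous_comp (c1 x) (@exprn_continuous _ _ _).
move=> x; apply: (cvgV _ (c2 x)).
by rewrite gt_eqF// exprn_gt0// ltr_pwDl.
Qed.

(** Summing over the dyadic cubes: on the k-th one the decay beats the volume
    by the factor [2 ^ - k]. *)
Lemma integrable_decay : integrable decay.
Proof.
have md : measurable_fun setT (decay : Rn -> R).
  exact: continuous_measurable_rV continuous_decay.
apply/integrableP; split; first exact/measurable_EFinP.
pose Q k : set Rn := cube (2 ^+ k).
pose c k : R := 2 ^+ n.+1 * (2 ^+ k)^-1 ^+ n.+1.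
have c0 k : 0 <= c k by rewrite mulr_ge0 ?exprn_ge0 ?invr_ge0 ?exprn_ge0.
have mQ k : measurable_fun [set: Rn] (EFin \o \1_(Q k) : Rn -> \bar R).
  by apply/measurable_EFinP; apply: measurable_indic; exact: measurable_cube.
pose F k (x : Rn) : \bar R := ((c k)%:E * (\1_(Q k) x)%:E)%E.
have F0 k x : (0 <= F k x)%E by rewrite mule_ge0// lee_fin.
have mF k : measurable_fun setT (F k).
  by apply: measurable_funeM; exact: mQ.
apply: (@le_lt_trans _ _ (\int[mu]_x \sum_(k <oo) F k x)%E).
  apply: ge0_le_integral => //.
  - by apply: measurableT_comp => //; exact/measurable_EFinP.
  - exact: ge0_emeasurable_sum.
  move=> x _ /=; rewrite ger0_norm; last exact: ltW (decay_gt0 x).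
  have ex : exists k, `|x| <= 2 ^+ k.
    exists (Num.truncn `|x|).+1; apply: le_trans (ltW (truncnS_gt _)) _.
    by rewrite -natrX ler_nat ltnW// ltn_expl.
  (* The first dyadic cube that contains [x]: its predecessor does not, so [|x|] is
     comparable to [2 ^+ k]. *)
  case: (ex_minnP ex) => k xk kmin.
  apply: le_trans (nneseries_lim_ge k.+1 _) => //.
  rewrite big_mkord big_ord_recr/= (le_trans _ (leeDr _ _))//; last first.
    by apply: sume_ge0.
  rewrite /F indicE mem_set// mule1 lee_fin /c -exprMn /decay -[(1 + _) ^- _]exprVn.
  apply: lerXn2r; rewrite ?nnegrE ?invr_ge0 ?addr_ge0 ?mulr_ge0 ?exprn_ge0//.
  case: k xk kmin => [|k] xk kmin.
    rewrite expr0 invr1 mulr1 (@le_trans _ _ 1) ?ler1n//; last first.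
  by rewrite invf_le1 ?lerDl ?ltr_pwDl.
  rewrite exprS invfM mulrA divff ?pnatr_eq0// mul1r.
  rewrite lef_pV2 ?posrE ?exprn_gt0// ?ltr_pwDl//.
  have : 2 ^+ k < `|x|.
    by rewrite ltNge; apply/negP => /kmin; rewrite ltnn.
  by move=> h; rewrite (le_trans (ltW h))// lerDr.
rewrite integral_nneseries//.
rewrite (@eq_eseriesr _ _ (fun k => ((2 ^+ n.+1 * 2 ^+ n * 2) / (2 ^ (k + 1))%:R)%:E)); last first.
  move=> k _; rewrite /F ge0_integralZl_EFin//.
  rewrite integral_indic//; last exact: measurable_cube.
  rewrite setIT.
  transitivity ((c k)%:E * ((2 * 2 ^+ k) ^+ n)%:E)%E.
    congr (_ * _)%E; apply: lebesgue_rV_cube; by rewrite exprn_ge0.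
  rewrite -EFinM; congr EFin.
  rewrite /c natrX addn1 !exprMn exprVn !exprS.
  have : (2 ^+ k : R) ^+ n != 0 by rewrite !expf_neq0.
  have : (2 ^+ k : R) != 0 by rewrite !expf_neq0.
  by move=> h1 h2; field; rewrite h1 h2.
  exact: mQ.
have := @cvg_geometric_eseries_half R (2 ^+ n.+1 * 2 ^+ n * 2) 0.
rewrite /eseries/= => /cvg_lim -> //; exact: ltry.
Qed.

End integrals_on_rV.

(** * Complex numbers and the characters *)

Section complex_numbers.
Context {R : realType}.
Implicit Types (z w : R[i]) (t : R).

Lemma cReD z w : complex.Re (z + w) = complex.Re z + complex.Re w.
Proof. by case: z w => [a b] [c d]. Qed.
Lemma cImD z w : complex.Im (z + w) = complex.Im z + complex.Im w.
Proof. by case: z w => [a b] [c d]. Qed.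
Lemma cReM z w : complex.Re (z * w) =
  complex.Re z * complex.Re w - complex.Im z * complex.Im w.
Proof. by case: z w => [a b] [c d]. Qed.
Lemma cImM z w : complex.Im (z * w) =
  complex.Re z * complex.Im w + complex.Im z * complex.Re w.
Proof. by case: z w => [a b] [c d] /=. Qed.

Lemma complex_eq z w : complex.Re z = complex.Re w ->
  complex.Im z = complex.Im w -> z = w.
Proof. by case: z w => [a b] [c d] /= -> ->. Qed.

Lemma normc_ge0 z : 0 <= normc z.
Proof. by case: z => a b; exact: sqrtr_ge0. Qed.

Lemma Re_le_normc z : `|complex.Re z| <= normc z.
Proof.
case: z => a b /=; rewrite -(@ler_pXn2r _ 2) ?nnegrE ?sqrtr_ge0//.
by rewrite sqr_sqrtr ?addr_ge0 ?sqr_ge0// real_normK ?num_real// lerDl sqr_ge0.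
Qed.

Lemma Im_le_normc z : `|complex.Im z| <= normc z.
Proof.
case: z => a b /=; rewrite -(@ler_pXn2r _ 2) ?nnegrE ?sqrtr_ge0//.
by rewrite sqr_sqrtr ?addr_ge0 ?sqr_ge0// real_normK ?num_real// lerDr sqr_ge0.
Qed.

Lemma normc_le_ReIm z : normc z <= `|complex.Re z| + `|complex.Im z|.
Proof.
case: z => a b /=; rewrite -(@ler_pXn2r _ 2) ?nnegrE ?sqrtr_ge0 ?addr_ge0//.
rewrite sqr_sqrtr ?addr_ge0 ?sqr_ge0// sqrrD !real_normK ?num_real//.
by rewrite lerD2r lerDl mulrn_wge0// mulr_ge0.
Qed.

Lemma normc_triangle z w : normc (z + w) <= normc z + normc w.
Proof. exact: (le_normcD (z : Rcomplex R) w). Qed.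

Lemma normc_opp z : normc (- z) = normc z.
Proof. by case: z => a b /=; rewrite !sqrrN. Qed.

Lemma normc_sum (I : Type) (s : seq I) (P : pred I) (F : I -> R[i]) :
  normc (\sum_(i <- s | P i) F i) <= \sum_(i <- s | P i) normc (F i).
Proof.
elim/big_ind2 : _ => //; first by rewrite normc0.
by move=> a b c d ab cd; rewrite (le_trans (normc_triangle _ _))// lerD.
Qed.

Lemma normc_real t : normc (t%:C) = `|t|.
Proof. by rewrite /normc/= expr0n/= addr0 sqrtr_sqr. Qed.

Lemma normcX z k : normc (z ^+ k) = normc z ^+ k.
Proof. by elim: k => [|k IH]; rewrite ?expr0 ?normc1// !exprS normcM IH. Qed.

Lemma cexpiD s t : cexpi (s + t) = cexpi s * cexpi t :> R[i].
Proof.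
by apply: complex_eq; rewrite ?cReM ?cImM /= ?cosD ?sinD// addrC [X in X + _]mulrC
  [X in _ + X]mulrC.
Qed.

Lemma normc_cexpi t : normc (cexpi t) = 1.
Proof. by rewrite /cexpi/= cos2Dsin2 sqrtr1. Qed.

Lemma cexpi0 : cexpi 0 = 1 :> R[i].
Proof. by apply: complex_eq; rewrite /= ?cos0 ?sin0. Qed.

Lemma cexpi_pi : cexpi pi = - 1 :> R[i].
Proof. by apply: complex_eq; rewrite /= ?cospi ?sinpi ?oppr0. Qed.

Lemma cexpi_Npi : cexpi (- pi) = - 1 :> R[i].
Proof. by apply: complex_eq; rewrite /= ?cosN ?sinN ?cospi ?sinpi ?oppr0. Qed.

Lemma lipschitz_of_derive (f df : R -> R) (s t : R) :
  (forall x : R, is_derive x 1 f (df x)) -> (forall x, `|df x| <= 1) ->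
  `|f s - f t| <= `|s - t|.
Proof.
move=> fd df1; wlog st : s t / s <= t.
  move=> h; have [/h//|/ltW/h] := leP s t.
  by rewrite distrC [X in _ <= X]distrC.
have [c _ e] : exists2 c, c \in `[s, t] & f t - f s = df c * (t - s).
  apply: MVT_segment => //.
  apply: continuous_subspaceT => x; apply: differentiable_continuous.
  by apply/derivable1_diffP; case: (fd x).
by rewrite distrC e normrM distrC ler_piMl.
Qed.

Lemma cexpi_lipschitz s t : normc (cexpi s - cexpi t) <= 2 * `|s - t|.
Proof.
apply: le_trans (normc_le_ReIm _) _; rewrite mulr_natl mulr2n lerD//=.
- apply: (@lipschitz_of_derive _ (fun x => - sin x)) => x.
  by rewrite normrN sin_max.
- apply: (@lipschitz_of_derive _ cos) => x; exact: cos_max.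
Qed.

End complex_numbers.

(** * Measurable complex functions *)

Section complex_measurability.
Context d (T : measurableType d) (R : realType).
Implicit Types f g : T -> R[i].

Definition cmeasurable f :=
  measurable_fun setT (fun x => complex.Re (f x)) /\
  measurable_fun setT (fun x => complex.Im (f x)).

Lemma cmeasurable_normc f : cmeasurable f ->
  measurable_fun setT (fun x => normc (f x)).
Proof.
move=> [m1 m2].
rewrite (_ : (fun _ => _) = Num.sqrt \o
    (fun x => complex.Re (f x) ^+ 2 + complex.Im (f x) ^+ 2)); last first.
  by apply/funext => x /=; case: (f x).
apply: measurableT_comp; last by apply: measurable_funD; exact: measurable_funX.
exact: continuous_measurable_fun (@sqrt_continuous R).
Qed.

Lemma cmeasurable_cst z : cmeasurable (fun=> z).
Proof. by split; exact: measurable_cst. Qed.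

Lemma cmeasurableM f g : cmeasurable f -> cmeasurable g ->
  cmeasurable (fun x => f x * g x).
Proof.
move=> [f1 f2] [g1 g2]; split.
- under eq_fun do rewrite cReM.
  by apply: measurable_funB; exact: measurable_funM.
- under eq_fun do rewrite cImM.
  by apply: measurable_funD; exact: measurable_funM.
Qed.

Lemma cmeasurable_cexpi (h : T -> R) : measurable_fun setT h ->
  cmeasurable (fun x => cexpi (h x)).
Proof.
move=> mh; split => /=; apply: measurableT_comp => //;
  apply: continuous_measurable_fun; [exact: continuous_cos|exact: continuous_sin].
Qed.

End complex_measurability.

Lemma cmeasurable_comp d1 d2 (T1 : measurableType d1) (T2 : measurableType d2)
    (R : realType) (f : T2 -> R[i]) (h : T1 -> T2) :
  cmeasurable f -> measurable_fun setT h -> cmeasurable (f \o h).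
Proof.
move=> [f1 f2] mh; split.
- exact: (measurableT_comp f1 mh).
- exact: (measurableT_comp f2 mh).
Qed.

(** * Integrals of complex functions *)

Section complex_integrals.
Context {R : realType} {n : nat}.
Local Notation Rn := 'rV[measurableTypeR R]_n.
Local Notation mu := (@lebesgue_rV R n).
Local Notation integrable f := (mu.-integrable setT (EFin \o f)).
Implicit Types (f g : 'rV[R]_n -> R[i]) (h : 'rV[R]_n -> R).

Lemma cintegrable_measurable f : cintegrable f -> cmeasurable (f : Rn -> R[i]).
Proof. by case=> /integrableP[/measurable_EFinP ? _] /integrableP[/measurable_EFinP ? _]. Qed.

Lemma integrable_dominated h (b : Rn -> R) : measurable_fun [set: Rn] h ->
  (forall x, `|h x| <= b x) -> integrable b -> integrable h.
Proof.
move=> mh hb ib; apply: (le_integrable measurableT _ _ ib).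
  exact/measurable_EFinP.
by move=> x _ /=; rewrite lee_fin (le_trans (hb x))// ler_norm.
Qed.

Lemma cintegrable_dominated f (b : Rn -> R) : cmeasurable (f : Rn -> R[i]) ->
  (forall x, normc (f x) <= b x) -> integrable b -> cintegrable f.
Proof.
move=> [m1 m2] fb ib; split.
- apply: (integrable_dominated m1 _ ib) => x.
  exact: le_trans (Re_le_normc _) (fb x).
- apply: (integrable_dominated m2 _ ib) => x.
  exact: le_trans (Im_le_normc _) (fb x).
Qed.

Lemma cintegrable_normc f : cintegrable f -> integrable (fun x => normc (f x)).
Proof.
move=> fi; have mf := cintegrable_measurable fi; case: fi => f1 f2.
apply: (integrable_dominated (b := fun x => `|complex.Re (f x)| + `|complex.Im (f x)|)).
- exact: cmeasurable_normc.
- by move=> x; rewrite ger0_norm ?normc_ge0// normc_le_ReIm.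
- rewrite (_ : _ \o _ = (fun x => `|(complex.Re (f x))%:E| + `|(complex.Im (f x))%:E|)%E)//.
  by apply: integrableD => //; exact: integrable_abse.
Qed.

(** Real and imaginary parts are estimated separately; this costs the factor
    2. *)
Lemma normc_cintegral_le f (b : Rn -> R) : cintegrable f ->
  (forall x, normc (f x) <= b x) -> integrable b ->
  normc (cintegral f) <= 2 * \int[mu]_x b x.
Proof.
move=> [f1 f2] fb ib; apply: le_trans (normc_le_ReIm _) _ => /=.
rewrite mulr_natl mulr2n lerD//.
- apply: (le_trans (le_normr_Rintegral _ f1)) => //.
  apply: le_Rintegral => //; first exact: (integrable_norm f1).
  by move=> x _; exact: le_trans (Re_le_normc _) (fb x).
- apply: (le_trans (le_normr_Rintegral _ f2)) => //.
  apply: le_Rintegral => //; first exact: (integrable_norm f2).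
  by move=> x _; exact: le_trans (Im_le_normc _) (fb x).
Qed.

Lemma cintegrableD f g : cintegrable f -> cintegrable g ->
  cintegrable (fun x => f x + g x).
Proof.
move=> [f1 f2] [g1 g2]; split.
- under eq_fun do rewrite cReD EFinD; exact: integrableD.
- under eq_fun do rewrite cImD EFinD; exact: integrableD.
Qed.

Lemma cintegralD f g : cintegrable f -> cintegrable g ->
  cintegral (fun x => f x + g x) = cintegral f + cintegral g.
Proof.
move=> [f1 f2] [g1 g2]; apply: complex_eq; rewrite ?cReD ?cImD/=.
- by under eq_Rintegral do rewrite cReD; rewrite RintegralD.
- by under eq_Rintegral do rewrite cImD; rewrite RintegralD.
Qed.

Lemma cintegrableZ (c : R[i]) f : cintegrable f -> cintegrable (fun x => c * f x).
Proof.
move=> [f1 f2]; split.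
- under eq_fun do rewrite cReM EFinB !EFinM.
  by apply: integrableB => //; exact: integrableZl.
- under eq_fun do rewrite cImM EFinD !EFinM.
  by apply: integrableD => //; exact: integrableZl.
Qed.

Lemma cintegralZ (c : R[i]) f : cintegrable f ->
  cintegral (fun x => c * f x) = c * cintegral f.
Proof.
move=> [f1 f2].
have i1 a : integrable (fun x => a * complex.Re (f x)).
  by under [_ \o _]eq_fun do rewrite /= EFinM; exact: integrableZl.
have i2 a : integrable (fun x => a * complex.Im (f x)).
  by under [_ \o _]eq_fun do rewrite /= EFinM; exact: integrableZl.
apply: complex_eq; rewrite ?cReM ?cImM/=.
- under eq_Rintegral do rewrite cReM.
  by rewrite RintegralB// !RintegralZl.
- under eq_Rintegral do rewrite cImM.
  by rewrite RintegralD// !RintegralZl.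
Qed.

Lemma eq_cintegral f g : f =1 g -> cintegral f = cintegral g.
Proof. by move=> /funext ->. Qed.

Lemma cintegral0 : cintegral (fun _ : 'rV[R]_n => 0 : R[i]) = 0.
Proof.
by apply: complex_eq; rewrite /= /Rintegral integral0.
Qed.

Lemma cintegrable0 : cintegrable (fun _ : 'rV[R]_n => 0 : R[i]).
Proof. by split; exact: integrable0. Qed.

Lemma cintegrable_sum (I : Type) (s : seq I) (F : I -> 'rV[R]_n -> R[i]) :
  (forall i, cintegrable (F i)) -> cintegrable (fun x => \sum_(i <- s) F i x).
Proof.
move=> iF; elim: s => [|i s IH].
  by under eq_fun do rewrite big_nil; exact: cintegrable0.
by under eq_fun do rewrite big_cons; exact: cintegrableD.
Qed.

Lemma cintegral_sum (I : Type) (s : seq I) (F : I -> 'rV[R]_n -> R[i]) :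
  (forall i, cintegrable (F i)) ->
  cintegral (fun x => \sum_(i <- s) F i x) = \sum_(i <- s) cintegral (F i).
Proof.
move=> iF; elim: s => [|i s IH].
  by rewrite big_nil -[RHS]cintegral0; apply: eq_cintegral => x; rewrite big_nil.
rewrite big_cons -IH -cintegralD//; last exact: cintegrable_sum.
by apply: eq_cintegral => x; rewrite big_cons.
Qed.

Lemma cintegrable_affine (l : R) (v : 'rV[R]_n) f : 0 < l -> cintegrable f ->
  cintegrable (fun x => f (l *: x + v)).
Proof.
move=> l0 [f1 f2]; split.
- exact: (integrable_affine v l0 f1).
- exact: (integrable_affine v l0 f2).
Qed.

Lemma cintegral_affine (l : R) (v : 'rV[R]_n) f : 0 < l -> cintegrable f ->
  cintegral (fun x => f (l *: x + v)) = ((l ^+ n)^-1)%:C * cintegral f.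
Proof.
move=> l0 [f1 f2]; apply: complex_eq; rewrite ?cReM ?cImM/= ?mul0r ?subr0 ?addr0.
- exact: (Rintegral_affine v l0 f1).
- exact: (Rintegral_affine v l0 f2).
Qed.

(** A product majorant gives at once joint integrability and, for every value
    of one variable, integrability in the other, so that no exceptional null
    set occurs. *)
Lemma Rintegral_fubini (F : Rn * Rn -> R) (a b : Rn -> R) :
  measurable_fun setT F -> (forall x y, `|F (x, y)| <= a x * b y) ->
  integrable a -> integrable b ->
  integrable (fun x => \int[mu]_y F (x, y)) /\
  \int[mu]_x \int[mu]_y F (x, y) = \int[mu]_y \int[mu]_x F (x, y).
Proof.
move=> mF Fab ia ib.
have mFE : measurable_fun setT (EFin \o F) by exact/measurable_EFinP.
have Fx x : integrable (fun y => F (x, y)).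
  apply: (@integrable_dominated _ (fun y => a x * b y)) => //.
    exact: (measurable_fun_pair2 _ mF).
  by under [_ \o _]eq_fun do rewrite /= EFinM; exact: integrableZl.
have Fy y : integrable (fun x => F (x, y)).
  apply: (@integrable_dominated _ (fun x => a x * b y)) => //.
    exact: (measurable_fun_pair1 _ mF).
  by under [_ \o _]eq_fun do rewrite /= mulrC EFinM; exact: integrableZl.
have iF : (mu \x mu)%E.-integrable setT (EFin \o F).
  apply/integrable12ltyP => //.
  apply: (@le_lt_trans _ _ (\int[mu]_x (`|a x| * fine (\int[mu]_y `|(b y)%:E|))%:E)%E).
    apply: ge0_le_integral => //.
    - by move=> x _; exact: integral_ge0.
    - apply: (measurable_fun_fubini_tonelli_F (m2 := mu) (fun z => `|(F z)%:E|)%E) => //.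
      exact: measurableT_comp.
    - case/integrableP : ia => /measurable_EFinP ma _.
      apply/measurable_EFinP; apply: measurable_funM => //.
      exact: measurableT_comp.
    move=> x _; rewrite EFinM fineK; last first.
      by apply: (integrable_fin_num measurableT); exact: (integrable_abse ib).
    rewrite -ge0_integralZl_EFin//; last first.
      by apply: measurableT_comp => //; case/integrableP : ib.
    apply: ge0_le_integral => //.
    - apply: measurableT_comp => //; apply: (measurableT_comp mFE).
      exact: pair1_measurable.
    - apply: measurable_funeM; apply: measurableT_comp => //.
      by case/integrableP : ib.
    - by move=> y _ /=; rewrite lee_fin -normrM (le_trans (Fab x y))// ler_norm.
  under eq_integral do rewrite EFinM muleC.
  have ia' : (mu.-integrable setT (fun x => `|(a x)%:E|))%E by exact: (integrable_abse ia).
  have := integrableZl measurableT (fine (\int[mu]_y `|(b y)%:E|)) ia'.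
  move/(integrable_fin_num measurableT).
  by rewrite fin_numElt => /andP[].
have E1 x : (\int[mu]_y F (x, y))%:E = (\int[mu]_y (F (x, y))%:E)%E.
  by rewrite /Rintegral fineK//; apply: (integrable_fin_num measurableT); exact: Fx.
have E2 y : (\int[mu]_x F (x, y))%:E = (\int[mu]_x (F (x, y))%:E)%E.
  by rewrite /Rintegral fineK//; apply: (integrable_fin_num measurableT); exact: Fy.
split.
  rewrite (_ : _ \o _ = fubini_F mu (EFin \o F)); last by apply/funext => x; exact: E1.
  exact: integrable_fubini_F.
rewrite [LHS]/Rintegral [RHS]/Rintegral; congr fine.
under eq_integral do rewrite E1; under [in RHS]eq_integral do rewrite E2.
exact: (Fubini iF).
Qed.

Lemma cintegral_fubini (F : Rn * Rn -> R[i]) (a b : Rn -> R) :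
  cmeasurable F -> (forall x y, normc (F (x, y)) <= a x * b y) ->
  integrable a -> integrable b ->
  cintegrable (fun x => cintegral (fun y => F (x, y))) /\
  cintegral (fun x => cintegral (fun y => F (x, y))) =
  cintegral (fun y => cintegral (fun x => F (x, y))).
Proof.
move=> [m1 m2] Fab ia ib.
have [i1 e1] := @Rintegral_fubini (fun z => complex.Re (F z)) a b m1
  (fun x y => le_trans (Re_le_normc _) (Fab x y)) ia ib.
have [i2 e2] := @Rintegral_fubini (fun z => complex.Im (F z)) a b m2
  (fun x y => le_trans (Im_le_normc _) (Fab x y)) ia ib.
by split; [split|apply: complex_eq].
Qed.

End complex_integrals.

(** * The Fourier integral *)

Section dot_product.
Context {R : realType} {n : nat}.
Implicit Types x y z : 'rV[R]_n.

Lemma dotrVC x y : dotrV x y = dotrV y x.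
Proof. by apply: eq_bigr => i _; rewrite mulrC. Qed.
Lemma dotrVDl x y z : dotrV (x + y) z = dotrV x z + dotrV y z.
Proof. by rewrite /dotrV -big_split; apply: eq_bigr => i _; rewrite !mxE mulrDl. Qed.
Lemma dotrVZl (l : R) x z : dotrV (l *: x) z = l * dotrV x z.
Proof. by rewrite /dotrV mulr_sumr; apply: eq_bigr => i _; rewrite !mxE mulrA. Qed.
Lemma dotrVDr x y z : dotrV z (x + y) = dotrV z x + dotrV z y.
Proof. by rewrite dotrVC dotrVDl !(dotrVC z). Qed.
Lemma dotrVZr (l : R) x z : dotrV z (l *: x) = l * dotrV z x.
Proof. by rewrite dotrVC dotrVZl (dotrVC z). Qed.
Lemma dotrV0l x : dotrV 0 x = 0.
Proof. by rewrite -(scale0r 0) dotrVZl mul0r. Qed.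
Lemma dotrVNl x y : dotrV (- x) y = - dotrV x y.
Proof. by rewrite -scaleN1r dotrVZl mulN1r. Qed.
Lemma dotrV_delta x i : dotrV x (delta_mx ord0 i) = x ord0 i.
Proof.
rewrite /dotrV (bigD1 i)//= mxE !eqxx mulr1 big1 ?addr0// => j ji.
by rewrite mxE eqxx (negbTE ji) mulr0.
Qed.
Lemma dotrV_le x y : `|dotrV x y| <= n%:R * (`|x| * `|y|).
Proof.
apply: le_trans (ler_norm_sum _ _ _) _.
rewrite -[X in X%:R](card_ord n) mulr_natl -sumr_const; apply: ler_sum => i _.
by rewrite normrM ler_pM// coord_le_norm.
Qed.

End dot_product.

Lemma measurable_dotrV (R : realType) (n : nat) :
  measurable_fun [set: 'rV[measurableTypeR R]_n * 'rV[measurableTypeR R]_n]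
    (fun z => dotrV (z.1 : 'rV[R]_n) z.2).
Proof.
apply: measurable_sum => i; apply: measurable_funM.
- exact: (measurableT_comp (measurable_coord i) measurable_fst).
- exact: (measurableT_comp (measurable_coord i) measurable_snd).
Qed.

Section fourier_basics.
Context {R : realType} {n : nat}.
Local Notation Rn := 'rV[measurableTypeR R]_n.
Local Notation mu := (@lebesgue_rV R n).
Local Notation integrable f := (mu.-integrable setT (EFin \o f)).
Implicit Types (f g m u : 'rV[R]_n -> R[i]).

Lemma measurable_dotrV1 (x : 'rV[R]_n) :
  measurable_fun [set: Rn] (fun y : 'rV[R]_n => dotrV x y).
Proof.
by apply: measurable_sum => i; apply: measurable_funM => //; exact: measurable_coord.
Qed.

Lemma cintegrable_bounded f g (M : R) : cmeasurable (g : Rn -> R[i]) ->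
  (forall x, normc (g x) <= M) -> cintegrable f ->
  cintegrable (fun x => f x * g x).
Proof.
move=> mg gM fi.
apply: (@cintegrable_dominated _ _ _ (fun x => M * normc (f x))).
- by apply: cmeasurableM => //; exact: cintegrable_measurable.
- by move=> x; rewrite normcM mulrC ler_wpM2r ?normc_ge0.
- under [_ \o _]eq_fun do rewrite /= EFinM.
  by apply: integrableZl => //; exact: cintegrable_normc.
Qed.

Lemma cintegrable_char f (h : Rn -> R) : measurable_fun setT h ->
  cintegrable f -> cintegrable (fun x => f x * cexpi (h x)).
Proof.
move=> mh fi; apply: (@cintegrable_bounded _ _ 1) => //.
  exact: cmeasurable_cexpi.
by move=> x; rewrite normc_cexpi.
Qed.

Lemma cintegrable_inv_fourier f x : cintegrable f ->
  cintegrable (fun xi => f xi * cexpi (2 * pi * dotrV x xi)).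
Proof.
by move=> fi; apply: cintegrable_char => //; apply: measurable_funM => //;
  exact: measurable_dotrV1.
Qed.

Lemma fourierE f x : fourier f x = inv_fourier f (- x).
Proof.
apply: eq_cintegral => y; rewrite dotrVNl mulrN (dotrVC x); congr (_ * cexpi _).
Qed.

Lemma inv_fourier0 f : inv_fourier f 0 = cintegral f.
Proof. by apply: eq_cintegral => x; rewrite dotrV0l mulr0 cexpi0 mulr1. Qed.

Lemma inv_fourier_translate m v x : cintegrable m ->
  inv_fourier (fun xi => m (xi + v)) x =
  cexpi (- (2 * pi * dotrV x v)) * inv_fourier m x.
Proof.
move=> im.
have h : cintegrable (fun xi => cexpi (- (2 * pi * dotrV x v)) *
    (m xi * cexpi (2 * pi * dotrV x xi))).
  by apply: cintegrableZ; exact: cintegrable_inv_fourier.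
have := cintegral_affine v (@ltr01 R) h.
rewrite expr1n invr1 mul1r [X in _ = X -> _]cintegralZ; last exact: cintegrable_inv_fourier.
move=> <-; apply: eq_cintegral => xi; rewrite scale1r dotrVDr mulrCA -cexpiD.
by congr (_ * cexpi _); ring.
Qed.

Lemma inv_fourier_dilate (t : R) m x : 0 < t -> cintegrable m ->
  inv_fourier (fun xi => m (t^-1 *: xi)) x = (t ^+ n)%:C * inv_fourier m (t *: x).
Proof.
move=> t0 im.
have ti0 : 0 < t^-1 by rewrite invr_gt0.
have h : cintegrable (fun xi => m xi * cexpi (2 * pi * dotrV (t *: x) xi)).
  exact: cintegrable_inv_fourier.
have := cintegral_affine 0 ti0 h.
rewrite exprVn invrK => <-; apply: eq_cintegral => xi.
rewrite addr0 dotrVZl dotrVZr; congr (_ * cexpi _); field.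
by rewrite gt_eqF.
Qed.

Lemma normc_inv_fourier_le m (b : Rn -> R) x : cmeasurable (m : Rn -> R[i]) ->
  (forall y, normc (m y) <= b y) -> integrable b ->
  normc (inv_fourier m x) <= 2 * \int[mu]_y b y.
Proof.
move=> mm mb ib; apply: normc_cintegral_le => //.
  by apply: cintegrable_inv_fourier; apply: (cintegrable_dominated mm mb ib).
by move=> y; rewrite normcM normc_cexpi mulr1.
Qed.

(** Every exchange of integrals below concerns two functions coupled by a
    unimodular kernel. *)
Lemma cintegral_char_swap u m (k : Rn * Rn -> R) : measurable_fun setT k ->
  cintegrable u -> cintegrable m ->
  cintegrable (fun x => u x * cintegral (fun y => m y * cexpi (k (x, y)))) /\
  cintegral (fun x => u x * cintegral (fun y => m y * cexpi (k (x, y)))) =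
  cintegral (fun y => m y * cintegral (fun x => u x * cexpi (k (x, y)))).
Proof.
move=> mk iu im.
have mF : cmeasurable (fun z : Rn * Rn => u z.1 * m z.2 * cexpi (k z)).
  apply: cmeasurableM; last exact: cmeasurable_cexpi.
  apply: cmeasurableM.
  - exact: (cmeasurable_comp (cintegrable_measurable iu) measurable_fst).
  - exact: (cmeasurable_comp (cintegrable_measurable im) measurable_snd).
have [] := @cintegral_fubini _ _ _ (fun x => normc (u x)) (fun y => normc (m y)) mF.
- by move=> x y /=; rewrite !normcM normc_cexpi mulr1.
- exact: cintegrable_normc.
- exact: cintegrable_normc.
have -> : (fun x => cintegral (fun y => u (x, y).1 * m (x, y).2 * cexpi (k (x, y)))) =
    (fun x => u x * cintegral (fun y => m y * cexpi (k (x, y)))).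
  apply/funext => x; rewrite -cintegralZ; last first.
    by apply: cintegrable_char => //; exact: (measurable_fun_pair2 _ mk).
  by apply: eq_cintegral => y /=; rewrite mulrA.
move=> h ->; split => //; apply: eq_cintegral => y.
rewrite -cintegralZ; last first.
  by apply: cintegrable_char => //; exact: (measurable_fun_pair1 _ mk).
by apply: eq_cintegral => x /=; rewrite mulrA (mulrC (u x)).
Qed.

Lemma cintegral_fourier_swap u m : cintegrable u -> cintegrable m ->
  cintegral (fun x => u x * fourier m x) = cintegral (fun x => fourier u x * m x).
Proof.
move=> iu im.
have mk : measurable_fun setT (fun z : Rn * Rn => - (2 * pi * dotrV (z.2 : 'rV[R]_n) z.1)).
  apply: measurable_funN; apply: measurable_funM => //.
  under eq_fun do rewrite dotrVC; exact: measurable_dotrV.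
have [_ ->] := cintegral_char_swap mk iu im.
apply: eq_cintegral => y; rewrite mulrC; congr (_ * _).
by apply: eq_cintegral => x /=; rewrite dotrVC.
Qed.

Lemma cintegral_inv_fourier_swap u m : cintegrable u -> cintegrable m ->
  cintegral (fun x => u x * inv_fourier m x) =
  cintegral (fun x => inv_fourier u x * m x).
Proof.
move=> iu im.
have mk : measurable_fun setT (fun z : Rn * Rn => 2 * pi * dotrV (z.1 : 'rV[R]_n) z.2).
  by apply: measurable_funM => //; exact: measurable_dotrV.
have [_ ->] := cintegral_char_swap mk iu im.
apply: eq_cintegral => y; rewrite mulrC; congr (_ * _).
by apply: eq_cintegral => x /=; rewrite dotrVC.
Qed.

Lemma lipschitz_continuous_rV (h : 'rV[R]_n -> R) (L : R) :
  (forall x y, `|h x - h y| <= L * `|x - y|) -> continuous h.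
Proof.
move=> hL x U /nbhs_ballP[e /= e0 eU].
have L0 : 0 < `|L| + 1 by rewrite ltr_wpDl.
apply/nbhs_ballP; exists (e / (`|L| + 1)); first by rewrite /= divr_gt0.
move=> y; rewrite mx_norm_ball /ball_/= ltr_pdivlMr// => xy.
apply: eU; rewrite /ball/=; apply: (le_lt_trans (hL x y)).
apply: le_lt_trans xy; rewrite mulrC ler_wpM2l//.
by rewrite (le_trans (ler_norm _))// lerDl.
Qed.

Lemma ccontinuous_lipschitz f (L : R) :
  (forall x y, normc (f x - f y) <= L * `|x - y|) -> ccontinuous f.
Proof.
move=> fL; split; apply: (@lipschitz_continuous_rV _ L) => x y;
  apply: le_trans (fL x y).
- have -> : complex.Re (f x) - complex.Re (f y) = complex.Re (f x - f y).
    by case: (f x) (f y) => [a b] [c d].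
  exact: Re_le_normc.
- have -> : complex.Im (f x) - complex.Im (f y) = complex.Im (f x - f y).
    by case: (f x) (f y) => [a b] [c d].
  exact: Im_le_normc.
Qed.

Lemma ccontinuous_measurable f : ccontinuous f -> cmeasurable (f : Rn -> R[i]).
Proof. by move=> [f1 f2]; split; exact: continuous_measurable_rV. Qed.

(** On a bounded support the characters are Lipschitz in [x], uniformly in
    [xi]. *)
Lemma ccontinuous_inv_fourier m (B : R) : cintegrable m ->
  (forall xi, B < `|xi| -> m xi = 0) -> ccontinuous (inv_fourier m).
Proof.
move=> im mB; pose C := 2 * (2 * (2 * pi)) * n%:R * `|B|.
apply: (@ccontinuous_lipschitz _ (C * \int[mu]_xi normc (m xi))) => x y.
pose F xi := m xi * cexpi (2 * pi * dotrV x xi).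
pose G xi := m xi * cexpi (2 * pi * dotrV y xi).
have iF : cintegrable F by exact: cintegrable_inv_fourier.
have iG : cintegrable G by exact: cintegrable_inv_fourier.
have iG1 := cintegrableZ (-1) iG.
have -> : inv_fourier m x - inv_fourier m y = cintegral (fun xi => F xi + - 1 * G xi).
  by rewrite cintegralD// cintegralZ// mulN1r.
have ic := cintegrable_normc im.
apply: le_trans (normc_cintegral_le (cintegrableD iF iG1)
    (b := fun xi => (C / 2 * `|x - y|) * normc (m xi)) _ _) _.
- move=> xi; rewrite mulN1r /F /G -mulrBr normcM mulrC.
  have [xiB|/mB->] := leP `|xi| B; last by rewrite normc0 !mulr0.
  rewrite ler_wpM2r ?normc_ge0//; apply: le_trans (cexpi_lipschitz _ _) _.
  rewrite -mulrBr -dotrVNl -dotrVDl normrM ger0_norm; last first.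
    by rewrite mulr_ge0// pi_ge0.
  apply: (@le_trans _ _ (2 * (2 * pi * (n%:R * (`|x - y| * `|B|))))).
    rewrite ler_wpM2l// ler_wpM2l ?mulr_ge0 ?pi_ge0//.
    apply: le_trans (dotrV_le _ _) _; rewrite ler_wpM2l// ler_wpM2l//.
    exact: le_trans xiB (ler_norm _).
  by rewrite le_eqVlt; apply/orP; left; apply/eqP; rewrite /C; field.
- by under [_ \o _]eq_fun do rewrite /= EFinM; exact: integrableZl.
- rewrite RintegralZl//.
  by rewrite le_eqVlt; apply/orP; left; apply/eqP; rewrite /C; field.
Qed.

End fourier_basics.

(** * Fourier inversion up to a constant *)

Section cube_majorants.
Context {R : realType} {n : nat}.
Local Notation Rn := 'rV[measurableTypeR R]_n.
Local Notation mu := (@lebesgue_rV R n).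
Local Notation integrable f := (mu.-integrable setT (EFin \o f)).

Lemma integrable_cube (M r : R) : 0 <= r ->
  integrable (fun x : Rn => M * \1_(cube r) x).
Proof.
move=> r0; under [_ \o _]eq_fun do rewrite /= EFinM.
apply: integrableZl => //; apply/integrableP; split.
  by apply/measurable_EFinP; apply: measurable_indic; exact: measurable_cube.
by under eq_integral do rewrite gee0_abs ?lee_fin//; rewrite integral_cube// ltry.
Qed.

Lemma Rintegral_cube (M r : R) : 0 <= r ->
  \int[mu]_x (M * \1_(cube r : set Rn) x) = M * (2 * r) ^+ n.
Proof.
move=> r0; have := @integrable_cube 1 r r0.
under [_ \o _]eq_fun do rewrite /= mul1r.
move=> i; rewrite RintegralZl//; congr (_ * _).
by rewrite /Rintegral integral_cube.
Qed.

Lemma Rintegral_gt0 (h : 'rV[R]_n -> R) (x0 : 'rV[R]_n) : continuous h ->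
  (forall x, 0 <= h x) -> integrable h -> 0 < h x0 -> 0 < \int[mu]_x h x.
Proof.
move=> ch h0 ih hx0.
have /nbhs_ballP[e /= e0 eU] : nbhs x0 [set x | h x0 / 2 < h x].
  apply: (ch x0 [set y | h x0 / 2 < y]).
  by apply: open_nbhs_nbhs; split; [exact: open_gt|rewrite /=; lra].
have e20 : 0 < e / 2 by rewrite divr_gt0.
have ih' := integrable_affine x0 ltr01 ih.
have := Rintegral_affine x0 ltr01 ih; rewrite expr1n invr1 mul1r => <-.
apply: (@lt_le_trans _ _ (h x0 / 2 * (2 * (e / 2)) ^+ n)).
  by rewrite mulr_gt0 ?exprn_gt0 ?divr_gt0 ?mulr_gt0.
rewrite -Rintegral_cube ?(ltW e20)//; apply: le_Rintegral => //.
  by apply: integrable_cube; exact: ltW.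
move=> x _; rewrite indicE; case: (boolP (x \in _)) => [|_]; last by rewrite mulr0.
rewrite inE /cube/= mulr1 => xe; apply/ltW; apply: eU.
rewrite mx_norm_ball /ball_/= scale1r opprD addrCA subrr addr0 normrN.
by apply: le_lt_trans xe _; rewrite ltr_pdivrMr// ltr_pMr// ltr1n.
Qed.

End cube_majorants.

Section inversion.
Context {R : realType} {n : nat}.
Local Notation Rn := 'rV[measurableTypeR R]_n.
Local Notation mu := (@lebesgue_rV R n).
Local Notation integrable f := (mu.-integrable setT (EFin \o f)).
Implicit Types (f g m u b : 'rV[R]_n -> R[i]).

Lemma cvg_dilate0 (x : 'rV[R]_n) (h : 'rV[R]_n -> R) : continuous h ->
  h (k.+1%:R^-1 *: x) @[k --> \oo] --> h 0.
Proof.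
move=> ch; apply/cvgrPdist_lt => e e0.
have /nbhs_ballP[d /= d0 dU] : nbhs (0 : 'rV[R]_n) [set x | `|h 0 - h x| < e].
  by apply: (ch 0 [set y | `|h 0 - y| < e]); apply: nbhsx_ballx.
have x1 : 0 < `|x| + 1 by rewrite ltr_wpDl.
near=> k; apply: dU; rewrite mx_norm_ball /ball_/= sub0r normrN normrZ.
rewrite ger0_norm ?invr_ge0//.
apply: (@le_lt_trans _ _ (k.+1%:R^-1 * (`|x| + 1))).
  by rewrite ler_wpM2l ?invr_ge0// lerDl.
rewrite -ltr_pdivlMr//; near: k; exact: (near_infty_natSinv_lt (PosNum (divr_gt0 d0 x1))).
Unshelve. all: by end_near. Qed.

Lemma cvg_Rintegral (F : nat -> 'rV[R]_n -> R) (G : 'rV[R]_n -> R) (a : Rn -> R) :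
  (forall k, measurable_fun [set: Rn] (F k)) -> measurable_fun [set: Rn] G ->
  (forall x, F k x @[k --> \oo] --> G x) ->
  (forall k x, `|F k x| <= a x) -> integrable a ->
  \int[mu]_x F k x @[k --> \oo] --> \int[mu]_x G x.
Proof.
move=> mF mG FG Fa ia.
have [] := @dominated_convergence _ _ R mu setT measurableT
  (fun k => EFin \o F k) (EFin \o G) (EFin \o a).
- by move=> k; exact/measurable_EFinP.
- exact/measurable_EFinP.
- apply: nearW => x _; apply: cvg_comp; first exact: FG.
  exact: cvg_id.
- exact: ia.
- by apply: nearW => x k _ /=; rewrite lee_fin.
move=> iG _ h; rewrite /Rintegral; apply: fine_cvg.
rewrite fineK; last exact: (integrable_fin_num measurableT iG).
exact: h.
Qed.

Lemma cvg_cintegral_dilate u b (M : R) : cintegrable u -> ccontinuous b ->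
  (forall x, normc (b x) <= M) ->
  (complex.Re (cintegral (fun x => u x * b (k.+1%:R^-1 *: x))) @[k --> \oo]
    --> complex.Re (cintegral u * b 0)) /\
  (complex.Im (cintegral (fun x => u x * b (k.+1%:R^-1 *: x))) @[k --> \oo]
    --> complex.Im (cintegral u * b 0)).
Proof.
move=> iu [cb1 cb2] bM.
have mu_ := cintegrable_measurable iu.
have mb : cmeasurable (b : Rn -> R[i]) by exact: ccontinuous_measurable.
have mbk k : cmeasurable (fun x : Rn => b (k.+1%:R^-1 *: x)).
  split.
  - have := measurable_affine_comp (k.+1%:R^-1) 0 mb.1.
    by under eq_fun do rewrite addr0.
  - have := measurable_affine_comp (k.+1%:R^-1) 0 mb.2.
    by under eq_fun do rewrite addr0.
have mF k := cmeasurableM mu_ (mbk k).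
have mG := cmeasurableM mu_ (cmeasurable_cst Rn (b 0)).
have ia : integrable (fun x => M * normc (u x)).
  under [_ \o _]eq_fun do rewrite /= EFinM.
  by apply: integrableZl => //; exact: cintegrable_normc.
have Fa k x : normc (u x * b (k.+1%:R^-1 *: x)) <= M * normc (u x).
  by rewrite normcM mulrC ler_wpM2r ?normc_ge0.
have -> : cintegral u * b 0 = cintegral (fun x => u x * b 0).
  by rewrite mulrC -cintegralZ//; apply: eq_cintegral => x; rewrite mulrC.
split.
- apply: (@cvg_Rintegral (fun k x => complex.Re (u x * b (k.+1%:R^-1 *: x)))
    (fun x => complex.Re (u x * b 0)) (fun x => M * normc (u x))) => //.
  + by move=> k; exact: (mF k).1.
  + exact: mG.1.
  + move=> x; under eq_fun do rewrite cReM; rewrite cReM.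
    exact: (cvgB (cvgM (cvg_cst _) (cvg_dilate0 x cb1))
                 (cvgM (cvg_cst _) (cvg_dilate0 x cb2))).
  + by move=> k x; exact: le_trans (Re_le_normc _) (Fa k x).
- apply: (@cvg_Rintegral (fun k x => complex.Im (u x * b (k.+1%:R^-1 *: x)))
    (fun x => complex.Im (u x * b 0)) (fun x => M * normc (u x))) => //.
  + by move=> k; exact: (mF k).2.
  + exact: mG.2.
  + move=> x; under eq_fun do rewrite cImM; rewrite cImM.
    exact: (cvgD (cvgM (cvg_cst _) (cvg_dilate0 x cb2))
                 (cvgM (cvg_cst _) (cvg_dilate0 x cb1))).
  + by move=> k x; exact: le_trans (Im_le_normc _) (Fa k x).
Qed.

(** The class of symbols for which inversion is elementary: no derivative is
    involved, and the class is stable under translations, dilations and linear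
    combinations. *)
Definition nice m := [/\ ccontinuous m,
  exists M : R, forall xi, normc (m xi) <= M,
  exists B : R, forall xi, B < `|xi| -> m xi = 0 &
  cintegrable (inv_fourier m)].

Lemma compact_cintegrable m (M B : R) : ccontinuous m ->
  (forall xi, normc (m xi) <= M) -> (forall xi, B < `|xi| -> m xi = 0) ->
  cintegrable m.
Proof.
move=> cm mM mB; apply: (cintegrable_dominated (ccontinuous_measurable cm)
  (b := fun x => M * \1_(cube `|B|) x)); last exact: integrable_cube.
move=> x; rewrite indicE; case: (boolP (x \in _)) => [_|]; first by rewrite mulr1.
rewrite notin_setE /cube/= => /negP; rewrite -ltNge => Bx.
by rewrite mulr0 mB ?normc0// (le_lt_trans (ler_norm _)).
Qed.

Lemma nice_cintegrable m : nice m -> cintegrable m.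
Proof. by case=> cm [M mM] [B mB] _; exact: compact_cintegrable mM mB. Qed.

Lemma nice_translate m (v : 'rV[R]_n) : nice m -> nice (fun xi => m (xi + v)).
Proof.
move=> nm; have im := nice_cintegrable nm; case: nm => -[c1 c2] [M mM] [B mB] ii.
have ct (h : 'rV[R]_n -> R) : continuous h -> continuous (fun x : 'rV[R]_n => h (x + v)).
  move=> ch x U /(ch _)/nbhs_ballP[e /= e0 eU].
  apply/nbhs_ballP; exists e => // y; rewrite mx_norm_ball /ball_/= => xy.
  by apply: eU; rewrite mx_norm_ball /ball_/= opprD addrACA subrr addr0.
split.
- by split; apply: (ct (fun x => _ (m x))).
- by exists M.
- exists (B + `|v|) => xi h; apply: mB.
  by rewrite -ltrBrDr in h; apply: (lt_le_trans h); rewrite lerBlDr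
    (le_trans _ (ler_normB _ _))// addrK.
- have -> : inv_fourier (fun xi => m (xi + v)) =
      (fun x => inv_fourier m x * cexpi (- (2 * pi * dotrV x v))).
    by apply/funext => x; rewrite inv_fourier_translate// mulrC.
  apply: cintegrable_char => //; apply: measurable_funN; apply: measurable_funM => //.
  by under eq_fun do rewrite dotrVC; exact: measurable_dotrV1.
Qed.

(** Insert the summability factor [g (e x)] and let [e] tend to 0: the
    multiplication formula and a dilation move it to the other side, where it
    becomes [m (e x)]. *)
Lemma cintegral_inv_symmetric m g : nice m -> nice g ->
  cintegral (inv_fourier m) * g 0 = cintegral (inv_fourier g) * m 0.
Proof.
move=> nm ng; have im := nice_cintegrable nm; have ig := nice_cintegrable ng.
case: nm => cm [Mm mM] _ iim; case: ng => cg [Mg gM] _ iig.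
(* The multiplication formula for [m] and the dilate of [g], followed by the
   substitution [x -> t x]. *)
have E (t : R) : 0 < t ->
    cintegral (fun x => inv_fourier m x * g (t *: x)) =
    cintegral (fun x => inv_fourier g x * m (t *: x)).
  move=> t0; have ti0 : 0 < t^-1 by rewrite invr_gt0.
  have iG : cintegrable (fun x => g (t *: x)).
    have := cintegrable_affine 0 t0 ig; congr cintegrable.
    by apply/funext => x; rewrite addr0.
  rewrite -cintegral_inv_fourier_swap//.
  have iG' x : inv_fourier (fun x => g (t *: x)) x =
      (t^-1 ^+ n)%:C * inv_fourier g (t^-1 *: x).
    by rewrite -inv_fourier_dilate// invrK.
  pose F x := m x * inv_fourier g (t^-1 *: x).
  have iF : cintegrable F.
    have := cintegrable_affine 0 ti0 iig.
    under [X in cintegrable X]eq_fun do rewrite addr0.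
    move=> h; have := @cintegrable_bounded _ _ _ m Mm (ccontinuous_measurable cm) mM h.
    by congr cintegrable; apply/funext => x; rewrite /F mulrC.
  have := cintegral_affine 0 t0 iF; rewrite -exprVn => FE.
  transitivity ((t^-1 ^+ n)%:C * cintegral F).
    by rewrite -cintegralZ//; apply: eq_cintegral => x; rewrite iG' /F mulrCA.
  rewrite -FE; apply: eq_cintegral => x; rewrite /F !addr0 mulrC scalerA.
  by rewrite mulVf ?scale1r// gt_eqF.
have [h1 h2] := cvg_cintegral_dilate iim cg gM.
have [h3 h4] := cvg_cintegral_dilate iig cm mM.
have k0 k : 0 < k.+1%:R^-1 :> R by rewrite invr_gt0.
have e : (fun k => cintegral (fun x => inv_fourier m x * g (k.+1%:R^-1 *: x))) =
    (fun k => cintegral (fun x => inv_fourier g x * m (k.+1%:R^-1 *: x))).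
  by apply/funext => k; exact: E.
have e1 := congr1 (fun F => (fun k : nat => complex.Re (F k : R[i]))) e.
have e2 := congr1 (fun F => (fun k : nat => complex.Im (F k : R[i]))) e.
move: e1 e2 => /= e1 e2; rewrite e1 in h1; rewrite e2 in h2.
by apply: complex_eq; [exact: (cvg_unique _ h1 h3)|exact: (cvg_unique _ h2 h4)].
Qed.

(** Inversion at the origin, applied to translates; the constant does not
    depend on [m]. *)
Lemma fourier_inv m b xi : nice m -> nice b -> b 0 = 1 ->
  fourier (inv_fourier m) xi = cintegral (inv_fourier b) * m xi.
Proof.
move=> nm nb b1; have := cintegral_inv_symmetric (nice_translate xi nm) nb.
rewrite b1 mulr1 add0r => <-; apply: eq_cintegral => x.
by rewrite inv_fourier_translate; [rewrite mulrC|exact: nice_cintegrable].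
Qed.

(** For a real bump [b], Plancherel's identity reads [\int |u|^2 = c \int b^2]
    with [u = inv_fourier b]; if [c] vanished, so would the continuous
    function [u], while [u 0 = \int b > 0]. *)
Lemma inv_fourier_constant_neq0 b : nice b -> b 0 = 1 ->
  (forall x, complex.Im (b x) = 0) -> (forall x, 0 <= complex.Re (b x)) ->
  cintegral (inv_fourier b) != 0.
Proof.
move=> nb b1 bI bR; apply/eqP => c0; have ib := nice_cintegrable nb.
have [cb [M bM] [B bB] iib] := nb.
pose u := inv_fourier b.
have cu : ccontinuous u by exact: ccontinuous_inv_fourier ib bB.
(* As [b] is real, its Fourier transform is the conjugate of [u]. *)
have fb x : fourier b x = complex.Re (u x) +i* - complex.Im (u x).
  apply: complex_eq => /=.
    apply: eq_Rintegral => y _; rewrite !cReM bI !mul0r !subr0 /= cosN dotrVC//.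
  rewrite -mulN1r -RintegralZl//; last exact: (cintegrable_inv_fourier x ib).2.
  by apply: eq_Rintegral => y _; rewrite mulN1r !cImM bI !mul0r !addr0/= sinN
    mulrN dotrVC.
have := cintegral_fourier_swap iib ib.
under [X in _ = X -> _]eq_cintegral do rewrite (fourier_inv _ nb nb b1) c0 !mul0r.
rewrite cintegral0 => /(congr1 (@complex.Re R)).
pose h x := complex.Re (u x) ^+ 2 + complex.Im (u x) ^+ 2.
have uE x : complex.Re (u x * fourier b x) = h x.
  by rewrite cReM fb/= mulrN opprK -!expr2.
rewrite [LHS](_ : _ = \int[mu]_x h x); last by apply: eq_Rintegral => x _; exact: uE.
apply/eqP; rewrite gt_eqF//; apply: (Rintegral_gt0 (x0 := 0)).
- move=> x; have h1 : complex.Re (u y) @[y --> x] --> complex.Re (u x) := cu.1 x.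
  have h2 : complex.Im (u y) @[y --> x] --> complex.Im (u x) := cu.2 x.
  by rewrite /h; under eq_fun do rewrite !expr2;
    exact: (cvgD (cvgM h1 h1) (cvgM h2 h2)).
- by move=> x; rewrite addr_ge0// sqr_ge0.
- have [] := @cintegrable_bounded _ _ u (fourier b) (2 * \int[mu]_y normc (b y)) _ _ iib.
  + by split; under eq_fun do rewrite fb; [exact: (ccontinuous_measurable cu).1|
      apply: measurable_funN; exact: (ccontinuous_measurable cu).2].
  + move=> x; rewrite fourierE; apply: normc_inv_fourier_le => //.
    exact: ccontinuous_measurable. exact: cintegrable_normc.
  by under [X in _.-integrable _ X]eq_fun do rewrite uE.
- rewrite /h ltr_wpDr ?sqr_ge0// exprn_gt0// /u inv_fourier0 /=.
  by apply: (Rintegral_gt0 (x0 := 0)) => //; [exact: cb.1|exact: ib.1|rewrite b1].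
Qed.

End inversion.

(** * Decay of Fourier integrals by finite differences *)

Section finite_differences.
Context {R : realType} {n : nat}.
Local Notation Rn := 'rV[measurableTypeR R]_n.
Local Notation mu := (@lebesgue_rV R n).
Local Notation integrable f := (mu.-integrable setT (EFin \o f)).
Implicit Types (f g m : 'rV[R]_n -> R[i]) (i : 'I_n) (h t : R).

Definition fdiff i h m : 'rV[R]_n -> R[i] :=
  fun xi => m (xi + h *: delta_mx ord0 i) - m xi.

(** A symbol of scale [t]: [A * (h / t) ^+ k] is what a bound [A * t ^- k] on
    the k-th derivatives gives for differences of step [h]. Unlike
    derivatives, differences are compatible with [inv_fourier] for every
    integrable symbol. *)
Definition diff_bounded (A t : R) (K : nat) m := forall i h, 0 <= h ->
  forall k, (k <= K)%N -> forall xi,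
  normc (iter k (fdiff i h) m xi) <= A * (h / t) ^+ k.

Lemma fdiffD i h f g : fdiff i h (f \+ g) = fdiff i h f \+ fdiff i h g.
Proof. by apply/funext => x; rewrite /fdiff /= opprD addrACA. Qed.

Lemma iter_fdiffD i h k f g :
  iter k (fdiff i h) (f \+ g) = iter k (fdiff i h) f \+ iter k (fdiff i h) g.
Proof. by elim: k => // k IH; rewrite !iterS IH fdiffD. Qed.

Lemma iter_fdiff_translate i h k f (v : 'rV[R]_n) :
  iter k (fdiff i h) (fun xi => f (xi + v)) =
  (fun xi => iter k (fdiff i h) f (xi + v)).
Proof.
elim: k => // k IH; rewrite !iterS IH; apply/funext => xi.
by rewrite /fdiff addrAC.
Qed.

Lemma iter_fdiff_dilate i h k f t :
  iter k (fdiff i h) (fun xi => f (t *: xi)) =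
  (fun xi => iter k (fdiff i (t * h)) f (t *: xi)).
Proof.
elim: k => // k IH; rewrite !iterS IH; apply/funext => xi.
by rewrite /fdiff scalerDr scalerA.
Qed.

(** Leibniz rule: each difference of a product is a sum of two products. *)
Lemma normc_iter_fdiffM i h (r : R) k : 0 <= r -> forall f g (A B : R),
  (forall l, (l <= k)%N -> forall xi, normc (iter l (fdiff i h) f xi) <= A * r ^+ l) ->
  (forall l, (l <= k)%N -> forall xi, normc (iter l (fdiff i h) g xi) <= B * r ^+ l) ->
  forall xi, normc (iter k (fdiff i h) (f \* g) xi) <= 2 ^+ k * A * B * r ^+ k.
Proof.
move=> r0; elim: k => [|k IH] f g A B fA gB xi.
  have := fA 0%N isT xi; have := gB 0%N isT xi.
  by rewrite !expr0 !mulr1 mul1r normcM/= => ? ?; rewrite ler_pM ?normc_ge0.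
rewrite iterSr.
have -> : fdiff i h (f \* g) =
    (fdiff i h f \* (fun xi => g (xi + h *: delta_mx ord0 i))) \+ (f \* fdiff i h g).
  by apply/funext => x; rewrite /fdiff/=; ring.
rewrite iter_fdiffD/= (le_trans (normc_triangle _ _))//.
have -> : 2 ^+ k.+1 * A * B * r ^+ k.+1 =
    2 ^+ k * (A * r) * B * r ^+ k + 2 ^+ k * A * (B * r) * r ^+ k.
  by rewrite !exprS; ring.
rewrite lerD// IH// => l lk x.
- by rewrite -iterSr -mulrA -exprS fA.
- by rewrite iter_fdiff_translate gB// ltnW.
- by rewrite fA// ltnW.
- by rewrite -iterSr -mulrA -exprS gB.
Qed.

Lemma diff_boundedM (A B t : R) K f g : 0 < t -> 0 <= A -> 0 <= B ->
  diff_bounded A t K f -> diff_bounded B t K g ->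
  diff_bounded (2 ^+ K * A * B) t K (f \* g).
Proof.
move=> t0 A0 B0 fA gB i h h0 k kK xi.
have r0 : 0 <= h / t by rewrite divr_ge0// ltW.
apply: (le_trans (@normc_iter_fdiffM i h (h / t) k r0 f g A B _ _ xi)).
- by move=> l lk x; apply: fA => //; exact: leq_trans kK.
- by move=> l lk x; apply: gB => //; exact: leq_trans kK.
rewrite ler_wpM2r ?exprn_ge0// ler_wpM2r// ler_wpM2r//.
by rewrite ler_weXn2l// ler1n.
Qed.

Lemma diff_bounded_rescale (A t t' c : R) K f : 0 < t -> 0 < t' -> 1 <= c ->
  t' <= c * t -> 0 <= A -> diff_bounded A t K f ->
  diff_bounded (A * c ^+ K) t' K f.
Proof.
move=> t0 t'0 c1 tt A0 fA i h h0 k kK xi.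
apply: le_trans (fA i h h0 k kK xi) _; rewrite -mulrA ler_wpM2l//.
have c0 : 0 <= c by rewrite (le_trans ler01).
apply: (@le_trans _ _ (c ^+ k * (h / t') ^+ k)); last first.
  by rewrite ler_wpM2r ?exprn_ge0 ?divr_ge0 ?(ltW t'0)// ler_weXn2l.
rewrite -exprMn; apply: lerXn2r; rewrite ?nnegrE ?mulr_ge0 ?invr_ge0 ?(ltW t0) ?(ltW t'0)//.
rewrite mulrCA ler_wpM2l// ler_pdivlMr// mulrC ler_pdivrMr//.
Qed.

Lemma diff_bounded_dilate (A t : R) K f : 0 < t -> diff_bounded A 1 K f ->
  diff_bounded A t K (fun xi => f (t^-1 *: xi)).
Proof.
move=> t0 fA i h h0 k kK xi; rewrite iter_fdiff_dilate mulrC.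
have := fA i (h / t) (divr_ge0 h0 (ltW t0)) k kK (t^-1 *: xi).
by rewrite divr1.
Qed.

Lemma diff_bounded_translate (A t : R) K f (v : 'rV[R]_n) :
  diff_bounded A t K f -> diff_bounded A t K (fun xi => f (xi + v)).
Proof. by move=> fA i h h0 k kK xi; rewrite iter_fdiff_translate; exact: fA. Qed.

Lemma norm_delta i : `|delta_mx ord0 i : 'rV[R]_n| <= 1.
Proof.
by apply/rV_normP => // j; rewrite mxE; case: (_ && _); rewrite ?normr1 ?normr0.
Qed.

Lemma iter_fdiff_support i h k m (B : R) : 0 <= h ->
  (forall xi, B < `|xi| -> m xi = 0) ->
  forall xi, B + k%:R * h < `|xi| -> iter k (fdiff i h) m xi = 0.
Proof.
move=> h0; elim: k => [|k IH] mB xi; first by rewrite mul0r addr0; exact: mB.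
rewrite -natr1 mulrDl mul1r addrA => hB; rewrite iterS /fdiff !(IH mB) ?subrr//.
  by apply: le_lt_trans hB; rewrite lerDl.
rewrite -ltrBrDr in hB; apply: lt_le_trans hB _; rewrite lerBlDr.
rewrite -[X in `|X| <= _](addrK (h *: delta_mx ord0 i)).
apply: le_trans (ler_normB _ _) _; rewrite lerD2l normrZ ger0_norm//.
by rewrite ler_piMr// norm_delta.
Qed.

Lemma continuous_translate (v : 'rV[R]_n) (h : 'rV[R]_n -> R) : continuous h ->
  continuous (fun x : 'rV[R]_n => h (x + v)).
Proof.
move=> ch x U /(ch _)/nbhs_ballP[e /= e0 eU].
apply/nbhs_ballP; exists e => // y; rewrite mx_norm_ball /ball_/= => xy.
by apply: eU; rewrite mx_norm_ball /ball_/= opprD addrACA subrr addr0.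
Qed.

Lemma ccontinuous_fdiff i h m : ccontinuous m -> ccontinuous (fdiff i h m).
Proof.
move=> [c1 c2]; split; rewrite /fdiff.
- have -> : (fun x => complex.Re (m (x + h *: delta_mx ord0 i) - m x)) =
      (fun x => complex.Re (m (x + h *: delta_mx ord0 i)) - complex.Re (m x)).
    by apply/funext => x; case: (m x) (m _) => [? ?] [? ?].
  move=> x; have h1 : complex.Re (m y) @[y --> x] --> complex.Re (m x) := c1 x.
  have h2 := @continuous_translate (h *: delta_mx ord0 i) _ c1 x.
  exact: (cvgB h2 h1).
- have -> : (fun x => complex.Im (m (x + h *: delta_mx ord0 i) - m x)) =
      (fun x => complex.Im (m (x + h *: delta_mx ord0 i)) - complex.Im (m x)).
    by apply/funext => x; case: (m x) (m _) => [? ?] [? ?].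
  move=> x; have h1 : complex.Im (m y) @[y --> x] --> complex.Im (m x) := c2 x.
  have h2 := @continuous_translate (h *: delta_mx ord0 i) _ c2 x.
  exact: (cvgB h2 h1).
Qed.

Lemma ccontinuous_iter_fdiff i h k m : ccontinuous m ->
  ccontinuous (iter k (fdiff i h) m).
Proof. by move=> cm; elim: k => // k IH; rewrite iterS; exact: ccontinuous_fdiff. Qed.

Lemma cintegrable_translate m (v : 'rV[R]_n) : cintegrable m ->
  cintegrable (fun xi => m (xi + v)).
Proof.
move=> im; have := cintegrable_affine v (@ltr01 R) im.
by under [X in cintegrable X -> _]eq_fun do rewrite scale1r.
Qed.

Lemma cintegrable_fdiff i h m : cintegrable m -> cintegrable (fdiff i h m).
Proof.
move=> im; have := cintegrableD (cintegrable_translate (h *: delta_mx ord0 i) im)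
  (cintegrableZ (-1) im).
by under [X in cintegrable X -> _]eq_fun do rewrite mulN1r.
Qed.

Lemma inv_fourier_fdiff i h m x : cintegrable m ->
  inv_fourier (fdiff i h m) x =
  (cexpi (- (2 * pi * (h * x ord0 i))) - 1) * inv_fourier m x.
Proof.
move=> im; rewrite mulrBl mul1r -dotrV_delta -dotrVZr -inv_fourier_translate//.
rewrite -[X in _ - X]mul1r -mulNr -cintegralZ; last exact: cintegrable_inv_fourier.
rewrite -cintegralD; last 2 first.
- by apply: cintegrable_inv_fourier; exact: cintegrable_translate.
- by apply: cintegrableZ; exact: cintegrable_inv_fourier.
by apply: eq_cintegral => xi; rewrite /fdiff mulrBl mulN1r.
Qed.

Lemma inv_fourier_iter_fdiff i h k m x : cintegrable m ->
  inv_fourier (iter k (fdiff i h) m) x =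
  (cexpi (- (2 * pi * (h * x ord0 i))) - 1) ^+ k * inv_fourier m x.
Proof.
move=> im; elim: k => [|k IH]; first by rewrite expr0 mul1r.
rewrite iterS inv_fourier_fdiff; first by rewrite IH exprS mulrA.
by elim: k {IH} => // k IH; rewrite iterS; exact: cintegrable_fdiff.
Qed.

Lemma normc_inv_fourier_cube m (A r : R) x : 0 <= r -> ccontinuous m ->
  (forall xi, normc (m xi) <= A) -> (forall xi, r < `|xi| -> m xi = 0) ->
  normc (inv_fourier m x) <= 2 * (A * (2 * r) ^+ n).
Proof.
move=> r0 cm mA mr; rewrite -(Rintegral_cube A r0).
apply: normc_inv_fourier_le; first exact: ccontinuous_measurable.
  move=> xi; rewrite indicE; case: (boolP (xi \in _)) => [_|]; first by rewrite mulr1.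
  by rewrite notin_setE /cube/= => /negP; rewrite -ltNge => Bx; rewrite mulr0 mr ?normc0.
exact: integrable_cube.
Qed.

Definition decay_const (B : R) : R :=
  2 * (2 * (B + n.+1%:R)) ^+ n * 2 ^+ n.+1.

(** At [y] the step [1 / (2 |y_i|)] in the direction of the largest coordinate
    turns each difference into a multiplication by [-2]; so [n.+1] differences
    bound [inv_fourier m y] by the [n.+1]-st power of the step. *)
Lemma inv_fourier_decay m (A B t : R) y : (0 < n)%N ->
  0 < t -> 0 <= A -> 0 <= B -> ccontinuous m -> diff_bounded A t n.+1 m ->
  (forall xi, B * t < `|xi| -> m xi = 0) ->
  normc (inv_fourier m y) <= decay_const B * A * t ^+ n * decay (t *: y).
Proof.
move=> n0 t0 A0 B0 cm mA mB.
have Bt0 : 0 <= B * t by rewrite mulr_ge0// ltW.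
have BM0 : 0 <= B + n.+1%:R by rewrite addr_ge0.
have tn0 : 0 <= t ^+ n by rewrite exprn_ge0// ltW.
set s := t * `|y|; have s0 : 0 <= s by rewrite mulr_ge0// ltW.
have s1 : 0 < (1 + s) ^+ n.+1 by rewrite exprn_gt0// ltr_pwDl.
rewrite /decay normrZ (gtr0_norm t0) -/s ler_pdivlMr//.
have mA' xi : normc (m xi) <= A.
  by have := mA (Ordinal n0) 0 (lexx _) 0%N isT xi; rewrite expr0 mulr1.
(* Near the origin the trivial bound is enough. *)
have [ty1|ty1] := ltP s 1.
  apply: (@le_trans _ _ (2 * (A * (2 * (B * t)) ^+ n) * 2 ^+ n.+1)).
    apply: ler_pM; rewrite ?normc_ge0 ?(ltW s1)//.
      exact: normc_inv_fourier_cube mA' mB.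
    by apply: lerXn2r; rewrite ?nnegrE ?addr_ge0//; lra.
  rewrite /decay_const mulrA exprMn.
  have -> : 2 * (2 * (B + n.+1%:R)) ^+ n * 2 ^+ n.+1 * A * t ^+ n =
    2 * A * ((2 * (B + n.+1%:R)) ^+ n * t ^+ n) * 2 ^+ n.+1 by ring.
  rewrite ler_wpM2r ?exprn_ge0// ler_wpM2l ?mulr_ge0// -!exprMn.
  apply: lerXn2r; rewrite ?nnegrE ?mulr_ge0// ?(ltW t0)//.
  by rewrite -mulrA ler_wpM2l// ler_wpM2r ?(ltW t0)// lerDl.
have y0 : 0 < `|y|.
  by rewrite lt_neqAle normr_ge0 andbT eq_sym; apply: contraTneq ty1 => y0;
    rewrite /s y0 mulr0 -ltNge.
have [i yi] := norm_attained y0.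
pose h := (2 * `|y|)^-1.
have h0 : 0 < h by rewrite invr_gt0 mulr_gt0.
have ht : h / t * (1 + s) <= 1.
  rewrite /h /s -invfM mulrC ler_pdivrMr; last by rewrite mulr_gt0 ?mulr_gt0.
  by rewrite mul1r -mulrA (mulrC `|y|) mulr_natl mulr2n lerD2r.
have ht0 : 0 <= h / t by rewrite divr_ge0 ?ltW.
have ht1 : h <= t.
  have : h / t <= 1 by apply: le_trans ht; rewrite ler_peMr// lerDl.
  by rewrite ler_pdivrMr// mul1r.
have Bh0 : 0 <= B * t + n.+1%:R * h by rewrite addr_ge0// mulr_ge0// ltW.
(* By the choice of [h] the phase is [pi] or [- pi]. *)
have cE : cexpi (- (2 * pi * (h * y ord0 i))) = - 1 :> R[i].
  have hy : `|h * y ord0 i| = 2^-1.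
    rewrite normrM (gtr0_norm h0) -yi /h invfM -mulrA mulVf ?mulr1//.
    by rewrite gt_eqF.
  have [yi0|yi0] := ltP (h * y ord0 i) 0.
    rewrite ltr0_norm// in hy.
    by rewrite -(opprK (h * _)) hy -cexpi_pi; congr cexpi; field.
  rewrite ger0_norm// in hy.
  by rewrite hy -cexpi_Npi; congr cexpi; field.
have := normc_inv_fourier_cube y Bh0 (ccontinuous_iter_fdiff i h n.+1 cm)
  (mA i h (ltW h0) n.+1 (leqnn _)) (@iter_fdiff_support i h n.+1 m (B * t) (ltW h0) mB).
rewrite inv_fourier_iter_fdiff; last exact: compact_cintegrable cm mA' mB.
rewrite cE -opprD normcM normcX normc_opp.
have -> : normc (1 + 1 : R[i]) = 2.
  by rewrite /normc/= addr0 expr0n addr0 sqrtr_sqr ger0_norm.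
move=> hm; apply: (@le_trans _ _ (2 ^+ n.+1 * normc (inv_fourier m y) * (1 + s) ^+ n.+1)).
  rewrite ler_wpM2r ?(ltW s1)// ler_peMl ?normc_ge0//.
  by rewrite exprn_ege1// ler1n.
apply: (@le_trans _ _ (2 * (A * (h / t) ^+ n.+1 * (2 * (B * t + n.+1%:R * h)) ^+ n)
    * (1 + s) ^+ n.+1)); first by rewrite ler_wpM2r ?(ltW s1).
have -> : 2 * (A * (h / t) ^+ n.+1 * (2 * (B * t + n.+1%:R * h)) ^+ n) * (1 + s) ^+ n.+1
  = 2 * A * (2 * (B * t + n.+1%:R * h)) ^+ n * (h / t * (1 + s)) ^+ n.+1.
  by rewrite [(h / t * _) ^+ _]exprMn; ring.
apply: (@le_trans _ _ (2 * A * ((2 * (B + n.+1%:R)) ^+ n * t ^+ n) * 1)).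
  apply: ler_pM.
  - by rewrite mulr_ge0 ?mulr_ge0 ?exprn_ge0// mulr_ge0.
  - by rewrite exprn_ge0// mulr_ge0// addr_ge0.
  - rewrite ler_wpM2l ?mulr_ge0// -exprMn; apply: lerXn2r;
      rewrite ?nnegrE ?mulr_ge0// ?(ltW t0)//.
    by rewrite -mulrA ler_wpM2l// mulrDl lerD2l ler_wpM2l.
  - by rewrite exprn_ile1// mulr_ge0// addr_ge0.
rewrite mulr1 /decay_const.
have -> : 2 * (2 * (B + n.+1%:R)) ^+ n * 2 ^+ n.+1 * A * t ^+ n =
    2 * A * ((2 * (B + n.+1%:R)) ^+ n * t ^+ n) * 2 ^+ n.+1 by ring.
rewrite ler_peMr ?mulr_ge0// ?exprn_ge0 ?mulr_ge0//.
by rewrite exprn_ege1// ler1n.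
Qed.

End finite_differences.

(** * Smooth functions *)

Section smooth_functions.
Context {R : realType} {n : nat}.
Implicit Types (f g F G : 'rV[R]_n -> R) (s : seq 'I_n) (i : 'I_n).
Local Notation e_ i := (delta_mx ord0 i : 'rV[R]_n).

Lemma is_derive_affine F (l : R) (c v x : 'rV[R]_n) : 0 < l ->
  derivable F (l *: x + c) v ->
  is_derive x v (fun y => F (l *: y + c)) (l * 'D_v F (l *: x + c)).
Proof.
move=> l0 dF.
pose G (h : R) : R := h^-1 *: ((F \o shift (l *: x + c)) (h *: v) - F (l *: x + c)).
have GD : G h @[h --> 0^'] --> ('D_v F (l *: x + c) : R) by exact: dF.
have lh : (l * h) @[h --> 0^'] --> 0^'.
  move=> U [e /= e0 eU]; exists (e / l); first by rewrite /= divr_gt0.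
  move=> h /=; rewrite sub0r normrN ltr_pdivlMr// => he h0; apply: eU => /=.
    by rewrite sub0r normrN normrM (gtr0_norm l0) mulrC.
  by rewrite mulf_neq0// gt_eqF.
have H : l *: G (l * h) @[h --> 0^'] --> (l * 'D_v F (l *: x + c) : R).
  have GG : G (l * h) @[h --> 0^'] --> ('D_v F (l *: x + c) : R).
    by apply: (@cvg_comp _ _ _ (fun h => l * h) G _ (0^') _ lh GD).
  exact: (cvgM (cvg_cst l) GG).
have E : (fun h : R => h^-1 *: (((fun y => F (l *: y + c)) \o shift x) (h *: v) -
    (fun y => F (l *: y + c)) x)) = (fun h => l *: G (l * h)).
  apply/funext => h; rewrite /G/= scalerA invfM mulrA mulfV ?gt_eqF// mul1r.
  by congr (_ *: (F _ - _)); rewrite scalerDr scalerA addrA.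
have d : derivable (fun y => F (l *: y + c)) x v.
  rewrite /derivable E; apply/cvg_ex; eexists; exact: H.
apply: DeriveDef => //; rewrite /derive E; exact/cvg_lim.
Qed.

Lemma partials_rcons s i f : partials (rcons s i) f = partials s ('D_(e_ i) f).
Proof. by rewrite /partials foldr_rcons. Qed.

Lemma smooth_derive f i : smooth f -> smooth ('D_(e_ i) f).
Proof. by move=> sf s; have := sf (rcons s i); rewrite partials_rcons. Qed.

(** Allows the Leibniz rule to be proved by induction on the order, since the
    derivative of a product is a sum of products of smooth functions. *)
Definition smooth_upto (N : nat) f := forall s, (size s <= N)%N ->
  continuous (partials s f) /\ forall i x, derivable (partials s f) x (e_ i).

Lemma partialsD N f g : smooth_upto N f -> smooth_upto N g ->
  forall s, (size s <= N.+1)%N -> partials s (f \+ g) = partials s f \+ partials s g.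
Proof.
move=> sf sg; elim => // i s IH /= sN.
rewrite IH; last exact: ltnW.
apply/funext => x; apply: deriveD; [exact: (sf s sN).2|exact: (sg s sN).2].
Qed.

Lemma smooth_uptoD N f g : smooth_upto N f -> smooth_upto N g ->
  smooth_upto N (f \+ g).
Proof.
move=> sf sg s sN; rewrite (partialsD sf sg); last exact: leqW.
have [c1 d1] := sf s sN; have [c2 d2] := sg s sN; split.
  move=> x; have h1 : partials s f y @[y --> x] --> partials s f x := c1 x.
  have h2 : partials s g y @[y --> x] --> partials s g x := c2 x.
  exact: (cvgD h1 h2).
by move=> i x; apply: derivableD.
Qed.

Lemma smooth_uptoM N f g : smooth f -> smooth g -> smooth_upto N (f \* g).
Proof.
elim: N f g => [|N IH] f g sf sg s.
  case: s => // _ /=; have [c1 d1] := sf [::]; have [c2 d2] := sg [::]; split.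
    move=> x; have h1 : f y @[y --> x] --> f x := c1 x.
    have h2 : g y @[y --> x] --> g x := c2 x.
    exact: (cvgM h1 h2).
  by move=> i x; apply: derivableM; [exact: d1|exact: d2].
case/lastP: s => [_|s i]; first exact: (IH f g sf sg [::]).
rewrite size_rcons ltnS => sN; rewrite partials_rcons.
have -> : 'D_(e_ i) (f \* g) = (f \* 'D_(e_ i) g) \+ (g \* 'D_(e_ i) f).
  apply/funext => x; apply: deriveM; [exact: (sf [::]).2|exact: (sg [::]).2].
by apply: (smooth_uptoD (N := N)) => //; apply: IH => //; exact: smooth_derive.
Qed.

Lemma smoothM f g : smooth f -> smooth g -> smooth (f \* g).
Proof. by move=> sf sg s; exact: (smooth_uptoM sf sg (leqnn _)). Qed.

Lemma partials_affine f (l : R) (c : 'rV[R]_n) s : 0 < l -> smooth f ->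
  partials s (fun x => f (l *: x + c)) =
  (fun x => l ^+ size s * partials s f (l *: x + c)).
Proof.
move=> l0 sf; elim: s => [|i s IH]; first by apply/funext => x; rewrite expr0 mul1r.
rewrite /= IH; apply/funext => x.
have h := is_derive_affine l0 ((sf s).2 i (l *: x + c)).
have -> : (fun x => l ^+ size s * partials s f (l *: x + c)) =
   (l ^+ size s) \*: (fun x => partials s f (l *: x + c)) by [].
rewrite deriveZ; last by case: h.
by rewrite (@derive_val _ _ _ _ _ _ _ h) exprSr -mulrA.
Qed.

Lemma continuous_affine_comp f (l : R) (c : 'rV[R]_n) : 0 < l -> continuous f ->
  continuous (fun x : 'rV[R]_n => f (l *: x + c)).
Proof.
move=> l0 cf x U /(cf _)/nbhs_ballP[e /= e0 eU].
apply/nbhs_ballP; exists (e / l); first by rewrite /= divr_gt0.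
move=> y; rewrite mx_norm_ball /ball_/= ltr_pdivlMr// => xy.
apply: eU; rewrite mx_norm_ball /ball_/= opprD addrACA subrr addr0 -scalerBr.
by rewrite normrZ (gtr0_norm l0) mulrC.
Qed.

Lemma smooth_affine f (l : R) (c : 'rV[R]_n) : 0 < l -> smooth f ->
  smooth (fun x => f (l *: x + c)).
Proof.
move=> l0 sf s; rewrite (partials_affine c s l0 sf); have [cs ds] := sf s; split.
  move=> x; have h : partials s f (l *: y + c) @[y --> x] --> partials s f (l *: x + c)
    := @continuous_affine_comp _ l c l0 cs x.
  exact: (cvgM (cvg_cst _) h).
move=> i x.
have -> : (fun x => l ^+ size s * partials s f (l *: x + c)) =
   (l ^+ size s) \*: (fun x => partials s f (l *: x + c)) by [].
apply: derivableZ; have h := is_derive_affine l0 ((sf s).2 i (l *: x + c)).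
by case: h.
Qed.

Lemma partials0 s : partials s (fun=> 0 : R) = (fun=> 0).
Proof.
by elim: s => //= i s ->; apply/funext => x; exact: (derive_cst (0 : R)).
Qed.

Lemma smooth0 : smooth (fun _ : 'rV[R]_n => 0 : R).
Proof.
move=> s; rewrite partials0; split; first exact: cst_continuous.
by move=> i x; exact: (@derivable_cst _ _ _ (0 : R)).
Qed.

Lemma partials_support f (B : R) s : (forall x, B < `|x| -> f x = 0) ->
  forall x, B < `|x| -> partials s f x = 0.
Proof.
move=> fB; elim: s => //= i s IH x xB.
rewrite -[RHS](derive_cst (0 : R) x (e_ i)); apply: near_eq_derive.
have : nbhs x [set y : 'rV[R]_n | B < `|y|].
  apply: (@norm_continuous _ _ x [set y | B < y]).
  by apply: open_nbhs_nbhs; split => //; exact: open_gt.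
by apply: filterS => y /= yB; rewrite IH.
Qed.

Lemma continuous_support_bounded f (B : R) : continuous f ->
  (forall x, B < `|x| -> f x = 0) -> exists M, forall x, `|f x| <= M.
Proof.
move=> cf fB.
have cK : compact [set x : 'rV[R]_n | `|x| <= `|B|].
  apply: bounded_closed_compact.
    by exists `|B|; split => // r Br x /= xB; rewrite (le_trans xB)// ltW.
  apply: (@closed_comp _ _ (fun x : 'rV[R]_n => `|x|) [set y | y <= `|B|]).
    by move=> x _; exact: norm_continuous.
  exact: closed_le.
have cfK : {within [set x : 'rV[R]_n | `|x| <= `|B|], continuous f}.
  exact: continuous_subspaceT.
have /compact_bounded[M [_ hM]] := continuous_compact cfK cK.
exists (`|M| + 1) => x; have [xB|xB] := leP `|x| `|B|.
  apply: (hM (`|M| + 1)); last by exists x.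
  by rewrite (le_lt_trans (ler_norm M))// ltrDl.
by rewrite fB ?normr0 ?addr_ge0// (le_lt_trans (ler_norm B)).
Qed.

Lemma monomial_le (a : 'I_n -> nat) (B : R) x : 0 <= B -> `|x| <= B ->
  `|monomial a x| <= \prod_i (1 + B) ^+ a i.
Proof.
move=> B0 xB; rewrite /monomial normr_prod; apply: ler_prod => i _.
rewrite normr_ge0 normrX/=; apply: lerXn2r; rewrite ?nnegrE ?addr_ge0//.
by rewrite (le_trans (coord_le_norm _ _))// (le_trans xB)// lerDr.
Qed.

Lemma schwartz_real f (B : R) : smooth f -> (forall x, B < `|x| -> f x = 0) ->
  schwartz (fun x => (f x)%:C).
Proof.
move=> sf fB; split; first by split => //; exact: smooth0.
move=> a b.
have pE x : normc (cpartial b (fun x => (f x)%:C) x) = `|partial b f x|.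
  rewrite /cpartial /partial /= partials0 /= expr0n/= addr0 sqrtr_sqr.
  by [].
have pB := partials_support _ fB.
have [M hM] := continuous_support_bounded (sf _).1
  (pB (flatten [seq nseq (b i) i | i <- enum 'I_n])).
have M0 : 0 <= M by apply: le_trans (hM 0); rewrite normr_ge0.
exists (\prod_i (1 + `|B|) ^+ a i * M) => x; rewrite pE.
have [xB|xB] := leP `|x| `|B|.
  by apply: ler_pM => //; [exact: monomial_le|exact: hM].
rewrite /partial pB ?normr0 ?mulr0 ?mulr_ge0// ?(le_lt_trans (ler_norm B))//.
by apply: prodr_ge0 => i _; rewrite exprn_ge0// addr_ge0.
Qed.

(** The mean value theorem along a coordinate axis. *)
Lemma fdiff_derive_le f i (C h : R) : 0 <= h ->
  (forall x, derivable f x (e_ i)) -> (forall x, `|'D_(e_ i) f x| <= C) ->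
  forall x, `|f (x + h *: e_ i) - f x| <= C * h.
Proof.
move=> h0 df fC x.
pose g (r : R) := f (x + r *: e_ i).
have gd (r : R) : is_derive r 1 g ('D_(e_ i) f (x + r *: e_ i)).
  have E : (fun h0 : R => h0^-1 *: ((g \o shift r) (h0 *: 1) - g r)) =
      (fun h0 => h0^-1 *: ((f \o shift (x + r *: e_ i)) (h0 *: e_ i)
                          - f (x + r *: e_ i))).
    apply/funext => k; congr (_ *: (_ - _)); rewrite /g/=; congr f.
    by rewrite [k *: 1]mulr1 scalerDl addrCA.
  have d : derivable g r 1 by rewrite /derivable E; exact: df.
  by apply: DeriveDef => //; rewrite /derive E.
have [|c _ e] := @MVT_segment _ g (fun r => 'D_(e_ i) f (x + r *: e_ i)) 0 h h0.
  apply: continuous_subspaceT => r; apply: differentiable_continuous.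
  by apply/derivable1_diffP; case: (gd r).
rewrite [X in `|X|](_ : _ = g h - g 0); last by rewrite /g scale0r addr0.
by rewrite e subr0 normrM (ger0_norm h0) ler_wpM2r.
Qed.

Definition rfdiff i (h : R) f : 'rV[R]_n -> R := fun x => f (x + h *: e_ i) - f x.

Lemma derive_rfdiff f i j h : (forall x, derivable f x (e_ j)) ->
  (forall x, derivable (rfdiff i h f) x (e_ j)) /\
  'D_(e_ j) (rfdiff i h f) = rfdiff i h ('D_(e_ j) f).
Proof.
move=> df.
have dt x : is_derive x (e_ j) (fun y => f (y + h *: e_ i))
    ('D_(e_ j) f (x + h *: e_ i)).
  have := @is_derive_affine f 1 (h *: e_ i) (e_ j) x ltr01.
  rewrite scale1r mul1r; under [fun y => f (1 *: y + _)]eq_fun do rewrite scale1r.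
  by apply; exact: df.
have E : rfdiff i h f = (fun y => f (y + h *: e_ i)) - f by [].
split => [x|]; last apply/funext => x; rewrite E.
  by apply: derivableB => //; case: (dt x).
by rewrite deriveB// (@derive_val _ _ _ _ _ _ _ (dt x)).
Qed.

(** The mean value theorem, iterated, as differences commute with derivatives. *)
Lemma iter_fdiff_le f i (h : R) k : 0 <= h -> forall C,
  (forall l, (l < k)%N -> forall x, derivable (partials (nseq l i) f) x (e_ i)) ->
  (forall x, `|partials (nseq k i) f x| <= C) ->
  forall x, `|iter k (rfdiff i h) f x| <= C * h ^+ k.
Proof.
move=> h0; elim: k f => [|k IH] f C df fC x; first by rewrite expr0 mulr1; exact: fC.
have comm l : (l <= k.+1)%N -> partials (nseq l i) (rfdiff i h f) =
    rfdiff i h (partials (nseq l i) f).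
  elim: l => // l IHl lk; rewrite /= IHl; last exact: ltnW.
  by have [_ ->] := @derive_rfdiff _ i i h (df l lk).
rewrite iterSr exprS mulrA; apply: IH.
  move=> l lk y; rewrite comm; last exact: leq_trans (ltnW lk) (leqnSn _).
  by apply: (derive_rfdiff _ _ _).1; apply: df; exact: leqW.
move=> y; rewrite comm//.
apply: (fdiff_derive_le h0); first by apply: df.
exact: fC.
Qed.

End smooth_functions.

(** * Littlewood-Paley families *)

Section euclidean_norm.
Context {R : realType} {n : nat}.
Implicit Types x : 'rV[R]_n.

Lemma dotrV_ge0 x : 0 <= dotrV x x.
Proof. by apply: sumr_ge0 => i _; rewrite -expr2 sqr_ge0. Qed.

Lemma eucl_norm_sqr x : eucl_norm x ^+ 2 = dotrV x x.
Proof. by rewrite sqr_sqrtr// dotrV_ge0. Qed.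

Lemma eucl_normZ (l : R) x : eucl_norm (l *: x) = `|l| * eucl_norm x.
Proof.
rewrite /eucl_norm dotrVZl dotrVZr mulrA -expr2 sqrtrM ?sqr_ge0//.
by rewrite sqrtr_sqr.
Qed.

Lemma coord_le_eucl x i : `|x ord0 i| <= eucl_norm x.
Proof.
rewrite -(@ler_pXn2r _ 2) ?nnegrE ?sqrtr_ge0// eucl_norm_sqr real_normK ?num_real//.
rewrite /dotrV (bigD1 i)//= -expr2 lerDl sumr_ge0// => j _.
by rewrite -expr2 sqr_ge0.
Qed.

Lemma norm_le_eucl x : `|x| <= eucl_norm x.
Proof. by apply/rV_normP; [exact: sqrtr_ge0|move=> i; exact: coord_le_eucl]. Qed.

End euclidean_norm.

Section littlewood_paley_facts.
Context {R : realType} {n : nat} (psi : nat -> 'rV[R]_n -> R[i]).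
Hypothesis hpsi : littlewood_paley psi.

Lemma support_neq0 j xi : psi j xi != 0 -> Defs.support (psi j) xi.
Proof. by move=> h; apply: subset_closure. Qed.

Lemma psi_support0 xi : 2 < eucl_norm xi -> psi 0%N xi = 0.
Proof.
move=> h; apply/eqP; apply: contraTT h => xi0; rewrite -leNgt.
by apply: (lp_support0 hpsi); exact: support_neq0.
Qed.

Lemma psi_support_ge j xi : psi j xi != 0 -> eucl_norm xi <= 2 ^+ j.+1.
Proof.
case: j => [|j] xi0.
  rewrite expr1 leNgt; apply: contra xi0 => h; apply/eqP; exact: psi_support0.
have /(_ xi (support_neq0 xi0)) /= := lp_support hpsi (ltn0Sn j).
by case/andP.
Qed.

Lemma psi_support_le j xi : (0 < j)%N -> psi j xi != 0 -> 2 ^+ j.-1 <= eucl_norm xi.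
Proof.
move=> j0 xi0; have /(_ xi (support_neq0 xi0)) /= := lp_support hpsi j0.
by case/andP.
Qed.

(** The partial sums are eventually constant, and they converge to 1. *)
Lemma psi_sum N xi : (forall k, (N <= k)%N -> psi k xi = 0) ->
  \sum_(k < N) psi k xi = 1.
Proof.
move=> h; apply/eqP; rewrite -subr_eq0; apply/eqP/eq0_normc.
apply: (cvg_unique (@Rhausdorff R) _ (lp_sum hpsi xi)).
apply: cvg_near_cst; exists N => // k /= Nk; congr (normc (_ - 1)).
rewrite -(subnKC Nk) big_split_ord/= [X in _ + X]big1 ?addr0// => i _.
by apply: h; rewrite leq_addr.
Qed.

(** All other members of the family live in [|xi| >= 1]. *)
Lemma psi0_eq1 xi : eucl_norm xi < 1 -> psi 0%N xi = 1.
Proof.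
move=> h; have := @psi_sum 1 xi; rewrite big_ord_recl big_ord0 addr0; apply.
move=> k k1; apply/eqP; apply: contraTT h => /(psi_support_le k1) h.
by rewrite -leNgt (le_trans _ h)// exprn_ege1// ler1n.
Qed.

Lemma psi_continuous j : ccontinuous (psi j).
Proof. by have [[s1 s2] _] := lp_test hpsi j; split; [exact: (s1 [::]).1|exact: (s2 [::]).1]. Qed.

Lemma Re_iter_fdiff i (h : R) k (m : 'rV[R]_n -> R[i]) xi :
  complex.Re (iter k (fdiff i h) m xi) =
  iter k (rfdiff i h) (fun x => complex.Re (m x)) xi.
Proof.
elim: k xi => // k IH xi; rewrite !iterS /fdiff /rfdiff -!IH.
by case: (iter _ _ _ _) (iter _ _ _ _) => [? ?] [? ?].
Qed.

Lemma Im_iter_fdiff i (h : R) k (m : 'rV[R]_n -> R[i]) xi :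
  complex.Im (iter k (fdiff i h) m xi) =
  iter k (rfdiff i h) (fun x => complex.Im (m x)) xi.
Proof.
elim: k xi => // k IH xi; rewrite !iterS /fdiff /rfdiff -!IH.
by case: (iter _ _ _ _) (iter _ _ _ _) => [? ?] [? ?].
Qed.

Definition single (i : 'I_n) (k : nat) : 'I_n -> nat := fun j => if j == i then k else 0%N.

Lemma partial_single i k (f : 'rV[R]_n -> R) : partial (single i k) f = partials (nseq k i) f.
Proof.
rewrite /partial; congr partials.
have : i \in enum 'I_n by rewrite mem_enum.
have : uniq (enum 'I_n) by exact: enum_uniq.
elim: (enum _) => // j s IH /= /andP[js us]; rewrite in_cons => /predU1P[ij|is_].
  subst j.
  rewrite /single eqxx; suff -> : flatten [seq nseq (if i0 == i then k else 0%N) i0 | i0 <- s] = [::].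
    by rewrite cats0.
  elim: s js {IH us} => // l s IH; rewrite in_cons negb_or => /andP[il ls] /=.
  by rewrite eq_sym (negbTE il)/= IH.
rewrite {1}/single ifF ?IH//; apply: contraNF js => /eqP ->; exact: is_.
Qed.

Lemma order_single i k : order_of (single i k) = k.
Proof.
rewrite /order_of (bigD1 i)//= /single eqxx big1 ?addn0// => j ji.
by rewrite (negbTE ji).
Qed.

(** The scale-invariant bounds on derivatives of a Littlewood-Paley family,
    for pure derivatives of order at most [K]. *)
Lemma psi_diff_bounded K : exists2 A : R, 0 <= A &
  forall j, diff_bounded A (2 ^+ j) K (psi j).
Proof.
have /choice[M hM] (ik : 'I_n * nat) : exists M : R, forall j xi,
    2 ^+ (j * ik.2) * normc (cpartial (single ik.1 ik.2) (psi j) xi) <= M.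
  have [M hM] := lp_bound hpsi (single ik.1 ik.2); exists M => j xi.
  by have := hM j xi; rewrite order_single.
pose A := \sum_(i < n) \sum_(k < K.+1) 2 * `|M (i, val k)|.
have MA i k : (k <= K)%N -> 2 * `|M (i, k)| <= A.
  move=> kK; rewrite /A (bigD1 i)//= (bigD1 (Ordinal (kK : (k < K.+1)%N)))//=.
  rewrite -addrA lerDl addr_ge0//; apply: sumr_ge0 => l _; first by rewrite mulr_ge0.
  by apply: sumr_ge0 => ? _; rewrite mulr_ge0.
exists A; first by apply: sumr_ge0 => i _; apply: sumr_ge0 => k _; rewrite mulr_ge0.
move=> j i h h0 k kK xi.
have j0 : 0 < (2 ^+ (j * k) : R) by rewrite exprn_gt0.
have hb y : normc (cpartial (single i k) (psi j) y) <= `|M (i, k)| / 2 ^+ (j * k).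
  by rewrite ler_pdivlMr// mulrC (le_trans (hM (i, k) j y))// ler_norm.
have [[s1 s2] _] := lp_test hpsi j.
apply: (@le_trans _ _ (2 * `|M (i, k)| * (h / 2 ^+ j) ^+ k)); last first.
  by rewrite ler_wpM2r ?exprn_ge0 ?divr_ge0 ?exprn_ge0// MA.
have -> : 2 * `|M (i, k)| * (h / 2 ^+ j) ^+ k =
    `|M (i, k)| / 2 ^+ (j * k) * h ^+ k + `|M (i, k)| / 2 ^+ (j * k) * h ^+ k.
  rewrite exprMn exprVn -exprM; ring.
apply: (le_trans (normc_le_ReIm _)); rewrite Re_iter_fdiff Im_iter_fdiff lerD//.
- apply: iter_fdiff_le => //; first by move=> l _ x; exact: (s1 _).2.
  move=> x; rewrite -partial_single; apply: le_trans (hb x).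
  exact: (Re_le_normc (cpartial (single i k) (psi j) x)).
- apply: iter_fdiff_le => //; first by move=> l _ x; exact: (s2 _).2.
  move=> x; rewrite -partial_single; apply: le_trans (hb x).
  exact: (Im_le_normc (cpartial (single i k) (psi j) x)).
Qed.

End littlewood_paley_facts.

(** * The profile and its frequency blocks *)

Section bumps.
Context {R : realType} {n : nat} (psi : nat -> 'rV[R]_n -> R[i]).
Hypothesis hpsi : littlewood_paley psi.
Hypothesis hn : (0 < n)%N.

(** A nonnegative smooth bump, with value 1 at the origin: the square makes it
    nonnegative whatever the values of [psi 0]. *)
Definition psi_bump (xi : 'rV[R]_n) : R :=
  complex.Re (psi 0%N xi) * complex.Re (psi 0%N xi).

Definition psi_bumpC (xi : 'rV[R]_n) : R[i] := (psi_bump xi)%:C.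

Lemma psi_bump_ge0 xi : 0 <= psi_bump xi.
Proof. by rewrite /psi_bump -expr2 sqr_ge0. Qed.

Lemma psi_bump0 : psi_bump 0 = 1.
Proof.
rewrite /psi_bump (psi0_eq1 hpsi) ?mulr1//.
by rewrite -(scale0r 0) eucl_normZ normr0 mul0r.
Qed.

Lemma psi_bump_eucl_support xi : 2 < eucl_norm xi -> psi_bump xi = 0.
Proof. by move=> h; rewrite /psi_bump (psi_support0 hpsi)// mul0r. Qed.

Lemma psi_bump_support xi : 2 < `|xi| -> psi_bump xi = 0.
Proof. by move=> h; apply: psi_bump_eucl_support; exact: lt_le_trans h (norm_le_eucl _). Qed.

Lemma smooth_bump : smooth psi_bump.
Proof.
have [[s1 _] _] := lp_test hpsi 0; exact: (smoothM s1 s1).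
Qed.

Lemma ccontinuous_bumpC : ccontinuous psi_bumpC.
Proof. by split; [exact: (smooth_bump [::]).1|exact: cst_continuous]. Qed.

Lemma diff_bounded_bumpC K : exists2 A : R, 0 <= A & diff_bounded A 1 K psi_bumpC.
Proof.
have [A A0 hA] := psi_diff_bounded hpsi K.
have h0 : diff_bounded A 1 K (fun xi => (complex.Re (psi 0%N xi))%:C).
  move=> i h h0 k kK xi; have := hA 0%N i h h0 k kK xi; rewrite expr0.
  apply: le_trans; apply: le_trans (Re_le_normc _).
  rewrite Re_iter_fdiff le_eqVlt; apply/orP; left; apply/eqP.
  rewrite -normc_real; congr normc; apply: complex_eq.
    by rewrite Re_iter_fdiff.
  rewrite Im_iter_fdiff /=.
  elim: k {kK} xi => // k IH xi; rewrite iterS /rfdiff !IH subrr//.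
exists (2 ^+ K * A * A); first by rewrite !mulr_ge0// exprn_ge0.
have := diff_boundedM ltr01 A0 A0 h0 h0; congr diff_bounded.
by apply/funext => xi; rewrite /psi_bumpC /psi_bump/= rmorphM.
Qed.

(** The decay obtained from [n.+1] differences is integrable. *)
Lemma nice_of_bounds m (A B : R) : 0 <= A -> 0 <= B ->
  ccontinuous m -> diff_bounded A 1 n.+1 m ->
  (forall xi : 'rV[R]_n, B < `|xi| -> m xi = 0) -> nice m.
Proof.
move=> A0 B0 cm mA mB.
have mA' xi : normc (m xi) <= A.
  by have := mA (Ordinal hn) 0 (lexx _) 0%N isT xi; rewrite expr0 mulr1.
split => //; [by exists A|by exists B|].
have im := compact_cintegrable cm mA' mB.
apply: (@cintegrable_dominated _ _ _ (fun x => @decay_const R n B * A * decay x)).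
- exact: ccontinuous_measurable (ccontinuous_inv_fourier im mB).
- move=> x; have := @inv_fourier_decay _ _ m A B 1 x hn ltr01 A0 B0 cm mA.
  by rewrite mulr1 expr1n mulr1 scale1r; apply.
- under [_ \o _]eq_fun do rewrite /= EFinM.
  by apply: integrableZl => //; exact: integrable_decay.
Qed.

Lemma nice_bumpC : nice psi_bumpC.
Proof.
have [A A0 hA] := diff_bounded_bumpC n.+1.
apply: (nice_of_bounds A0 (ler0n R 2) ccontinuous_bumpC hA).
by move=> xi h; rewrite /psi_bumpC psi_bump_support.
Qed.

(** A bump of radius 2 centred here lies in [6 <= |xi| <= 10]. The annuli of
    [psi k] that meet the dilate [6 * 2^J <= |xi| <= 10 * 2^J] are those with
    [J + 2 <= k <= J + 4]. *)
Definition shift8 : 'rV[R]_n := 8 *: delta_mx ord0 (Ordinal hn).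

Definition chi (xi : 'rV[R]_n) : R[i] := psi_bumpC (xi - shift8).

Lemma nice_chi : nice chi.
Proof. exact: (nice_translate _ nice_bumpC). Qed.

Lemma diff_bounded_chi K : exists2 A : R, 0 <= A & diff_bounded A 1 K chi.
Proof.
have [A A0 hA] := diff_bounded_bumpC K; exists A => //.
exact: diff_bounded_translate.
Qed.

Lemma chi_eucl_support xi : chi xi != 0 -> 6 <= eucl_norm xi <= 10.
Proof.
move=> h; have e2 : eucl_norm (xi - shift8) <= 2.
  rewrite leNgt; apply: contra h => h; rewrite /chi /psi_bumpC psi_bump_eucl_support//.
have x0 : 0 <= eucl_norm xi by exact: sqrtr_ge0.
have := coord_le_eucl xi (Ordinal hn).
have : eucl_norm (xi - shift8) ^+ 2 <= 2 ^+ 2.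
  by apply: lerXn2r => //; rewrite nnegrE ?sqrtr_ge0.
have -> : eucl_norm (xi - shift8) ^+ 2 =
    eucl_norm xi ^+ 2 - 16 * xi ord0 (Ordinal hn) + 64.
  rewrite !eucl_norm_sqr /shift8 -scaleNr dotrVDl !dotrVDr !dotrVZl !dotrVZr.
  rewrite (dotrVC (delta_mx _ _) xi) !dotrV_delta mxE !eqxx/=; ring.
rewrite ler_norml => h1 /andP[_ h2]; apply/andP; split; nra.
Qed.

Lemma chi_support xi : 10 < `|xi| -> chi xi = 0.
Proof.
move=> h; apply/eqP; apply: contraTT h => /chi_eucl_support /andP[_ h].
by rewrite -leNgt (le_trans (norm_le_eucl _)).
Qed.

Definition profile : 'rV[R]_n -> R[i] := inv_fourier chi.

Lemma profile_decay : exists2 C : R, 0 < C & forall x, normc (profile x) <= C * decay x.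
Proof.
have [A A0 hA] := diff_bounded_chi n.+1; have [cm _ _ _] := nice_chi.
have D0 : 0 <= @decay_const R n 10 * A :> R.
  by rewrite /decay_const !mulr_ge0 ?exprn_ge0// ?mulr_ge0// addr_ge0.
exists (@decay_const R n 10 * A + 1); first by rewrite ltr_wpDl.
move=> x; have := @inv_fourier_decay _ _ chi A 10 1 x hn ltr01 A0 (ler0n R 10) cm hA.
rewrite mulr1 expr1n mulr1 scale1r => /(_ chi_support) h; apply: le_trans h _.
by rewrite ler_wpM2r ?(ltW (decay_gt0 _))// lerDl.
Qed.

(** Near the origin the profile is close to its value [\int chi > 0] there. *)
Lemma profile_pos : exists2 k : R, 0 < k & exists2 rho : R, 0 < rho &
  forall x, `|x| <= rho -> k <= complex.Re (profile x).
Proof.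
have ic := nice_cintegrable nice_chi; have [cm _ _ _] := nice_chi.
have cp : ccontinuous profile by exact: ccontinuous_inv_fourier ic chi_support.
have p0 : 0 < complex.Re (profile 0).
  rewrite /profile inv_fourier0 /=; apply: (Rintegral_gt0 (x0 := shift8)).
  - exact: cm.1.
  - by move=> x; rewrite /= psi_bump_ge0.
  - exact: ic.1.
  - by rewrite /= subrr psi_bump0.
have /nbhs_ballP[e /= e0 eU] : nbhs (0 : 'rV[R]_n)
    [set x | complex.Re (profile 0) / 2 < complex.Re (profile x)].
  apply: (cp.1 0 [set y | complex.Re (profile 0) / 2 < y]).
  by apply: open_nbhs_nbhs; split; [exact: open_gt|rewrite /= ltr_pdivrMr// ltr_pMr// ltr1n].
exists (complex.Re (profile 0) / 2); first by rewrite divr_gt0.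
exists (e / 2); first by rewrite divr_gt0.
move=> x xe; apply/ltW; apply: eU; rewrite mx_norm_ball /ball_/= sub0r normrN.
by apply: le_lt_trans xe _; rewrite ltr_pdivrMr// ltr_pMr// ltr1n.
Qed.

Definition chi_at (t : R) (xi : 'rV[R]_n) : R[i] := chi (t^-1 *: xi).

Lemma chi_at_support (t : R) xi : 0 < t -> chi_at t xi != 0 ->
  6 * t <= eucl_norm xi <= 10 * t.
Proof.
move=> t0 /chi_eucl_support; rewrite eucl_normZ gtr0_norm ?invr_gt0//.
by rewrite mulrC ler_pdivlMr// ler_pdivrMr.
Qed.

Lemma ccontinuous_chi_at (t : R) : 0 < t -> ccontinuous (chi_at t).
Proof.
move=> t0; have [[c1 c2] _ _ _] := nice_chi.
have t1 : 0 < t^-1 by rewrite invr_gt0.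
have h1 := @continuous_affine_comp _ _ _ t^-1 0 t1 c1.
have h2 := @continuous_affine_comp _ _ _ t^-1 0 t1 c2.
by split; rewrite /chi_at; [move: h1|move: h2];
  under [X in continuous X -> _]eq_fun do rewrite addr0.
Qed.

Lemma cintegrable_chi_at (t : R) : 0 < t -> cintegrable (chi_at t).
Proof.
move=> t0; have := cintegrable_affine 0 (_ : 0 < t^-1) (nice_cintegrable nice_chi).
rewrite invr_gt0 => /(_ t0).
by under [X in cintegrable X -> _]eq_fun do rewrite addr0.
Qed.

Lemma inv_fourier_chi_at (t : R) x : 0 < t ->
  inv_fourier (chi_at t) x = (t ^+ n)%:C * profile (t *: x).
Proof. by move=> t0; rewrite -inv_fourier_dilate//; exact: nice_cintegrable nice_chi. Qed.

Lemma nice_chi_at (t : R) : 0 < t -> nice (chi_at t).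
Proof.
move=> t0; have [cm [M hM] _ iP] := nice_chi; split.
- exact: ccontinuous_chi_at.
- by exists M => xi; exact: hM.
- exists (10 * t) => xi h; apply: chi_support.
  by rewrite normrZ gtr0_norm ?invr_gt0// mulrC ltr_pdivlMr.
- have := cintegrableZ (t ^+ n)%:C (cintegrable_affine 0 t0 iP).
  congr cintegrable; apply/funext => x.
  by rewrite addr0 inv_fourier_chi_at.
Qed.

Lemma psi_chi_at_window J k xi : psi k xi * chi_at (2 ^+ J) xi != 0 ->
  (J.+2 <= k <= J.+4)%N.
Proof.
have t0 : 0 < 2 ^+ J :> R by rewrite exprn_gt0.
rewrite mulf_eq0 negb_or => /andP[p0 /(chi_at_support t0)/andP[c1 c2]].
have h1 := psi_support_ge hpsi p0.
have pow a b : (2 : R) ^+ a < 2 ^+ b -> (a < b)%N by rewrite ltr_eXn2l// ltr1n.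
apply/andP; split.
  have : (2 : R) ^+ J.+2 < 2 ^+ k.+1.
    apply: lt_le_trans h1; apply: lt_le_trans c1.
    by rewrite !exprS mulrA ltr_pM2r// -natrM ltr_nat.
  by move/pow; rewrite ltnS.
case: k p0 {h1} => // k p0; have h1 := psi_support_le hpsi (ltn0Sn k) p0.
have : (2 : R) ^+ k < 2 ^+ J.+4.
  apply: (le_lt_trans h1); apply: (le_lt_trans c2).
  by rewrite !exprS !mulrA ltr_pM2r// -!natrM ltr_nat.
by move/pow.
Qed.

Lemma psi_chi_at_sum J xi :
  \sum_(k < J.+4.+1) psi k xi * chi_at (2 ^+ J) xi = chi_at (2 ^+ J) xi.
Proof.
have [->|c0] := eqVneq (chi_at (2 ^+ J) xi) 0; first by rewrite big1// => k _; rewrite mulr0.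
rewrite -mulr_suml (psi_sum hpsi) ?mul1r// => k Jk.
apply/eqP; apply: contraTT Jk => p0; rewrite -ltnNge ltnS.
by have /psi_chi_at_window/andP[] : psi k xi * chi_at (2 ^+ J) xi != 0 by rewrite mulf_neq0.
Qed.

(** For [J >= 4] the dilate by [2 ^- J] lies in [|xi| < 1], where [psi 0] is
    1. *)
Lemma psi_chi_at_low J k xi : (4 <= J)%N ->
  psi k xi * chi_at (2 ^+ J)^-1 xi = if k == 0%N then chi_at (2 ^+ J)^-1 xi else 0.
Proof.
move=> J4; have t0 : 0 < (2 ^+ J)^-1 :> R by rewrite invr_gt0 exprn_gt0.
have [->|c0] := eqVneq (chi_at (2 ^+ J)^-1 xi) 0; first by rewrite mulr0; case: ifP.
have /andP[_ c2] := chi_at_support t0 c0.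
have x1 : eucl_norm xi < 1.
  apply: (le_lt_trans c2); rewrite ltr_pdivrMr ?exprn_gt0// mul1r.
  apply: (@lt_le_trans _ _ (2 ^+ 4)); first by rewrite -natrX ltr_nat.
  by rewrite ler_weXn2l// ler1n.
case: k => [|k] /=; first by rewrite (psi0_eq1 hpsi)// mul1r.
suff -> : psi k.+1 xi = 0 by rewrite mul0r.
apply/eqP; apply: contraTT x1 => /(psi_support_le hpsi (ltn0Sn k)) h.
by rewrite -leNgt (le_trans _ h)// exprn_ege1// ler1n.
Qed.

(** The k-th block of the dilate [t ^ n * profile (t x)]. *)
Definition lp_kernel k t : 'rV[R]_n -> R[i] :=
  inv_fourier (fun xi => psi k xi * chi_at t xi).

Lemma ccontinuousM (f g : 'rV[R]_n -> R[i]) : ccontinuous f -> ccontinuous g ->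
  ccontinuous (fun x => f x * g x).
Proof.
move=> [f1 f2] [g1 g2]; split => x.
- have a1 : complex.Re (f y) @[y --> x] --> complex.Re (f x) := f1 x.
  have a2 : complex.Im (f y) @[y --> x] --> complex.Im (f x) := f2 x.
  have b1 : complex.Re (g y) @[y --> x] --> complex.Re (g x) := g1 x.
  have b2 : complex.Im (g y) @[y --> x] --> complex.Im (g x) := g2 x.
  under eq_fun do rewrite cReM.
  exact: (cvgB (cvgM a1 b1) (cvgM a2 b2)).
- have a1 : complex.Re (f y) @[y --> x] --> complex.Re (f x) := f1 x.
  have a2 : complex.Im (f y) @[y --> x] --> complex.Im (f x) := f2 x.
  have b1 : complex.Re (g y) @[y --> x] --> complex.Re (g x) := g1 x.
  have b2 : complex.Im (g y) @[y --> x] --> complex.Im (g x) := g2 x.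
  under eq_fun do rewrite cImM.
  exact: (cvgD (cvgM a1 b2) (cvgM a2 b1)).
Qed.

Lemma psi_bounded : exists2 M : R, 0 <= M & forall k xi, normc (psi k xi) <= M.
Proof.
have [A A0 hA] := psi_diff_bounded hpsi 0; exists A => // k xi.
by have := hA k (Ordinal hn) 0 (lexx _) 0%N isT xi; rewrite expr0 mulr1.
Qed.

Lemma cintegrable_psiM k m : cintegrable m -> cintegrable (fun xi => psi k xi * m xi).
Proof.
move=> im; have [M _ hM] := psi_bounded.
have := cintegrable_bounded (ccontinuous_measurable (psi_continuous hpsi k)) (hM k) im.
by congr cintegrable; apply/funext => xi; rewrite mulrC.
Qed.

Lemma lp_kernel_window J k : ~~ (J.+2 <= k <= J.+4)%N -> lp_kernel k (2 ^+ J) = fun=> 0.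
Proof.
move=> h; apply/funext => x; rewrite /lp_kernel.
have -> : (fun xi => psi k xi * chi_at (2 ^+ J) xi) = fun=> 0.
  by apply/funext => xi; apply/eqP; apply: contraNT h; exact: psi_chi_at_window.
by rewrite -[RHS](@cintegral0 R n); apply: eq_cintegral => xi; rewrite mul0r.
Qed.

(** The three blocks of the window sum up to the identity on the dilate. *)
Lemma lp_kernel_sum J x : lp_kernel J.+2 (2 ^+ J) x + lp_kernel J.+3 (2 ^+ J) x +
  lp_kernel J.+4 (2 ^+ J) x = ((2 ^+ J) ^+ n)%:C * profile (2 ^+ J *: x).
Proof.
have t0 : 0 < 2 ^+ J :> R by rewrite exprn_gt0.
rewrite -inv_fourier_chi_at//.
transitivity (\sum_(k < J.+4.+1) lp_kernel k (2 ^+ J) x).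
  rewrite 3!big_ord_recr/= big1 ?add0r// => k _; rewrite lp_kernel_window//.
  by rewrite negb_and -ltnNge (ltn_ord k).
rewrite -cintegral_sum; last first.
  move=> k; apply: cintegrable_inv_fourier; apply: cintegrable_psiM.
  exact: cintegrable_chi_at.
apply: eq_cintegral => xi; rewrite -[in RHS]psi_chi_at_sum mulr_suml.
by apply: eq_bigr => k _.
Qed.

Lemma lp_kernel_low J k x : (4 <= J)%N -> lp_kernel k (2 ^+ J)^-1 x =
  if k == 0%N then ((2 ^+ J)^-1 ^+ n)%:C * profile ((2 ^+ J)^-1 *: x) else 0.
Proof.
move=> J4; have t0 : 0 < (2 ^+ J)^-1 :> R by rewrite invr_gt0 exprn_gt0.
rewrite /lp_kernel; under [X in inv_fourier X]eq_fun do rewrite psi_chi_at_low//.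
case: ifP => _; first exact: inv_fourier_chi_at.
by rewrite -[RHS](@cintegral0 R n); apply: eq_cintegral => xi; rewrite mul0r.
Qed.

(** Uniformity in [J] comes from the scale-invariant derivative bounds of a
    Littlewood-Paley family. *)
Lemma lp_kernel_decay : exists2 C : R, 0 < C & forall J k x,
  normc (lp_kernel k (2 ^+ J) x) <= C * (2 ^+ J) ^+ n * decay (2 ^+ J *: x).
Proof.
have [A A0 hA] := psi_diff_bounded hpsi n.+1.
have [A' A'0 hA'] := diff_bounded_chi n.+1.
pose D : R := 2 ^+ n.+1 * A * A'.
have D0 : 0 <= D by rewrite !mulr_ge0// exprn_ge0.
have C0 : 0 <= @decay_const R n 10 * D :> R.
  by rewrite mulr_ge0// /decay_const !mulr_ge0 ?exprn_ge0// ?mulr_ge0// addr_ge0.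
exists (@decay_const R n 10 * D + 1); first by rewrite ltr_wpDl.
move=> J k x; have t0 : 0 < 2 ^+ J :> R by rewrite exprn_gt0.
have dx := ltW (decay_gt0 (2 ^+ J *: x)).
have [kJ|kJ] := boolP (J.+2 <= k <= J.+4)%N; last first.
  rewrite lp_kernel_window// normc0 mulr_ge0// mulr_ge0 ?exprn_ge0//.
  by rewrite addr_ge0.
apply: (@le_trans _ _ (@decay_const R n 10 * D * (2 ^+ J) ^+ n * decay (2 ^+ J *: x))); last first.
  by rewrite ler_wpM2r// ler_wpM2r ?exprn_ge0// lerDl.
apply: inv_fourier_decay => //.
- apply: ccontinuousM; first exact: psi_continuous.
  exact: ccontinuous_chi_at.
- have h1 : diff_bounded A (2 ^+ J) n.+1 (psi k).
    have := @diff_bounded_rescale _ _ A (2 ^+ k) (2 ^+ J) 1 n.+1 (psi k).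
    rewrite [1 ^+ _]expr1n mulr1; apply => //.
    rewrite mul1r ler_weXn2l ?ler1n//; case/andP: kJ => kJ _.
    by rewrite (leq_trans _ kJ)// -addn2 leq_addr.
  exact: (diff_boundedM t0 A0 A'0 h1 (diff_bounded_dilate t0 hA')).
- move=> xi h; rewrite /chi_at chi_support ?mulr0//.
  by rewrite normrZ gtr0_norm ?invr_gt0// mulrC ltr_pdivlMr.
Qed.

End bumps.

(** * Schwartz functions *)

Section schwartz_facts.
Context {R : realType} {n : nat}.
Local Notation Rn := 'rV[measurableTypeR R]_n.
Local Notation mu := (@lebesgue_rV R n).
Local Notation integrable f := (mu.-integrable setT (EFin \o f)).
Implicit Types (phi : 'rV[R]_n -> R[i]).

Let zero : 'I_n -> nat := fun=> 0%N.

Lemma cpartial_zero phi : cpartial zero phi = phi.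
Proof.
have E (f : 'rV[R]_n -> R) : partial zero f = f.
  rewrite /partial (_ : flatten _ = [::])//.
  by elim: (enum _).
by apply/funext => x; rewrite /cpartial !E; case: (phi x).
Qed.

Lemma schwartz_ccontinuous phi : schwartz phi -> ccontinuous phi.
Proof. by case=> -[s1 s2] _; split; [exact: (s1 [::]).1|exact: (s2 [::]).1]. Qed.

Lemma monomial_single i k (x : 'rV[R]_n) : monomial (single i k) x = x ord0 i ^+ k.
Proof.
rewrite /monomial (bigD1 i)//= /single eqxx big1 ?mulr1// => j ji.
by rewrite (negbTE ji) expr0.
Qed.

Lemma monomial_zero (x : 'rV[R]_n) : monomial zero x = 1.
Proof. by rewrite /monomial big1// => i _; rewrite expr0. Qed.

Lemma schwartz_seminorm_ge0 (a b : 'I_n -> nat) phi : schwartz phi ->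
  0 <= schwartz_seminorm a b phi.
Proof.
move=> [_ /(_ a b)[M hM]].
apply: (@le_trans _ _ (`|monomial a 0| * normc (cpartial b phi 0))).
  by rewrite mulr_ge0 ?normc_ge0.
apply: ub_le_sup; last by exists 0.
by exists M => _ [x _ <-]; exact: hM.
Qed.

Lemma normc_le_seminorm phi x : schwartz phi -> normc (phi x) <= schwartz_seminorm zero zero phi.
Proof.
move=> [_ /(_ zero zero)[M hM]]; apply: ub_le_sup.
  by exists M => _ [y _ <-]; exact: hM.
by exists x => //; rewrite monomial_zero normr1 mul1r cpartial_zero.
Qed.

(** Bounds on [|x_i|^(n+1) |phi x|] for every [i] suffice, since [|x|] is the
    largest [|x_i|]. *)
Lemma schwartz_decay phi : schwartz phi -> exists C : R, forall x,
  normc (phi x) <= C * decay x.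
Proof.
move=> sphi; have [_ hphi] := sphi.
have /choice[M hM] (i : 'I_n) : exists M : R, forall x : 'rV[R]_n,
    `|x ord0 i| ^+ n.+1 * normc (phi x) <= M.
  have [M hM] := hphi (single i n.+1) zero; exists M => x.
  by have := hM x; rewrite monomial_single normrX cpartial_zero.
pose M0 := schwartz_seminorm zero zero phi.
have M00 : 0 <= M0 by exact: schwartz_seminorm_ge0.
have S0 : 0 <= \sum_i `|M i| by apply: sumr_ge0.
exists (2 ^+ n.+1 * (M0 + \sum_i `|M i|)) => x.
have s0 := normr_ge0 x.
rewrite /decay ler_pdivlMr ?exprn_gt0 ?ltr_pwDl//.
have [x1|x1] := ltP `|x| 1.
  rewrite mulrC; apply: ler_pM; rewrite ?exprn_ge0 ?normc_ge0 ?addr_ge0//.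
    by apply: lerXn2r; rewrite ?nnegrE ?addr_ge0//; lra.
  by rewrite (le_trans (normc_le_seminorm x sphi))// lerDl.
have [i yi] := norm_attained (lt_le_trans ltr01 x1).
apply: (@le_trans _ _ (2 ^+ n.+1 * (`|x| ^+ n.+1 * normc (phi x)))).
  rewrite mulrA -exprMn mulrC ler_wpM2r ?normc_ge0//.
  by apply: lerXn2r; rewrite ?nnegrE ?addr_ge0 ?mulr_ge0//; lra.
rewrite ler_wpM2l ?exprn_ge0// yi (le_trans (hM i x))//.
rewrite (le_trans (ler_norm _))// ler_wpDl// (bigD1 i)//= lerDl.
by apply: sumr_ge0.
Qed.

Lemma schwartz_cintegrable phi : schwartz phi -> cintegrable phi.
Proof.
move=> sphi; have [C hC] := schwartz_decay sphi.
apply: (cintegrable_dominated (b := fun x : Rn => C * decay (x : 'rV[R]_n))) => //.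
  exact: ccontinuous_measurable (schwartz_ccontinuous sphi).
under [_ \o _]eq_fun do rewrite /= EFinM.
by apply: integrableZl => //; exact: integrable_decay.
Qed.

End schwartz_facts.

(** * Distributions with a nice Fourier transform *)

Section regular_distributions.
Context {R : realType} {n : nat} (psi : nat -> 'rV[R]_n -> R[i]).
Hypothesis hpsi : littlewood_paley psi.
Hypothesis hn : (0 < n)%N.
Local Notation Rn := 'rV[measurableTypeR R]_n.
Local Notation mu := (@lebesgue_rV R n).
Local Notation integrable f := (mu.-integrable setT (EFin \o f)).

Definition distr_of (m : 'rV[R]_n -> R[i]) : ('rV[R]_n -> R[i]) -> R[i] :=
  fun phi => cintegral (fun x => inv_fourier m x * phi x).

Lemma cintegrable_schwartzM (u phi : 'rV[R]_n -> R[i]) : cintegrable u -> schwartz phi ->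
  cintegrable (fun x => u x * phi x).
Proof.
move=> iu sphi; apply: (cintegrable_bounded (M := schwartz_seminorm (fun=> 0%N) (fun=> 0%N) phi)) => //.
  exact: ccontinuous_measurable (schwartz_ccontinuous sphi).
by move=> x; exact: normc_le_seminorm.
Qed.

(** Integration against an integrable function is bounded by the first
    seminorm alone. *)
Lemma tempered_distr_of m : nice m -> tempered (distr_of m).
Proof.
case=> _ _ _ iu; split.
  move=> c f g sf sg; rewrite /distr_of.
  rewrite -cintegralZ; last exact: cintegrable_schwartzM.
  rewrite -cintegralD; first last.
  - exact: cintegrable_schwartzM.
  - by apply: cintegrableZ; exact: cintegrable_schwartzM.
  by apply: eq_cintegral => x; ring.
have iN := cintegrable_normc iu.
exists (2 * \int[mu]_x normc (inv_fourier m x)), 0%N => phi sphi.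
pose a0 : {ffun 'I_n -> 'I_1} := [ffun=> ord0].
have pa (a : {ffun 'I_n -> 'I_1}) : true = (a == a0).
  by apply/esym/eqP/ffunP => i; rewrite ffunE (ord1 (a i)).
rewrite (big_pred1 a0)//; rewrite (big_pred1 a0)//.
have -> : (fun i => nat_of_ord (a0 i)) = (fun=> 0%N).
  by apply/funext => i; rewrite ffunE.
set S := schwartz_seminorm _ _ _.
apply: le_trans (normc_cintegral_le (b := fun x => S * normc (inv_fourier m x)) _ _ _) _.
- exact: cintegrable_schwartzM.
- by move=> x; rewrite normcM mulrC ler_wpM2r ?normc_ge0//; exact: normc_le_seminorm.
- by under [_ \o _]eq_fun do rewrite /= EFinM; exact: integrableZl.
- by rewrite RintegralZl// mulrCA mulrC.
Qed.

(** A bump concentrated where [v] keeps its sign detects a nonzero value. *)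
Lemma eq0_of_bump_integrals (v : 'rV[R]_n -> R) : continuous v ->
  (forall (l : R) (x0 : 'rV[R]_n), 0 < l ->
    integrable (fun x : Rn => v x * psi_bump psi (l *: (x : 'rV[R]_n) + x0)) /\
    \int[mu]_x (v x * psi_bump psi (l *: (x : 'rV[R]_n) + x0)) = 0) ->
  forall x, v x = 0.
Proof.
move=> cv hv x0; apply/eqP; apply/negPn/negP => v0.
have /nbhs_ballP[e /= e0 eU] : nbhs x0 [set x | `|v x0 - v x| < `|v x0|].
  apply: (cv x0 [set y | `|v x0 - y| < `|v x0|]).
  by apply: nbhsx_ballx; rewrite normr_gt0.
have l0 : 0 < 4 / e by rewrite divr_gt0.
have [iv ev] := hv _ (- ((4 / e) *: x0)) l0.
(* The bump lives in the ball of radius [e / 2] around [x0]; multiplying by [v x0]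
   makes the integrand nonnegative there. *)
pose h x := v x0 * (v x * psi_bump psi ((4 / e) *: x + - ((4 / e) *: x0))).
suff : 0 < \int[mu]_x h x by rewrite RintegralZl// ev mulr0 ltxx.
apply: (Rintegral_gt0 (x0 := x0)).
- move=> x; have h1 : v y @[y --> x] --> v x := cv x.
  have h2 := @continuous_affine_comp _ _ _ _ (- ((4 / e) *: x0)) l0 (smooth_bump hpsi [::]).1 x.
  exact: (cvgM (cvg_cst _) (cvgM h1 h2)).
- move=> x; rewrite /h mulrA.
  have [xx|xx] := ltP 2 `|(4 / e) *: x - (4 / e) *: x0|.
    by rewrite (psi_bump_support hpsi)// mulr0.
  rewrite mulr_ge0 ?psi_bump_ge0//.
  have : `|v x0 - v x| < `|v x0|.
    apply: eU; rewrite mx_norm_ball /ball_/= distrC.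
    rewrite -scalerBr normrZ (gtr0_norm l0) in xx.
    have : `|x - x0| <= e / 2.
      rewrite -(ler_pM2l l0); apply: le_trans xx _.
      by rewrite le_eqVlt; apply/orP; left; apply/eqP; field; rewrite gt_eqF.
    by move/le_lt_trans; apply; rewrite ltr_pdivrMr// ltr_pMr// ltr1n.
  have [vp|vn] := ltP 0 (v x0).
    by rewrite (gtr0_norm vp) ltr_norml => /andP[_ h1]; rewrite mulr_ge0 ?ltW//; lra.
  rewrite (ler0_norm vn) ltr_norml => /andP[h1 _]; rewrite mulr_le0//; lra.
- by rewrite /h; under [_ \o _]eq_fun do rewrite /= EFinM; exact: integrableZl.
- rewrite /h subrr (psi_bump0 hpsi) mulr1 -expr2 lt_neqAle sqr_ge0 andbT eq_sym.
  by rewrite sqrf_eq0.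
Qed.

(** Test against translated and dilated bumps, which are Schwartz functions. *)
Lemma represents_unique (g1 g2 : 'rV[R]_n -> R[i]) T : ccontinuous g1 -> ccontinuous g2 ->
  represents g1 T -> represents g2 T -> g1 = g2.
Proof.
move=> c1 c2 r1 r2.
have sb (l : R) (x0 : 'rV[R]_n) : 0 < l -> schwartz (fun x => (psi_bump psi (l *: x + x0))%:C).
  move=> l0; apply: (@schwartz_real _ _ _ ((2 + `|x0|) / l)).
    by apply: smooth_affine => //; exact: smooth_bump.
  move=> x; rewrite ltr_pdivrMr// => h; apply: (psi_bump_support hpsi).
  rewrite -ltrBrDr in h; apply: lt_le_trans h _; rewrite lerBlDr.
  rewrite mulrC -{1}(gtr0_norm l0) -normrZ.
  by rewrite -[X in `|X| <= _](addrK x0) (le_trans (ler_normB _ _)).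
have E (l : R) (x0 : 'rV[R]_n) : 0 < l ->
    [/\ integrable (fun x : Rn => complex.Re (g1 x) * psi_bump psi (l *: (x : 'rV[R]_n) + x0)),
        integrable (fun x : Rn => complex.Im (g1 x) * psi_bump psi (l *: (x : 'rV[R]_n) + x0)),
        integrable (fun x : Rn => complex.Re (g2 x) * psi_bump psi (l *: (x : 'rV[R]_n) + x0)),
        integrable (fun x : Rn => complex.Im (g2 x) * psi_bump psi (l *: (x : 'rV[R]_n) + x0)) &
     \int[mu]_x (complex.Re (g1 x) * psi_bump psi (l *: (x : 'rV[R]_n) + x0)) =
     \int[mu]_x (complex.Re (g2 x) * psi_bump psi (l *: (x : 'rV[R]_n) + x0)) /\
     \int[mu]_x (complex.Im (g1 x) * psi_bump psi (l *: (x : 'rV[R]_n) + x0)) =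
     \int[mu]_x (complex.Im (g2 x) * psi_bump psi (l *: (x : 'rV[R]_n) + x0))].
  move=> l0; have [[i1 i2] e1] := r1 _ (sb l x0 l0).
  have [[i3 i4] e2] := r2 _ (sb l x0 l0).
  have eR (g : 'rV[R]_n -> R[i]) : (fun x => complex.Re (g x * (psi_bump psi (l *: x + x0))%:C)) =
      (fun x => complex.Re (g x) * psi_bump psi (l *: x + x0)).
    by apply/funext => x; rewrite cReM/= mulr0 subr0.
  have eI (g : 'rV[R]_n -> R[i]) : (fun x => complex.Im (g x * (psi_bump psi (l *: x + x0))%:C)) =
      (fun x => complex.Im (g x) * psi_bump psi (l *: x + x0)).
    by apply/funext => x; rewrite cImM/= mulr0 add0r.
  rewrite -!eR -!eI; split => //; split.
  - exact: (congr1 (@complex.Re R) (etrans (esym e1) e2)).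
  - exact: (congr1 (@complex.Im R) (etrans (esym e1) e2)).
apply/funext => x; apply: complex_eq; apply/eqP; rewrite -subr_eq0; apply/eqP.
- apply: (@eq0_of_bump_integrals (fun x => complex.Re (g1 x) - complex.Re (g2 x))).
    move=> y; have h1 : complex.Re (g1 z) @[z --> y] --> complex.Re (g1 y) := c1.1 y.
    have h2 : complex.Re (g2 z) @[z --> y] --> complex.Re (g2 y) := c2.1 y.
    exact: (cvgB h1 h2).
  move=> l x0 l0; have [i1 _ i2 _ [e _]] := E l x0 l0.
  under [_ \o _]eq_fun do rewrite mulrBl EFinB; split; first exact: integrableB.
  by under eq_Rintegral do rewrite mulrBl; rewrite RintegralB// e subrr.
- apply: (@eq0_of_bump_integrals (fun x => complex.Im (g1 x) - complex.Im (g2 x))).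
    move=> y; have h1 : complex.Im (g1 z) @[z --> y] --> complex.Im (g1 y) := c1.2 y.
    have h2 : complex.Im (g2 z) @[z --> y] --> complex.Im (g2 y) := c2.2 y.
    exact: (cvgB h1 h2).
  move=> l x0 l0; have [_ i1 _ i2 [_ e]] := E l x0 l0.
  under [_ \o _]eq_fun do rewrite mulrBl EFinB; split; first exact: integrableB.
  by under eq_Rintegral do rewrite mulrBl; rewrite RintegralB// e subrr.
Qed.

(** The constant of [fourier_inv], for the bump built from [psi]. *)
Definition inv_const : R[i] := cintegral (inv_fourier (psi_bumpC psi)).

Lemma inv_const_neq0 : inv_const != 0.
Proof.
apply: inv_fourier_constant_neq0; first exact: nice_bumpC.
- by rewrite /psi_bumpC (psi_bump0 hpsi).
- by [].
- by move=> x; exact: psi_bump_ge0.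
Qed.

(** Transposing twice, the block tested on [phi] becomes the integral of [phi]
    against the right-hand side; two exchanges of integrals and the inversion
    formula do this, and a continuous representative is unique. *)
Lemma function_of_block m k : nice m ->
  function_of (lp_block psi k (distr_of m)) =
  (fun x => inv_const * inv_fourier (fun xi => psi k xi * m xi) x).
Proof.
move=> nm; have im := nice_cintegrable nm; have [cm [Mm mM] [B mB] iu] := nm.
have fE : fourier (inv_fourier m) = fun xi => inv_const * m xi.
  apply/funext => xi; apply: fourier_inv => //; first exact: nice_bumpC.
  by rewrite /psi_bumpC (psi_bump0 hpsi).
have ipm := cintegrable_psiM hpsi hn k im.
pose g x := inv_const * inv_fourier (fun xi => psi k xi * m xi) x.
have gE : g = inv_fourier (fun xi => inv_const * (psi k xi * m xi)).
  apply/funext => x; rewrite /g -cintegralZ; last exact: cintegrable_inv_fourier.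
  by apply: eq_cintegral => xi; rewrite !mulrA.
have icpm := cintegrableZ inv_const ipm.
have cg : ccontinuous g.
  by rewrite gE; apply: (ccontinuous_inv_fourier (B := B)) => // xi /mB ->; rewrite !mulr0.
have rg : represents g (lp_block psi k (distr_of m)).
  move=> phi sphi; have iphi := schwartz_cintegrable sphi.
  split.
    have := @cintegrable_bounded _ _ phi g (2 * \int[mu]_y
       normc (inv_const * (psi k y * m y))) (ccontinuous_measurable cg).
    have -> : (fun x => phi x * g x) = (fun x => g x * phi x).
      by apply/funext => x; rewrite mulrC.
    apply => // x; rewrite gE; apply: normc_inv_fourier_le => //.
      exact: cintegrable_measurable.
    exact: cintegrable_normc.
  have iG : cintegrable (fun xi => psi k xi * inv_fourier phi xi).
    have ipsi : cintegrable (psi k).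
      have [M _ hM] := psi_bounded hpsi hn.
      apply: (compact_cintegrable (psi_continuous hpsi k) (hM k) (B := 2 ^+ k.+1)).
      move=> xi h; apply/eqP; apply: contraTT h => /(psi_support_ge hpsi) h.
      by rewrite -leNgt (le_trans (norm_le_eucl _)).
    have mk : measurable_fun setT (fun z : Rn * Rn => 2 * pi * dotrV (z.1 : 'rV[R]_n) z.2).
      by apply: measurable_funM => //; exact: measurable_dotrV.
    exact: (cintegral_char_swap mk ipsi iphi).1.
  rewrite /lp_block /dinv_fourier /dmul /dfourier /distr_of.
  rewrite cintegral_fourier_swap// fE gE -cintegral_inv_fourier_swap//.
  by apply: eq_cintegral => xi; ring.
apply: xget_unique => [|g' [cg' rg']]; first by split.
exact: (represents_unique cg' cg rg' rg).
Qed.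

End regular_distributions.

(** * The sequence norms *)

Section sequence_norms.
Context {R : realType}.
Implicit Types (w : nat -> R) (r : \bar R).
Local Open Scope ereal_scope.

(** Turns the almost everywhere statements of the case [r = +oo] into
    pointwise ones. *)
Lemma counting_eq0 (A : set nat) : @counting nat R A = 0 -> A = set0.
Proof.
rewrite /counting; case: ifPn => [/asboolP fA|//].
move=> /eqP; rewrite eqe pnatr_eq0 finmap.cardfs_eq0 => /eqP e.
by rewrite -[LHS](fset_setK fA) e; apply/seteqP; split => x.
Qed.

Lemma le_Lnorm_counting w k r : (forall j, 0 <= w j)%R -> 1 <= r ->
  (w k)%:E <= 'N[counting]_r [(fun j => (w j)%:E)].
Proof.
move=> w0; case: r => [r||] //; last first.
  move=> _; rewrite unlock; case: ifPn => [_|]; last first.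
    rewrite -leNgt => h; have : @counting nat R setT = 0.
      by apply/eqP; rewrite eq_le h measure_ge0.
    by move/counting_eq0/seteqP => [/(_ 0%N I)].
  have [N [mN /counting_eq0 N0 NE]] := ess_sup_ge (@counting nat R) (abse \o (fun j => (w j)%:E)).
  apply: contrapT => h; suff : N k by rewrite N0.
  apply: NE => /=; move=> h'; apply: h; apply: le_trans h' => /=.
  by rewrite lee_fin ler_norm.
rewrite lee_fin => r1; have r0 : (0 < r)%R by exact: lt_le_trans r1.
rewrite Lnorm_counting//.
apply: (@le_trans _ _ (((w k `^ r)%R)%:E `^ r^-1)).
  by rewrite poweR_EFin lee_fin -powRrM mulfV ?gt_eqF// powRr1.
apply: gt0_ler_poweR; rewrite ?invr_ge0 ?(ltW r0)//.
- by rewrite in_itv/= leey andbT lee_fin powR_ge0.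
- by rewrite in_itv/= leey andbT nneseries_ge0// => *; exact: poweR_ge0.
- apply: le_trans (nneseries_lim_ge k.+1 _); last by move=> *; exact: poweR_ge0.
  rewrite big_mkord big_ord_recr/= ger0_norm// leeDr//.
  by apply: sume_ge0 => *; rewrite lee_fin powR_ge0.
Qed.

(** The l^1 norm dominates all l^r norms: [w j ^ r <= w j * S ^ (r - 1)],
    where [S] is the sum. *)
Lemma Lnorm_counting_le w (K : nat) r : (forall j, 0 <= w j)%R ->
  (forall j, (K <= j)%N -> w j = 0%R) -> 1 <= r ->
  'N[counting]_r [(fun j => (w j)%:E)] <= (\sum_(j < K) w j)%R%:E.
Proof.
move=> w0 wK; set S := (\sum_(j < K) w j)%R.
have S0 : (0 <= S)%R by exact: sumr_ge0.
have wS j : (w j <= S)%R.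
  have [jK|/wK->//] := ltnP j K.
  by rewrite /S (bigD1 (Ordinal jK))//= lerDl sumr_ge0.
case: r => [r||] //; last first.
  move=> _; rewrite unlock; case: ifPn => _; last by rewrite lee_fin.
  by apply/ess_supP/nearW => j /=; rewrite lee_fin ger0_norm.
rewrite lee_fin => r1; have r0 : (0 < r)%R by exact: lt_le_trans r1.
rewrite Lnorm_counting//.
apply: (@le_trans _ _ (((S `^ r)%R)%:E `^ r^-1)); last first.
  by rewrite poweR_EFin lee_fin -powRrM mulfV ?gt_eqF// powRr1.
apply: gt0_ler_poweR; rewrite ?invr_ge0 ?(ltW r0)//.
- by rewrite in_itv/= leey andbT nneseries_ge0// => *; exact: poweR_ge0.
- by rewrite in_itv/= leey andbT lee_fin powR_ge0.
rewrite (nneseries_split 0 K)//; last by move=> *; exact: poweR_ge0.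
rewrite add0n eseries0 ?adde0; last first.
  by move=> j jK _; rewrite wK//= normr0 powR0// gt_eqF.
rewrite big_mkord.
under eq_bigr => j _ do rewrite /= ger0_norm//.
rewrite sumEFin lee_fin.
apply: (@le_trans _ _ (\sum_(j < K) w j * S `^ (r - 1))%R).
  apply: ler_sum => j _.
  rewrite -(mulr_powRB1 (w0 j) r0) ler_wpM2l//.
  by apply: ge0_ler_powR => //; rewrite ?nnegrE ?subr_ge0.
by rewrite -mulr_suml -/S mulr_powRB1.
Qed.

Lemma Lnorm_counting_level d (T : measurableType d) (w : nat -> T -> R) r (a : R) :
  (forall j x, 0 <= w j x)%R -> 1 <= r -> (forall j, measurable_fun setT (w j)) ->
  (0 <= a)%R ->
  measurable [set x | a%:E < `| 'N[counting]_r [(fun j => (w j x)%:E)] |].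
Proof.
move=> w0 r1 mw a0.
have -> : [set x | a%:E < `| 'N[counting]_r [(fun j => (w j x)%:E)] |] =
    [set x | a%:E < 'N[counting]_r [(fun j => (w j x)%:E)] ].
  by apply/seteqP; split => x /=; rewrite gee0_abs// Lnorm_ge0.
case: r r1 => [r||] // r1; last first.
  rewrite (_ : [set x | _] = \bigcup_j [set x | (a < w j x)%R]).
    apply: bigcupT_measurable => j.
    rewrite (_ : [set x | _] = w j @^-1` `]a, +oo[%classic).
      by rewrite -[X in measurable X]setTI; exact: mw.
    by apply/seteqP; split => x /=; rewrite in_itv/= andbT.
  apply/seteqP; split => x /= h; last first.
    by case: h => j _ /= h; apply: lt_le_trans (le_Lnorm_counting j (w0 ^~ x) r1); rewrite lte_fin.
  apply: contrapT => nh; move: h; apply/negP; rewrite -leNgt.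
  rewrite unlock; case: ifPn => _; last by rewrite lee_fin.
  apply/ess_supP/nearW => j /=; rewrite lee_fin ger0_norm// leNgt.
  by apply/negP => h; apply: nh; exists j.
have r0 : (0 < r)%R by move: r1; rewrite lee_fin; exact: lt_le_trans.
have mN : measurable_fun setT (fun x => 'N[counting]_r%:E [(fun j => (w j x)%:E)]).
  under eq_fun do rewrite Lnorm_counting//.
  apply: (@measurableT_comp _ _ _ _ _ _ (fun z : \bar R => z `^ r^-1)).
    exact: measurable_poweR.
  apply: ge0_emeasurable_sum => [j x _ _|j _]; first exact: poweR_ge0.
  apply: (@measurableT_comp _ _ _ _ _ _ (fun z : \bar R => z `^ r)).
    exact: measurable_poweR.
  by apply: measurableT_comp => //; exact/measurable_EFinP.
rewrite (_ : [set x | _] = (fun x => 'N[counting]_r%:E [(fun j => (w j x)%:E)]) @^-1` `]a%:E, +oo[%classic).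
  by rewrite -[X in measurable X]setTI; apply: mN => //; exact: emeasurable_itv.
by apply/seteqP; split => x /=; rewrite in_itv/= andbT.
Qed.

End sequence_norms.

(** * Lorentz norms *)

Section lorentz_norms.
Context {R : realType} {n : nat}.
Hypothesis hn : (0 < n)%N.
Local Notation Rn := 'rV[measurableTypeR R]_n.
Local Notation mu := (@lebesgue_rV R n).
Local Open Scope ereal_scope.

(** [lebesgue_rV_cube] with [lebesgue_rV] regarded as the measure that
    [lorentz_norm] takes. *)
Lemma lebesgue_cube_ereal (r : R) : (0 <= r)%R -> mu (cube r) = ((2 * r) ^+ n)%:E.
Proof. exact: lebesgue_rV_cube. Qed.

(** The set where [h] exceeds [a] lies in the cube on which [B |x|^(-n/p)]
    does. *)
Lemma lorentz_weak_le (p B : R) (h : Rn -> \bar R) : (1 < p)%R -> (0 < B)%R ->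
  (forall a : R, (0 <= a)%R -> measurable [set x : Rn | a%:E < `|h x|]) ->
  (forall x : 'rV[R]_n, (0 < `|x|)%R -> `|h x| <= (B * `|x| `^ (- (n%:R / p)))%R%:E) ->
  lorentz_norm mu p +oo h <= (2 `^ (n%:R / p) * B)%R%:E.
Proof.
move=> p1 B0 mh hB; have p0 : (0 < p)%R by exact: lt_trans p1.
have n0 : (0 < n%:R :> R)%R by rewrite ltr0n.
rewrite /lorentz_norm; apply: ge_ereal_sup => _ [a a0 <-].
move: a0; rewrite /= in_itv/= andbT => a0.
(* The radius at which [B |x|^(-n/p)] equals [a]. *)
pose rho : R := ((B / a) `^ (p / n%:R))%R.
have rho0 : (0 <= rho)%R by exact: powR_ge0.
have Ba0 : (0 < B / a)%R by rewrite divr_gt0.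
have sub : [set x : Rn | a%:E < `|h x|] `<=` cube rho.
  move=> x /= ax; rewrite /cube/=.
  have [x0|x0] := leP `|(x : 'rV[R]_n)|%R 0%R; first exact: le_trans x0 rho0.
  have := lt_le_trans ax (hB x x0); rewrite lte_fin powRN.
  rewrite ltr_pdivlMr ?powR_gt0// mulrC -ltr_pdivlMr// => h1.
  have e : ((n%:R / p) * (p / n%:R) = 1 :> R)%R by field; rewrite !gt_eqF.
  have -> : `|(x : 'rV[R]_n)|%R = ((`|(x : 'rV[R]_n)| `^ (n%:R / p)) `^ (p / n%:R))%R.
    by rewrite -powRrM e powRr1// ltW.
  apply: ge0_ler_powR; rewrite ?nnegrE ?powR_ge0 ?(ltW Ba0) ?(ltW h1)//.
  by rewrite divr_ge0// ltW.
have D : distribution_function mu h a <= ((2 * rho) ^+ n)%R%:E.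
  rewrite -lebesgue_cube_ereal//; apply: le_measure => //; rewrite inE.
    exact: mh (ltW a0).
  exact: measurable_cube.
apply: (@le_trans _ _ (a%:E * ((2 * rho) ^+ n)%R%:E `^ p^-1)).
  rewrite lee_pmul2l// ?lte_fin//; apply: gt0_ler_poweR => //.
  - by rewrite invr_ge0 ltW.
  - by rewrite in_itv/= leey andbT measure_ge0.
  - by rewrite in_itv/= leey andbT lee_fin exprn_ge0// mulr_ge0.
rewrite poweR_EFin -EFinM lee_fin le_eqVlt; apply/orP; left; apply/eqP.
rewrite exprMn powRM ?exprn_ge0// -!powR_mulrn// -!powRrM.
have -> : (p / n%:R * (n%:R / p) = 1 :> R)%R by field; rewrite !gt_eqF.
rewrite powRr1; last exact: ltW.
by field; rewrite gt_eqF.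
Qed.

Lemma distribution_function_le (h : Rn -> \bar R) (a b : R) :
  (forall a : R, (0 <= a)%R -> measurable [set x : Rn | a%:E < `|h x|]) ->
  (0 <= a)%R -> (a <= b)%R ->
  distribution_function mu h b <= distribution_function mu h a.
Proof.
move=> mh a0 ab; apply: le_measure; rewrite ?inE.
- by apply: mh; exact: le_trans ab.
- exact: mh.
- by move=> x /=; apply: le_lt_trans; rewrite lee_fin.
Qed.

(** On the i-th interval of levels the distribution function is at least [v
    i]; disjoint intervals contribute independently to the integral over the
    levels. *)
Lemma lorentz_p1_ge (p : R) (h : Rn -> \bar R) (N : nat) (lam v : nat -> R) :
  (1 < p)%R ->
  (forall a : R, (0 <= a)%R -> measurable [set x : Rn | a%:E < `|h x|]) ->
  (forall i, (i < N)%N -> 0 < lam i)%R -> (forall i, 0 <= v i)%R ->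
  (forall i, (i < N)%N -> exists E : set Rn, [/\ measurable E,
     forall x, E x -> (lam i)%:E <= `|h x| & (v i)%:E <= mu E]) ->
  trivIset [set i | (i < N)%N] (fun i => `](lam i / 2)%R, lam i[%classic : set R) ->
  (\sum_(i < N) (lam i / 2 * v i `^ p^-1))%R%:E <= lorentz_norm mu p 1 h.
Proof.
move=> p1 mh lam0 v0 hE tI; have p0 : (0 < p)%R by exact: lt_trans p1.
pose I i : set R := `](lam i / 2)%R, lam i[%classic.
pose D := distribution_function mu h.
pose f (a : R) : \bar R := (a%:E * D a `^ p^-1) `^ 1 * (a^-1)%:E.
have D0 a : 0 <= D a by exact: measure_ge0.
have fE a : (0 < a)%R -> f a = D a `^ p^-1.
  move=> a0; rewrite /f poweRe1; last by rewrite mule_ge0 ?poweR_ge0// lee_fin ltW.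
  rewrite muleAC -EFinM mulfV ?mul1e// gt_eqF//.
(* A monotone function is measurable: its upper level sets are intervals. *)
have mD : measurable_fun (`]0%R, +oo[%classic : set R) D.
  apply: (measurability _ (ErealGenOInfty.measurableE R)) => //= _ [_ [y ->] <-].
  apply: is_interval_measurable => s t [s0 sy] [t0 ty] u /andP[su ut].
  move: s0 sy t0 ty; rewrite /= !in_itv/= !andbT => s0 sy t0 ty.
  have u0 : (0 < u)%R by exact: lt_le_trans su.
  split => //=; rewrite ?in_itv/= ?andbT//.
  by apply: lt_le_trans ty _; exact: distribution_function_le mh (ltW u0) ut.
have mf : measurable_fun (`]0%R, +oo[%classic : set R) f.
  apply: (eq_measurable_fun (fun a => D a `^ p^-1)).
    by move=> a; rewrite inE/= in_itv/= andbT => a0; rewrite fE.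
  apply: (@measurableT_comp _ _ _ _ _ _ (fun z : \bar R => z `^ p^-1)) => //.
  exact: measurable_poweR.
have f0 a : `]0%R, +oo[%classic a -> 0 <= f a.
  by rewrite /= in_itv/= andbT => a0; rewrite fE// poweR_ge0.
have IS i : (i < N)%N -> I i `<=` `]0%R, +oo[%classic.
  move=> iN x; rewrite /I/= !in_itv/= andbT => /andP[h1 _].
  by apply: lt_trans h1; rewrite divr_gt0// lam0.
rewrite /lorentz_norm invr1 poweRe1; last first.
  rewrite mule_ge0//; first by rewrite lee_fin ltW.
  by apply: integral_ge0 => a a0; exact: f0.
apply: (@le_trans _ _ (\int[lebesgue_measure]_(a in `]0%R, +oo[) f a)); last first.
  rewrite -[leLHS]mul1e lee_wpmul2r// ?lee_fin ?(ltW p1)//.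
  by apply: integral_ge0 => a a0; exact: f0.
pose U := \big[setU/set0]_(i < N) I i.
have US : U `<=` `]0%R, +oo[%classic.
  by rewrite /U -bigcup_mkord => x [i /= iN]; exact: IS.
have mI i : measurable (I i : set (measurableTypeR R)) by exact: measurable_itv.
apply: (@le_trans _ _ (\int[lebesgue_measure]_(a in U) f a)); last first.
  apply: ge0_subset_integral => //.
  exact: bigsetU_measurable.
rewrite /U -(big_mkord xpredT I) ge0_integral_bigsetU//; first last.
- by rewrite big_mkord => x /US /f0.
- by rewrite big_mkord; apply: measurable_funS mf.
- move=> i j; rewrite /= !mem_index_iota /= => iN jN; exact: tI.
- exact: iota_uniq.
rewrite big_mkord -sumEFin; apply: lee_sum => i _.
have [E [mE Eh vE]] := hE i (ltn_ord i).
have li := lam0 i (ltn_ord i).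
apply: (@le_trans _ _ (\int[lebesgue_measure]_(a in I i) (cst ((v i) `^ p^-1)%R%:E a))).
  rewrite (_ : \int[_]_(a in _) _ =
      ((v i) `^ p^-1)%R%:E * lebesgue_measure (I i)); last exact: integral_cst.
  rewrite /I lebesgue_measure_itv/= lte_fin.
  rewrite ltr_pdivrMr// ltr_pMr// ltr1n -EFinB -EFinM lee_fin mulrC.
  by rewrite le_eqVlt; apply/orP; left; apply/eqP; congr (_ * _)%R; field.
apply: ge0_le_integral => //.
- by move=> x _; rewrite lee_fin powR_ge0.
- by apply: measurable_funS mf => //; exact: IS.
move=> a Ia; have := IS i (ltn_ord i) a Ia; rewrite /= in_itv/= andbT => a0.
rewrite fE// -poweR_EFin; apply: gt0_ler_poweR.
- by rewrite invr_ge0 ltW.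
- by rewrite in_itv/= leey andbT lee_fin.
- by rewrite in_itv/= leey andbT.
apply: (le_trans vE); apply: le_measure; rewrite ?inE//.
  exact: mh (ltW a0).
move=> x /Eh hx /=; apply: lt_le_trans hx; rewrite lte_fin.
by move: Ia; rewrite /I/= in_itv/= => /andP[].
Qed.

Lemma annulus_measure (r : R) : (0 < r)%R ->
  (r ^+ n)%R%:E <= mu (cube r `\` cube (r / 2) : set Rn).
Proof.
move=> r0; have r20 : (0 <= r / 2)%R by rewrite divr_ge0// ltW.
have h1 : mu (cube r) < +oo by rewrite lebesgue_cube_ereal ?ltry// ltW.
have -> : mu (cube r `\` cube (r / 2) : set Rn) =
    mu (cube r) - mu (cube r `&` cube (r / 2)).
  by apply: measureD => //; exact: measurable_cube.
have -> : cube r `&` cube (r / 2) = cube (r / 2) :> set Rn.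
  apply/seteqP; split => [x []//|x h]; split => //.
  by apply: le_trans h _; rewrite ler_pdivrMr// ler_peMr// ?(ltW r0)// ler1n.
rewrite !lebesgue_cube_ereal ?(ltW r0)// -EFinB lee_fin.
have -> : (2 * (r / 2) = r)%R by field.
(* [(2 ^ n - 1) r ^ n] is at least [r ^ n]. *)
have h2 : (2 <= 2 ^+ n :> R)%R.
  by rewrite -{1}(expr1 2%R) ler_weXn2l// ler1n.
have rn : (0 <= r ^+ n)%R by rewrite exprn_ge0// ltW.
have h3 : (2 * r ^+ n <= 2 ^+ n * r ^+ n)%R by rewrite ler_wpM2r.
rewrite exprMn; lra.
Qed.

End lorentz_norms.

Lemma lorentz_weak_ge0 d (T : measurableType d) (R : realType)
    (mu : {measure set T -> \bar R}) (p : R) (f : T -> \bar R) :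
  (0 <= lorentz_norm mu p +oo f)%E.
Proof.
apply: (@le_trans _ _ (1%:E * distribution_function mu f 1 `^ p^-1)%E).
  by rewrite mule_ge0// ?lee_fin// poweR_ge0.
by apply: ereal_sup_ubound; exists 1 => //=; rewrite in_itv/= ltr01.
Qed.

(** * Geometric sums *)

Section geometric_sums.
Context {R : realType}.

(** Each term is dominated by an increment of the bounded function
    [z / (1 + z)] along the geometric sequence. *)
Lemma geometric_min_sum (b : R) (z : nat -> R) N : 1 < b -> (forall i, 0 < z i) ->
  (forall i, z i.+1 = b * z i) ->
  \sum_(i < N) Num.min (z i) (z i)^-1 <= 2 * (1 + b) / (b - 1).
Proof.
move=> b1 z0 zS; pose g i := z i / (1 + z i).
have b0 : 0 < b by exact: lt_trans b1.
have bm : 0 < b - 1 by rewrite subr_gt0.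
have z1 i : 0 < 1 + z i by rewrite addr_gt0.
have step i : Num.min (z i) (z i)^-1 <= 2 * (1 + b) / (b - 1) * (g i.+1 - g i).
  have zi := z0 i.
  have bz : 0 < 1 + b * z i by rewrite addr_gt0// mulr_gt0.
  have -> : g i.+1 - g i = (b - 1) * z i / ((1 + b * z i) * (1 + z i)).
    by rewrite /g zS; field; rewrite !gt_eqF.
  have -> : 2 * (1 + b) / (b - 1) * ((b - 1) * z i / ((1 + b * z i) * (1 + z i))) =
      2 * (1 + b) * z i / ((1 + b * z i) * (1 + z i)).
    by field; rewrite !gt_eqF.
  rewrite ler_pdivlMr ?mulr_gt0//.
  have [zl|zl] := leP (z i) 1.
    apply: (@le_trans _ _ (z i * ((1 + b * z i) * (1 + z i)))).
      by rewrite ler_wpM2r ?mulr_ge0 ?(ltW bz) ?(ltW (z1 i))// ge_min lexx.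
    rewrite [leRHS]mulrC ler_wpM2l ?(ltW zi)// [leRHS]mulrC.
    apply: ler_pM; rewrite ?(ltW bz) ?(ltW (z1 i))//; last lra.
    by rewrite lerD2l ler_piMr// ltW.
  apply: (@le_trans _ _ ((z i)^-1 * ((1 + b * z i) * (1 + z i)))).
    by rewrite ler_wpM2r ?mulr_ge0 ?(ltW bz) ?(ltW (z1 i))// ge_min lexx orbT.
  rewrite ler_pdivrMl//.
  have -> : z i * (2 * (1 + b) * z i) = ((1 + b) * z i) * (2 * z i) by ring.
  by apply: ler_pM; rewrite ?(ltW bz) ?(ltW (z1 i))//; [rewrite mulrDl mul1r lerD2r ltW|lra].
apply: (le_trans (ler_sum _ (fun (i : 'I_N) _ => step i))).
rewrite -mulr_sumr ler_piMr//.
  by apply: divr_ge0; rewrite ?(ltW bm)// mulr_ge0// addr_ge0// ltW.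
rewrite -(big_mkord xpredT (fun i => g i.+1 - g i)) telescope_sumr//.
apply: (@le_trans _ _ (g N)); first by rewrite lerBlDr lerDl divr_ge0 ?(ltW (z0 _)) ?(ltW (z1 _)).
by rewrite /g ler_pdivrMr// mul1r lerDr.
Qed.

Lemma geometric_min_sum_inv (b : R) (z : nat -> R) N : 1 < b -> (forall i, 0 < z i) ->
  (forall i, z i = b * z i.+1) ->
  \sum_(i < N) Num.min (z i) (z i)^-1 <= 2 * (1 + b) / (b - 1).
Proof.
move=> b1 z0 zS; have b0 : 0 < b by exact: lt_trans b1.
apply: le_trans (@geometric_min_sum b (fun i => (z i)^-1) N b1 _ _).
- by apply: ler_sum => i _; rewrite invrK minC.
- by move=> i; rewrite invr_gt0.
- by move=> i; rewrite (zS i) invfM mulrA mulfV ?mul1r// gt_eqF.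
Qed.

(** Growth of order [q] at 0 and decay of order at least 1 at infinity,
    expressed by one power [z] of [y] so that [geometric_min_sum] applies. *)
Lemma powR_decay_le (n : nat) (q y : R) : 0 < q -> q < n%:R -> 0 < y ->
  y `^ q * (1 + y) ^- n.+1 <= Num.min (y `^ Num.min q 1) (y `^ Num.min q 1)^-1.
Proof.
move=> q0 qn y0; set z := y `^ Num.min q 1; have q1 : 0 < Num.min q 1 by rewrite lt_min q0 ltr01.
have d1 : (1 + y) ^- n.+1 <= 1.
  by rewrite invf_le1 ?exprn_gt0 ?addr_gt0// exprn_ege1// lerDl ltW.
have z0 : 0 < z by rewrite powR_gt0.
have d0 : 0 <= (1 + y) ^- n.+1 by rewrite invr_ge0 exprn_ge0// addr_ge0// ltW.
have [y1|y1] := leP y 1.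
  have h : y `^ q * (1 + y) ^- n.+1 <= z.
    apply: (@le_trans _ _ (y `^ q)); first by rewrite ler_piMr// powR_ge0.
    by apply: ger_powR; rewrite ?y0// ge_min lexx.
  have z1 : z <= 1 by rewrite -(powRr0 y) ger_powR ?y0// ltW.
  by rewrite le_min h (le_trans h)// (le_trans z1)// invf_ge1.
have y1' := ltW y1.
have h : y `^ q * (1 + y) ^- n.+1 <= z^-1.
  apply: (@le_trans _ _ (y^-1)).
    rewrite ler_pdivrMr ?exprn_gt0 ?addr_gt0// ler_pdivlMl// exprS.
    apply: ler_pM; rewrite ?powR_ge0 ?(ltW y0)//; first by rewrite lerDr.
    apply: (@le_trans _ _ (y `^ n%:R)); first by rewrite ler_powR// ltW.
    by rewrite powR_mulrn ?(ltW y0)// lerXn2r ?nnegrE ?addr_ge0 ?(ltW y0)// lerDr.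
  rewrite lef_pV2 ?posrE//.
  by rewrite -[leRHS]powRr1 ?(ltW y0)// ler_powR// ge_min lexx orbT.
have z1 : 1 <= z by rewrite -(powRr0 y) ler_powR// ltW.
by rewrite le_min h andbT (le_trans h)// (le_trans _ z1)// invf_le1.
Qed.

Lemma geometric_tail_sum (L i : nat) : (0 < L)%N ->
  \sum_(j < i) ((2 : R) ^+ (L * (i - j)))^-1 <= 2 / 2 ^+ L.
Proof.
move=> L0; have L1 : 2 <= (2 : R) ^+ L.
  by rewrite -{1}(expr1 2) ler_weXn2l// ler1n.
have Lp : 0 < (2 : R) ^+ L by rewrite exprn_gt0.
suff h : \sum_(j < i) ((2 : R) ^+ (L * (i - j)))^-1 <= 2 / 2 ^+ L - 2 / 2 ^+ L * (2 ^+ (L * i))^-1.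
  by apply: le_trans h _; rewrite lerBlDr lerDl mulr_ge0 ?invr_ge0 ?divr_ge0 ?exprn_ge0.
elim: i => [|i IH]; first by rewrite big_ord0 muln0 expr0 invr1 mulr1 subrr.
rewrite big_ord_recl /= subn0.
under eq_bigr => j _ do rewrite /bump/= add1n subSS.
have e : (2 : R) ^+ (L * i.+1) = 2 ^+ L * 2 ^+ (L * i) by rewrite mulnS exprD.
rewrite e; set P := (2 : R) ^+ (L * i) in IH *; set Q := (2 : R) ^+ L in L1 Lp IH *.
have P0 : 0 < P by rewrite exprn_gt0.
apply: le_trans (lerD (lexx _) IH) _.
rewrite invfM; set q := Q^-1; set u := P^-1.
have q2 : q <= 1 / 2 by rewrite ler_pdivlMr// mulrC ler_pdivrMr// mul1r.
have : 0 <= q * u * (1 - 2 * q).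
  by rewrite mulr_ge0 ?mulr_ge0 ?invr_ge0 ?(ltW P0) ?(ltW Lp)//; lra.
nra.
Qed.

End geometric_sums.

(** * Lacunary superpositions *)

Section lacunary_sums.
Context {R : realType} {n : nat} (psi : nat -> 'rV[R]_n -> R[i]).
Hypothesis hpsi : littlewood_paley psi.
Hypothesis hn : (0 < n)%N.
Local Notation Rn := 'rV[measurableTypeR R]_n.
Local Notation mu := (@lebesgue_rV R n).

Lemma niceD (m1 m2 : 'rV[R]_n -> R[i]) : nice m1 -> nice m2 ->
  nice (fun xi => m1 xi + m2 xi).
Proof.
move=> h1 h2; have i1 := nice_cintegrable h1; have i2 := nice_cintegrable h2.
case: h1 h2 => -[c1 d1] [M1 b1] [B1 s1] u1 [[c2 d2] [M2 b2] [B2 s2] u2]; split.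
- split => x.
    have -> : (fun x => complex.Re (m1 x + m2 x)) =
      (fun x => complex.Re (m1 x) + complex.Re (m2 x)) by apply/funext => y; rewrite cReD.
    have h1 : complex.Re (m1 y) @[y --> x] --> complex.Re (m1 x) := c1 x.
    have h2 : complex.Re (m2 y) @[y --> x] --> complex.Re (m2 x) := c2 x.
    exact: (cvgD h1 h2).
  have -> : (fun x => complex.Im (m1 x + m2 x)) =
    (fun x => complex.Im (m1 x) + complex.Im (m2 x)) by apply/funext => y; rewrite cImD.
  have h1 : complex.Im (m1 y) @[y --> x] --> complex.Im (m1 x) := d1 x.
  have h2 : complex.Im (m2 y) @[y --> x] --> complex.Im (m2 x) := d2 x.
  exact: (cvgD h1 h2).
- exists (M1 + M2) => xi; apply: le_trans (normc_triangle _ _) _; exact: lerD.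
- exists (Num.max B1 B2) => xi; rewrite gt_max => /andP[h1 h2].
  by rewrite s1// s2// addr0.
- have -> : inv_fourier (fun xi => m1 xi + m2 xi) = (fun x => inv_fourier m1 x + inv_fourier m2 x).
    apply/funext => x; rewrite /inv_fourier -cintegralD.
    + by apply: eq_cintegral => xi; rewrite mulrDl.
    + exact: cintegrable_inv_fourier.
    + exact: cintegrable_inv_fourier.
  exact: cintegrableD.
Qed.

Lemma niceZ (c : R) (m : 'rV[R]_n -> R[i]) : nice m -> nice (fun xi => c%:C * m xi).
Proof.
move=> h1; have i1 := nice_cintegrable h1.
case: h1 => -[c1 d1] [M1 b1] [B1 s1] u1; split.
- split => x.
    have -> : (fun x => complex.Re (c%:C * m x)) =
      (fun x => c * complex.Re (m x)) by apply/funext => y; rewrite cReM /= mul0r subr0.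
    have h1 : complex.Re (m y) @[y --> x] --> complex.Re (m x) := c1 x.
    exact: (cvgM (cvg_cst _) h1).
  have -> : (fun x => complex.Im (c%:C * m x)) =
    (fun x => c * complex.Im (m x)) by apply/funext => y; rewrite cImM /= mul0r addr0.
  have h1 : complex.Im (m y) @[y --> x] --> complex.Im (m x) := d1 x.
  exact: (cvgM (cvg_cst _) h1).
- exists (`|c| * M1) => xi; rewrite normcM normc_real ler_wpM2l//.
- by exists B1 => xi /s1 ->; rewrite mulr0.
- have -> : inv_fourier (fun xi => c%:C * m xi) = (fun x => c%:C * inv_fourier m x).
    apply/funext => x; rewrite /inv_fourier -cintegralZ.
    + by apply: eq_cintegral => xi; rewrite mulrA.
    + exact: cintegrable_inv_fourier.
  exact: cintegrableZ.
Qed.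

Lemma nice0 : nice (fun _ : 'rV[R]_n => 0 : R[i]).
Proof.
have := niceZ 0 (nice_chi hpsi hn).
by under eq_fun do rewrite mul0r.
Qed.

Lemma nice_sum N (F : nat -> 'rV[R]_n -> R[i]) : (forall i, nice (F i)) ->
  nice (fun xi => \sum_(i < N) F i xi).
Proof.
move=> h; elim: N => [|N IH].
  by under eq_fun do rewrite big_ord0; exact: nice0.
by under eq_fun do rewrite big_ord_recr/=; exact: niceD.
Qed.

Lemma measurable_block m k : nice m ->
  measurable_fun setT (fun x : Rn => normc (function_of (lp_block psi k (distr_of m)) x)).
Proof.
move=> nm; have im := nice_cintegrable nm; have [cm [Mm mM] [B mB] iu] := nm.
rewrite function_of_block//; apply: (@cmeasurable_normc _ Rn).
apply: cmeasurableM; first exact: cmeasurable_cst.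
apply: ccontinuous_measurable.
apply: (ccontinuous_inv_fourier (B := B)); first exact: cintegrable_psiM.
by move=> xi /mB ->; rewrite mulr0.
Qed.

(** The Fourier transform of a superposition of [N] dilates of the profile,
    the i-th one of amplitude [c i] and frequency [t i]: hence the factor [t i
    ^- n]. *)
Definition lacunary (c t : nat -> R) N (xi : 'rV[R]_n) : R[i] :=
  \sum_(i < N) (c i / t i ^+ n)%:C * chi_at psi hn (t i) xi.

Lemma nice_lacunary c t N : (forall i, 0 < t i) -> nice (lacunary c t N).
Proof.
move=> t0; apply: (@nice_sum N (fun i xi => (c i / t i ^+ n)%:C * chi_at psi hn (t i) xi)).
by move=> i; apply: niceZ; exact: nice_chi_at.
Qed.

Lemma block_lacunary c t N k x : (forall i, 0 < t i) ->
  function_of (lp_block psi k (distr_of (lacunary c t N))) x =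
  inv_const psi * \sum_(i < N) (c i / t i ^+ n)%:C * lp_kernel psi hn k (t i) x.
Proof.
move=> t0; rewrite function_of_block//; last exact: nice_lacunary.
congr (_ * _).
have ic i : cintegrable (fun xi => psi k xi * chi_at psi hn (t i) xi).
  by apply: cintegrable_psiM => //; exact: cintegrable_chi_at.
transitivity (cintegral (fun xi => \sum_(i < N) (c i / t i ^+ n)%:C *
    (psi k xi * chi_at psi hn (t i) xi * cexpi (2 * pi * dotrV x xi)))).
  apply: eq_cintegral => xi; rewrite /lacunary !mulr_sumr mulr_suml.
  by apply: eq_bigr => i _; ring.
rewrite (@cintegral_sum _ _ _ _ (fun i : 'I_N => _)); last first.
  by move=> i; apply: cintegrableZ; exact: cintegrable_inv_fourier.
by apply: eq_bigr => i _; rewrite cintegralZ//; exact: cintegrable_inv_fourier.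
Qed.

End lacunary_sums.

(** * Ascending and descending scales *)

Section dyadic_scales.
Context {R : realType}.

Definition scale (up : bool) (J : nat) : R := if up then 2 ^+ J else (2 ^+ J)^-1.

Lemma scale_gt0 up J : 0 < scale up J.
Proof. by rewrite /scale; case: up; rewrite ?invr_gt0 exprn_gt0. Qed.

Lemma powR2X (J : nat) (s : R) : 2 `^ (J%:R * s) = (2 ^+ J) `^ s :> R.
Proof. by rewrite powRrM powR_mulrn. Qed.

Lemma pow2_window_le (J k : nat) (s : R) : (J <= k <= J + 4)%N ->
  2 `^ (k%:R * s) <= (2 ^+ J) `^ s * 2 `^ (4 * `|s|).
Proof.
move=> /andP[h1 h2]; rewrite -powR2X -powRD ?pnatr_eq0 ?implybT//.
apply: ler_powR; first by rewrite ler1n.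
have -> : k%:R = J%:R + (k - J)%:R :> R by rewrite -natrD subnKC.
rewrite mulrDl lerD2l; have d4 : (k - J)%:R <= 4 :> R.
  by rewrite (ler_nat R _ 4); lia.
by apply: le_trans (ler_norm _) _; rewrite normrM ger0_norm// ler_wpM2r.
Qed.

Lemma pow2_window_ge (J k : nat) (s : R) : (J <= k <= J + 4)%N ->
  (2 ^+ J) `^ s <= 2 `^ (k%:R * s) * 2 `^ (4 * `|s|).
Proof.
move=> /andP[h1 h2]; rewrite -powR2X -powRD ?pnatr_eq0 ?implybT//.
apply: ler_powR; first by rewrite ler1n.
have -> : k%:R = J%:R + (k - J)%:R :> R by rewrite -natrD subnKC.
rewrite mulrDl -addrA lerDl; have d4 : (k - J)%:R <= 4 :> R.
  by rewrite (ler_nat R _ 4); lia.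
have : `|(k - J)%:R * s| <= 4 * `|s| by rewrite normrM ger0_norm// ler_wpM2r.
by rewrite ler_norml => /andP[h _]; lra.
Qed.

Lemma sum_pred1_le K (j : nat) (B : R) : 0 <= B ->
  \sum_(k < K) (if k == j :> nat then B else 0) <= B.
Proof.
move=> B0; elim: K => [|K IH]; first by rewrite big_ord0.
rewrite big_ord_recr/=; case: eqVneq => [e|_]; last by rewrite addr0.
by rewrite big1 ?add0r// => k _; rewrite -e ltn_eqF// ltn_ord.
Qed.

(** The i-th term of a geometric sequence of ratio [2 ^+ L] or [2 ^- L]; the
    offset [a] moves the whole sequence to infinity or to 0. *)
Definition freq (up : bool) (L a i : nat) : R := scale up (L * (a + i.+1)).

Lemma freq_gt0 up L a i : 0 < freq up L a i.
Proof. exact: scale_gt0. Qed.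

Lemma freq_ratio up L a i : freq up L a i.+1 =
  if up then 2 ^+ L * freq up L a i else (2 ^+ L)^-1 * freq up L a i.
Proof.
rewrite /freq /scale addnS mulnS.
by case: up; rewrite exprD// invfM.
Qed.

Lemma freq_shift (up : bool) L a i j : (i <= j)%N ->
  if up then freq up L a j = 2 ^+ (L * (j - i)) * freq up L a i :> R
  else freq up L a i = 2 ^+ (L * (j - i)) * freq up L a j :> R.
Proof.
move=> ij; have e : (L * (a + j.+1) = L * (j - i) + L * (a + i.+1))%N.
  by rewrite -mulnDr; congr (_ * _)%N; lia.
case: up; rewrite /freq /scale e exprD// invfM mulrA mulfV ?mul1r//.
Qed.

Lemma freq_powR_double (up : bool) L a i j (q : R) : (i < j)%N -> 0 < q -> 1 <= L%:R * q ->
  if up then 2 * freq up L a i `^ q <= freq up L a j `^ q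
  else 2 * freq up L a j `^ q <= freq up L a i `^ q.
Proof.
move=> ij q0 Lq.
have h2 : 2 <= (2 ^+ (L * (j - i)) : R) `^ q.
  apply: (@le_trans _ _ ((2 ^+ L : R) `^ q)); last first.
    apply: ge0_ler_powR; rewrite ?nnegrE ?exprn_ge0 ?(ltW q0)//.
    by rewrite ler_weXn2l ?ler1n// leq_pmulr// subn_gt0.
  by rewrite -powR2X -[leLHS]powRr1 ?ler0n// ler_powR ?ler1n.
have t0 k : 0 <= freq up L a k :> R by exact: ltW (freq_gt0 _ _ _ _).
have := freq_shift up L a (ltnW ij); case: up t0 => t0 ->.
  by rewrite powRM ?exprn_ge0// ler_wpM2r ?powR_ge0.
by rewrite powRM ?exprn_ge0// ler_wpM2r ?powR_ge0.
Qed.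

(** Passes from the sum of the three blocks of a window to a single block. *)
Lemma third_le_some (b u v w : R) : 3 * b <= u + v + w ->
  [\/ b <= u, b <= v | b <= w].
Proof.
move=> h; have [hu|hu] := leP b u; first by constructor 1.
have [hv|hv] := leP b v; first by constructor 2.
by constructor 3; lra.
Qed.

Lemma le_pow2_of_bound (x : R) (L : nat) : (Num.bound x <= L)%N -> 0 <= x -> x <= 2 ^+ L.
Proof.
move=> h x0; apply: ltW; apply: lt_le_trans (archi_boundP x0) _.
by rewrite -natrX ler_nat (leq_trans h)// ltnW// ltn_expl.
Qed.

End dyadic_scales.

(** * Weighted sums of block kernels *)

Section weighted_kernels.
Context {R : realType} {n : nat} (psi : nat -> 'rV[R]_n -> R[i]).
Hypothesis hpsi : littlewood_paley psi.
Hypothesis hn : (0 < n)%N.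

Lemma lp_kernel_vanish up J k x : (4 <= J)%N -> (J + 5 <= k)%N ->
  lp_kernel psi hn k (scale up J) x = 0.
Proof.
case: up => J4 Jk; rewrite /scale.
  by rewrite lp_kernel_window//; apply/negP => /andP[_]; lia.
by rewrite lp_kernel_low// gtn_eqF//; lia.
Qed.

(** The power of the frequency as which [2 ^ (k s)] acts on the blocks of a
    dilate: at low frequencies only the block [k = 0] is present. *)
Definition weight (up : bool) (s : R) : R := if up then s else 0.

(** At ascending scales three values of [k] contribute, with [2 ^ k]
    comparable to the frequency; at descending ones only [k = 0] does. *)
Lemma lp_kernel_weighted_sum up s : exists2 C : R, 0 < C & forall J K x, (4 <= J)%N ->
  \sum_(k < K) 2 `^ (k%:R * s) * normc (lp_kernel psi hn k (scale up J) x) <=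
  C * scale up J `^ weight up s * scale up J ^+ n * decay (scale up J *: x).
Proof.
case: up; rewrite /weight /scale.
  have [C C0 hC] := lp_kernel_decay hpsi hn.
  have p4 : 0 < 2 `^ (4 * `|s|) :> R by rewrite powR_gt0.
  exists (3 * (2 `^ (4 * `|s|) * C)); first by rewrite !mulr_gt0.
  move=> J K x J4; set d := decay _; set T := (2 ^+ J) `^ s.
  pose B := 2 `^ (4 * `|s|) * C * T * (2 ^+ J) ^+ n * d.
  have B0 : 0 <= B by rewrite /B !mulr_ge0 ?powR_ge0 ?exprn_ge0 ?(ltW C0) ?(ltW (decay_gt0 _)).
  have -> : 3 * (2 `^ (4 * `|s|) * C) * T * (2 ^+ J) ^+ n * d = B + B + B by rewrite /B; ring.
  pose ind j (k : nat) := if k == j then B else 0.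
  apply: (@le_trans _ _ (\sum_(k < K) (ind J.+2 k + ind J.+3 k + ind J.+4 k))).
    apply: ler_sum => k _; have [h|h] := boolP (J.+2 <= k <= J.+4)%N; last first.
      rewrite lp_kernel_window// normc0 mulr0 /ind.
      by rewrite !addr_ge0//; case: ifP.
    apply: (@le_trans _ _ B).
      rewrite /B; have -> : 2 `^ (4 * `|s|) * C * T * (2 ^+ J) ^+ n * d =
        (T * 2 `^ (4 * `|s|)) * (C * (2 ^+ J) ^+ n * d) by ring.
      apply: ler_pM; rewrite ?powR_ge0 ?normc_ge0//.
      by apply: pow2_window_le; lia.
    have i0 j (l : nat) : 0 <= ind j l by rewrite /ind; case: ifP.
    have : (k == J.+2 :> nat) || (k == J.+3 :> nat) || (k == J.+4 :> nat) by lia.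
    have := i0 J.+2 k; have := i0 J.+3 k; have := i0 J.+4 k; rewrite /ind.
    by move=> h2 h3 h4 /orP[/orP[]|] e; rewrite e in h2 h3 h4 *; lra.
  rewrite !big_split/=; apply: lerD; first apply: lerD; exact: sum_pred1_le.
have [C C0 hC] := profile_decay hpsi hn.
exists C => // J K x J4; set t := (2 ^+ J)^-1.
have t0 : 0 < t by rewrite invr_gt0 exprn_gt0.
rewrite powRr0 mulr1.
apply: le_trans (sum_pred1_le K 0%N (B := C * t ^+ n * decay (t *: x)) _); last first.
  by rewrite !mulr_ge0 ?exprn_ge0 ?(ltW C0) ?(ltW t0) ?(ltW (decay_gt0 _)).
apply: ler_sum => k _; rewrite lp_kernel_low//; case: eqVneq => [->|_]; last first.
  by rewrite normc0 mulr0.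
rewrite mul0r powRr0 mul1r normcM normc_real ger0_norm ?exprn_ge0 ?(ltW t0)//.
by rewrite -/t [leRHS]mulrAC [leRHS]mulrC ler_wpM2l ?exprn_ge0 ?(ltW t0).
Qed.

End weighted_kernels.

(** * Weak norms of lacunary superpositions *)

Section upper_bound.
Context {R : realType} {n : nat} (psi : nat -> 'rV[R]_n -> R[i]).
Hypothesis hpsi : littlewood_paley psi.
Hypothesis hn : (0 < n)%N.
Local Notation Rn := 'rV[measurableTypeR R]_n.
Local Notation mu := (@lebesgue_rV R n).

Definition lacunary_power (up : bool) (L a : nat) (beta : R) N : 'rV[R]_n -> R[i] :=
  lacunary psi hn (fun i => freq up L a i `^ beta) (freq up L a) N.

Lemma nice_lacunary_power up L a beta N : nice (lacunary_power up L a beta N).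
Proof. by apply: nice_lacunary => // i; exact: freq_gt0. Qed.

Lemma block_lacunary_power up L a beta N k x :
  function_of (lp_block psi k (distr_of (lacunary_power up L a beta N))) x =
  inv_const psi * \sum_(i < N) (freq up L a i `^ beta / freq up L a i ^+ n)%:C *
    lp_kernel psi hn k (freq up L a i) x.
Proof. by apply: block_lacunary => // i; exact: freq_gt0. Qed.

(** The bound is uniform in the length and in the offset of the sequence: this
    is why the weak norm does not grow with the number of terms. *)
Lemma freq_decay_sum up L q : (0 < L)%N -> 0 < q -> q < n%:R ->
  exists2 C : R, 0 < C & forall a N y, 0 < y ->
  \sum_(i < N) (freq up L a i * y) `^ q * (1 + freq up L a i * y) ^- n.+1 <= C.
Proof.
move=> L0 q0 qn; pose m := Num.min q 1.
have m0 : 0 < m by rewrite /m lt_min q0 ltr01.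
have b1 : 1 < (2 ^+ L) `^ m :> R.
  have L1 : 1 < 2 ^+ L :> R by rewrite exprn_egt1 ?ltr1n// -lt0n.
  have e1 : 1 = 1 `^ m :> R by rewrite powR1.
  by rewrite [ltLHS]e1 gt0_ltr_powR// nnegrE ?exprn_ge0.
pose b := (2 ^+ L : R) `^ m.
exists (2 * (1 + b) / (b - 1)).
  by rewrite divr_gt0 ?subr_gt0// mulr_gt0// addr_gt0// (lt_trans _ b1).
move=> a N y y0; pose z i := (freq up L a i * y) `^ m.
have fy i : 0 < freq up L a i * y by rewrite mulr_gt0// freq_gt0.
have z0 i : 0 < z i by rewrite powR_gt0.
apply: (@le_trans _ _ (\sum_(i < N) Num.min (z i) (z i)^-1)).
  by apply: ler_sum => i _; exact: powR_decay_le.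
case: up @z fy z0 => z fy z0.
  apply: geometric_min_sum => // i.
  by rewrite /z freq_ratio -mulrA powRM ?exprn_ge0// ltW.
apply: geometric_min_sum_inv => // i.
rewrite /z freq_ratio -mulrA /b -powRM ?exprn_ge0// ?mulr_ge0 ?invr_ge0 ?exprn_ge0 ?(ltW (fy _)) ?(ltW y0)//.
by rewrite mulrA mulfV ?mul1r// gt_eqF// exprn_gt0.
Qed.

Let weighted_block s m (k : nat) (x : Rn) : R :=
  2 `^ (k%:R * s) * normc (function_of (lp_block psi k (distr_of m)) x).

Definition sequence_norm s r f (x : Rn) : \bar R :=
  'N[counting]_r [(fun j : nat =>
    (2 `^ (j%:R * s) * normc (function_of (lp_block psi j f) x))%:E)].

Lemma measurable_TLL_level s m r (a : R) : nice m -> (1 <= r)%E -> 0 <= a ->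
  measurable [set x : Rn | (a%:E < `| sequence_norm s r (distr_of m) x |)%E].
Proof.
move=> nm r1 a0; apply: (Lnorm_counting_level (w := weighted_block s m)) => //.
- by move=> j x; rewrite mulr_ge0 ?powR_ge0 ?normc_ge0.
- by move=> j; apply: measurable_funM => //; exact: measurable_block.
Qed.

(** Up to a constant, the l^1 norm of the weighted blocks at [x] is at most a
    sum over [i] of [t_i ^ (beta + weight) * (1 + t_i |x|) ^- n.+1].
    Extracting [|x| ^ (- n/p)] leaves powers bounded by [B] times terms summed
    by [freq_decay_sum]. *)
Lemma TLL_norm_lacunary_le up L s r p beta : (4 <= L)%N -> 1 < p -> (1 <= r)%E ->
  exists2 C : R, 0 < C & forall a N B, 0 < B ->
  (forall i, (i < N)%N -> freq up L a i `^ (beta + weight up s - n%:R / p) <= B) ->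
  (TLL_norm psi s r p +oo (distr_of (lacunary_power up L a beta N)) <= (C * B)%:E)%E.
Proof.
move=> L4 p1 r1; have p0 : 0 < p by exact: lt_trans p1.
have n0 : 0 < n%:R :> R by rewrite ltr0n.
have q0 : 0 < n%:R / p by rewrite divr_gt0.
have qn : n%:R / p < n%:R by rewrite ltr_pdivrMr// ltr_pMr.
have [C1 C10 hC1] := lp_kernel_weighted_sum hpsi hn up s.
have [C2 C20 hC2] := @freq_decay_sum up L _ (leq_trans (isT : 0 < 4)%N L4) q0 qn.
have k0 : 0 < normc (inv_const psi).
  by rewrite lt_neqAle normc_ge0 andbT eq_sym; apply/eqP => /eq0_normc/eqP; apply/negP/inv_const_neq0.
exists (2 `^ (n%:R / p) * (normc (inv_const psi) * C1 * C2)).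
  by rewrite !mulr_gt0 ?powR_gt0.
move=> a N B B0 hB; set m := lacunary_power _ _ _ _ _.
have nm : nice m by exact: nice_lacunary_power.
rewrite -mulrA; apply: lorentz_weak_le => //.
- by rewrite !mulr_gt0.
- by move=> b b0; exact: measurable_TLL_level.
move=> x x0; rewrite gee0_abs ?Lnorm_ge0//.
(* No block beyond this one meets any of the [N] dilates. *)
pose K := (L * (a + N) + 5)%N.
have JK (i : 'I_N) : (4 <= L * (a + i.+1))%N && (L * (a + i.+1) + 5 <= K)%N.
  apply/andP; split.
    by apply: (leq_trans L4); rewrite leq_pmulr// addnS.
  by rewrite /K leq_add2r leq_mul2l leq_add2l ltn_ord orbT.
apply: le_trans (@Lnorm_counting_le _ (fun k => weighted_block s m k x) K r _ _ r1) _.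
- by move=> j; rewrite mulr_ge0 ?powR_ge0 ?normc_ge0.
- move=> j Kj; rewrite /weighted_block block_lacunary_power big1 ?mulr0 ?normc0 ?mulr0// => i _.
  rewrite /freq lp_kernel_vanish ?mulr0//; have /andP[h1 h2] := JK i => //.
  exact: leq_trans Kj.
rewrite lee_fin.
pose F i k := freq up L a i `^ beta / freq up L a i ^+ n *
  (2 `^ (k%:R * s) * normc (lp_kernel psi hn k (freq up L a i) x)).
apply: (@le_trans _ _ (\sum_(k < K) normc (inv_const psi) * \sum_(i < N) F i k)).
  apply: ler_sum => k _; rewrite /weighted_block block_lacunary_power normcM mulrCA.
  rewrite ler_wpM2l ?normc_ge0//.
  apply: le_trans (ler_wpM2l (powR_ge0 _ _) (normc_sum _ _ _)) _.
  rewrite mulr_sumr; apply: ler_sum => i _; rewrite /F normcM normc_real.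
  rewrite ger0_norm ?divr_ge0 ?powR_ge0 ?exprn_ge0 ?(ltW (freq_gt0 _ _ _ _))//.
  by rewrite mulrCA.
rewrite -mulr_sumr exchange_big/=.
have -> : normc (inv_const psi) * C1 * C2 * B * `|x| `^ (- (n%:R / p)) =
  normc (inv_const psi) * (C1 * B * `|x| `^ (- (n%:R / p)) * C2) by ring.
rewrite ler_wpM2l ?normc_ge0//.
apply: (@le_trans _ _ (\sum_(i < N) C1 * B * `|x| `^ (- (n%:R / p)) *
   ((freq up L a i * `|x|) `^ (n%:R / p) * (1 + freq up L a i * `|x|) ^- n.+1))); last first.
  rewrite -mulr_sumr ler_wpM2l//; last exact: hC2.
  by rewrite !mulr_ge0 ?powR_ge0 ?(ltW C10) ?(ltW B0).
apply: ler_sum => i _; rewrite /F -mulr_sumr.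
have t0 := @freq_gt0 R up L a i; have /andP[J4 _] := JK i.
apply: le_trans (ler_wpM2l _ (hC1 (L * (a + i.+1))%N K x J4)) _.
  by rewrite divr_ge0 ?powR_ge0 ?exprn_ge0// ltW.
rewrite -/(freq up L a i); set t := freq up L a i in t0 *.
have -> : decay (t *: x) = (1 + t * `|x|) ^- n.+1 by rewrite /decay normrZ gtr0_norm.
set d := (1 + t * `|x|) ^- n.+1.
have d0 : 0 <= d by rewrite invr_ge0 exprn_ge0// addr_ge0// mulr_ge0// ltW.
have -> : t `^ beta / t ^+ n * (C1 * t `^ weight up s * t ^+ n * d) =
  C1 * (t `^ beta * t `^ weight up s) * d by field; rewrite gt_eqF// exprn_gt0.
have -> : C1 * B * `|x| `^ (- (n%:R / p)) * ((t * `|x|) `^ (n%:R / p) * d) =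
  C1 * (B * t `^ (n%:R / p)) * d.
  rewrite powRM ?(ltW t0) ?(ltW x0)// powRN; field.
  by rewrite gt_eqF// powR_gt0.
rewrite ler_wpM2r// ler_wpM2l ?(ltW C10)//.
rewrite -powRD; last by rewrite (gt_eqF t0) implybT.
rewrite -ler_pdivrMr ?powR_gt0// -powRN -powRD; last by rewrite (gt_eqF t0) implybT.
exact: hB.
Qed.

End upper_bound.

(** * Pointwise lower bounds *)

Section lower_bound.
Context {R : realType} {n : nat} (psi : nat -> 'rV[R]_n -> R[i]).
Hypothesis hpsi : littlewood_paley psi.
Hypothesis hn : (0 < n)%N.
Local Notation Rn := 'rV[measurableTypeR R]_n.
Local Notation mu := (@lebesgue_rV R n).

Lemma cRe_realM (a : R) (z : R[i]) : complex.Re (a%:C * z) = a * complex.Re z.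
Proof. by rewrite cReM /= mul0r subr0. Qed.

Lemma normc_inv_const_gt0 : 0 < normc (inv_const psi).
Proof.
rewrite lt_neqAle normc_ge0 andbT eq_sym.
by apply/eqP => /eq0_normc/eqP; apply/negP/inv_const_neq0.
Qed.

(** For [L >= 4] the windows of different frequencies are disjoint. In the
    three blocks of the i-th window only the i-th dilate is present, and these
    blocks sum up to it. *)
Lemma sequence_norm_up_ge s r p : 1 < p -> (1 <= r)%E ->
  exists2 A : R, 0 < A & exists2 rho : R, 0 < rho & forall L a N i x, (4 <= L)%N ->
  (i < N)%N -> `|x| <= rho / freq true L a i ->
  ((A * freq true L a i `^ (n%:R / p))%:E <=
   sequence_norm psi s r (distr_of (lacunary_power psi hn true L a (n%:R / p - weight true s) N)) x)%E.
Proof.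
move=> p1 r1; have [k k0 [rho rho0 hk]] := profile_pos hpsi hn.
have c0 := normc_inv_const_gt0; set c := normc _ in c0.
set q := n%:R / p; rewrite /weight.
have w0 : 0 < 2 `^ (4 * `|s|) :> R by rewrite powR_gt0.
exists (c * k / (3 * 2 `^ (4 * `|s|))); first by rewrite !(mulr_gt0, divr_gt0).
exists rho => // L a N i x L4 iN hx.
pose J j := (L * (a + j.+1))%N.
pose t := freq true L a i : R; have t0 : 0 < t by exact: freq_gt0.
set f := distr_of _; set S := sequence_norm psi s r f x.
pose T j := 2 `^ (j%:R * s) * normc (function_of (lp_block psi j f) x).
have TS j : ((T j)%:E <= S)%E.
  by apply: (@le_Lnorm_counting _ T) => // l; rewrite mulr_ge0 ?powR_ge0 ?normc_ge0.
have Tk d : (2 <= d <= 4)%N -> T (J i + d)%N = 2 `^ ((J i + d)%:R * s) *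
    (c * (t `^ (q - s) / t ^+ n * normc (lp_kernel psi hn (J i + d) t x))).
  move=> hd; rewrite /T /f block_lacunary_power// normcM -/c (bigD1 (Ordinal iN))//.
  rewrite big1 ?addr0; last first.
    move=> j ji; rewrite [X in lp_kernel _ _ _ X]/freq /scale lp_kernel_window ?mulr0//.
    apply/negP => h; have : J j != J i.
      by rewrite /J eqn_mul2l negb_or -lt0n (leq_trans _ L4)//= eqn_add2l eqSS.
    have [jl|il|e] := ltngtP j i; last by rewrite -val_eqE/= e eqxx in ji.
      by have := leq_mul2l L (a + j.+2) (a + i.+1); rewrite /J in h *; nia.
    by rewrite /J in h *; nia.
  by rewrite [X in normc X]addr0 normcM normc_real ger0_norm// divr_ge0 ?powR_ge0 ?exprn_ge0 ?(ltW t0).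
have main : c * k / 2 `^ (4 * `|s|) * t `^ q <= T (J i + 2)%N + T (J i + 3)%N + T (J i + 4)%N.
  (* [2 ^ (k s)] is [t ^ s] up to the factor [2 ^ (4 |s|)] in the window. *)
  have T_ge d : (2 <= d <= 4)%N ->
      c * t `^ q / 2 `^ (4 * `|s|) / t ^+ n * normc (lp_kernel psi hn (J i + d) t x) <= T (J i + d)%N.
    move=> hd; rewrite Tk//.
    set g := normc (lp_kernel _ _ _ _ _); set W := 2 `^ (4 * _) in w0 *.
    have g0 : 0 <= g by exact: normc_ge0.
    have -> : t `^ q = t `^ s * t `^ (q - s).
      by rewrite -powRD ?(gt_eqF t0) ?implybT// addrC subrK.
    have -> : c * (t `^ s * t `^ (q - s)) / W / t ^+ n * g =
       t `^ s / W * (c * (t `^ (q - s) / t ^+ n * g)).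
      by field; rewrite !gt_eqF// exprn_gt0.
    rewrite ler_wpM2r//.
      by rewrite !mulr_ge0 ?powR_ge0 ?invr_ge0 ?exprn_ge0 ?(ltW c0) ?(ltW t0).
    rewrite ler_pdivrMr//; apply: (@pow2_window_ge _ (J i)).
    by move: hd => /andP[_ hd]; rewrite leq_addr leq_add2l.
  have h2 := T_ge 2%N isT; have h3 := T_ge 3%N isT; have h4 := T_ge 4%N isT.
  apply: le_trans (lerD (lerD h2 h3) h4); rewrite -!mulrDr.
  have tn : 0 < t ^+ n by rewrite exprn_gt0.
  have -> : c * k / 2 `^ (4 * `|s|) * t `^ q = c * t `^ q / 2 `^ (4 * `|s|) / t ^+ n * (t ^+ n * k).
    by field; rewrite !gt_eqF.
  rewrite ler_wpM2l//.
    by rewrite !mulr_ge0 ?powR_ge0 ?invr_ge0 ?exprn_ge0 ?powR_ge0 ?(ltW c0) ?(ltW t0).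
  apply: le_trans (le_trans (normc_triangle _ _) (lerD (normc_triangle _ _) (lexx _))).
  rewrite !addn2 addn3 addn4 /t /freq /scale -/(J i) lp_kernel_sum// normcM normc_real.
  rewrite ger0_norm ?exprn_ge0// ler_wpM2l ?exprn_ge0//.
  apply: le_trans (le_trans (ler_norm _) (Re_le_normc _)); apply: hk.
  by rewrite normrZ ger0_norm ?exprn_ge0// mulrC -ler_pdivlMr ?exprn_gt0.
have [d hd] : exists d, c * k / (3 * 2 `^ (4 * `|s|)) * t `^ q <= T (J i + d)%N.
  move: main.
  have -> : c * k / 2 `^ (4 * `|s|) * t `^ q = 3 * (c * k / (3 * 2 `^ (4 * `|s|)) * t `^ q).
    by field; rewrite gt_eqF.
  by case/third_le_some => h; [exists 2%N|exists 3%N|exists 4%N].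
by apply: le_trans (TS (J i + d)%N); rewrite lee_fin.
Qed.

(** Everything is in block 0, where the other dilates must not cancel the i-th
    one. Those of lower frequency have a nonnegative real part at [x]; those
    of higher frequency are in their decay region and sum up to a multiple of
    [2 ^- L], small for large [L]. *)
Lemma sequence_norm_down_ge s r p : 1 < p -> (1 <= r)%E ->
  exists2 A : R, 0 < A & exists2 rho : R, 0 < rho & exists L0 : nat,
  forall L a N i x, (L0 <= L)%N -> (4 <= L)%N ->
  (i < N)%N -> `|x| <= rho / freq false L a i -> rho / freq false L a i / 2 < `|x| ->
  ((A * freq false L a i `^ (n%:R / p))%:E <=
   sequence_norm psi s r (distr_of (lacunary_power psi hn false L a (n%:R / p - weight false s) N)) x)%E.
Proof.
move=> p1 r1; have p0 : 0 < p by exact: lt_trans p1.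
have [k k0 [rho rho0 hk]] := profile_pos hpsi hn.
have [C C0 hC] := profile_decay hpsi hn.
have c0 := normc_inv_const_gt0; set c := normc _ in c0.
set q := n%:R / p; rewrite /weight subr0.
have qn : q <= n%:R by rewrite ler_pdivrMr// ler_peMr// ltW.
have r20 : 0 < rho / 2 by rewrite divr_gt0.
(* The decay bound for the dilates of higher frequency, outside the inner
   radius of the i-th shell. *)
pose D := C * (rho / 2) ^- n.+1.
have D0 : 0 < D by rewrite mulr_gt0// invr_gt0 exprn_gt0.
exists (c * (k / 2)); first by rewrite mulr_gt0// divr_gt0.
exists rho => //; exists (Num.bound (4 * D / k)) => L a N i x L0 L4 iN hx hx'.
have L0' : (0 < L)%N by exact: leq_trans L4.
have small : D * (2 / 2 ^+ L) <= k / 2.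
  have := le_pow2_of_bound L0 (ltW (divr_gt0 (mulr_gt0 (ltr0n _ 4) D0) k0)).
  rewrite ler_pdivrMr// => h.
  by rewrite mulrA ler_pdivrMr ?exprn_gt0//; move: h; set P := 2 ^+ L; lra.
pose t j := freq false L a j : R; have t0 j : 0 < t j by exact: freq_gt0.
set f := distr_of _; set S := sequence_norm psi s r f x.
pose T j := 2 `^ (j%:R * s) * normc (function_of (lp_block psi j f) x).
have TS : ((T 0%N)%:E <= S)%E.
  by apply: (@le_Lnorm_counting _ T) => // l; rewrite mulr_ge0 ?powR_ge0 ?normc_ge0.
apply: le_trans TS; rewrite lee_fin {}/T mul0r powRr0 mul1r /f block_lacunary_power//.
rewrite normcM -/c -mulrA ler_wpM2l ?(ltW c0)// -/(t i).
apply: le_trans (le_trans (ler_norm _) (Re_le_normc _)).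
pose G j := t j `^ q * complex.Re (profile psi hn (t j *: x)).
have -> : complex.Re (\sum_(j < N) (freq false L a j `^ q / freq false L a j ^+ n)%:C *
    lp_kernel psi hn 0 (freq false L a j) x) = \sum_(j < N) G j.
  rewrite (big_morph (@complex.Re R) (@cReD R) (erefl : complex.Re 0 = 0 :> R)).
  apply: eq_bigr => j _; rewrite /G.
  have -> : lp_kernel psi hn 0 (freq false L a j) x = (t j ^+ n)%:C * profile psi hn (t j *: x).
    by rewrite /t /freq lp_kernel_low// (leq_trans L4)// leq_pmulr// addnS.
  rewrite !cRe_realM -/(t j) mulrA; congr (_ * _).
  by rewrite divfK// gt_eqF// exprn_gt0.
have Gi : k * t i `^ q <= G i.
  rewrite /G mulrC ler_wpM2l ?powR_ge0//; apply: hk.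
  by rewrite normrZ gtr0_norm// mulrC -ler_pdivlMr.
have Gge j : (i < j)%N -> 0 <= G j.
  move=> ij; rewrite /G mulr_ge0 ?powR_ge0// (le_trans (ltW k0))//; apply: hk.
  rewrite normrZ gtr0_norm// (@le_trans _ _ (t i * `|x|))//; last first.
    by rewrite mulrC -ler_pdivlMr.
  rewrite ler_wpM2r//; have -> : t i = 2 ^+ (L * (j - i)) * t j by exact: (freq_shift false L a (ltnW ij)).
  by rewrite ler_peMl ?(ltW (t0 _))// exprn_ege1// ler1n.
have Glt j : (j < i)%N -> - (D * t i `^ q * (2 ^+ (L * (i - j)))^-1) <= G j.
  move=> ji; set P := 2 ^+ (L * (i - j)) : R.
  have P1 : 1 <= P by rewrite exprn_ege1// ler1n.
  have P0 : 0 < P by exact: lt_le_trans P1.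
  (* In the descending sequence the earlier term has the higher frequency. *)
  have tj : t j = P * t i by exact: (freq_shift false L a (ltnW ji)).
  suff : `|G j| <= D * t i `^ q / P by rewrite ler_norml => /andP[].
  rewrite /G normrM ger0_norm ?powR_ge0//.
  apply: le_trans (ler_wpM2l (powR_ge0 _ _) (Re_le_normc _)) _.
  apply: le_trans (ler_wpM2l (powR_ge0 _ _) (hC _)) _.
  have xt : rho / 2 <= t i * `|x|.
    by rewrite [leRHS]mulrC -ler_pdivrMr// mulrAC ltW.
  have d1 : decay (t j *: x) <= (P * (rho / 2)) ^- n.+1.
    have h : P * (rho / 2) <= `|t j *: x|.
      by rewrite normrZ gtr0_norm// tj -mulrA; exact: (ler_wpM2l (ltW P0) xt).
    have h0 : 0 < P * (rho / 2) by rewrite mulr_gt0.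
    have h1 : P * (rho / 2) <= 1 + `|t j *: x| by apply: le_trans h _; rewrite lerDr.
    have h2 := lt_le_trans h0 h1.
    by rewrite /decay lef_pV2 ?posrE ?exprn_gt0// lerXn2r ?nnegrE ?(ltW h0) ?(ltW h2).
  (* The amplitude [t_j ^ (n/p)] costs at most [P ^ n] of the decay [P ^- n.+1]. *)
  have pq : P `^ q <= P ^+ n by rewrite -powR_mulrn ?(ltW P0)// ler_powR.
  apply: (@le_trans _ _ ((P ^+ n * t i `^ q) * (C * (P * (rho / 2)) ^- n.+1))).
    apply: ler_pM; rewrite ?powR_ge0 ?mulr_ge0 ?(ltW C0) ?(ltW (decay_gt0 _))//.
      by rewrite tj powRM ?(ltW P0) ?(ltW (t0 _))// ler_wpM2r ?powR_ge0.
    by rewrite ler_wpM2l ?(ltW C0).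
  rewrite le_eqVlt; apply/orP; left; apply/eqP.
  by rewrite /D exprMn (exprS P); field; rewrite !gt_eqF// ?exprn_gt0// ?exprn_gt0.
rewrite -(big_mkord xpredT G) (big_cat_nat (n := i))//=; last exact: ltnW.
rewrite (big_ltn iN).
have s1 : - (D * t i `^ q * (2 / 2 ^+ L)) <= \sum_(0 <= j < i) G j.
  rewrite big_mkord; apply: (@le_trans _ _ (\sum_(j < i) - (D * t i `^ q * (2 ^+ (L * (i - j)))^-1))).
    rewrite sumrN lerN2 -mulr_sumr ler_wpM2l ?geometric_tail_sum//.
    by rewrite mulr_ge0 ?powR_ge0// ltW.
  by apply: ler_sum => j _; exact: Glt.
have s2 : 0 <= \sum_(i.+1 <= j < N) G j.
  by rewrite big_nat; apply: sumr_ge0 => j /andP[ij _]; exact: Gge.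
have s3 := ler_wpM2r (powR_ge0 (t i) q) small.
rewrite -/q; move: s1 s2 s3 Gi; rewrite mulrAC.
set u := \sum_(0 <= j < i) _; set v := \sum_(i.+1 <= j < N) _.
set g := G i; set z := D * _ * _; set w := _ `^ q; lra.
Qed.

End lower_bound.

(** * Strong norms of lacunary superpositions *)

Section lorentz_lower_bound.
Context {R : realType} {n : nat} (psi : nat -> 'rV[R]_n -> R[i]).
Hypothesis hpsi : littlewood_paley psi.
Hypothesis hn : (0 < n)%N.
Local Notation Rn := 'rV[measurableTypeR R]_n.
Local Notation mu := (@lebesgue_rV R n).

Lemma sequence_norm_ge up s r p : 1 < p -> (1 <= r)%E ->
  exists2 A : R, 0 < A & exists2 rho : R, 0 < rho & exists L0 : nat,
  forall L a N i x, (L0 <= L)%N -> (4 <= L)%N ->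
  (i < N)%N -> `|x| <= rho / freq up L a i -> rho / freq up L a i / 2 < `|x| ->
  ((A * freq up L a i `^ (n%:R / p))%:E <=
   sequence_norm psi s r (distr_of (lacunary_power psi hn up L a (n%:R / p - weight up s) N)) x)%E.
Proof.
move=> p1 r1; case: up; last exact: sequence_norm_down_ge.
have [A A0 [rho rho0 h]] := sequence_norm_up_ge hpsi hn s p1 r1.
exists A => //; exists rho => //; exists 0%N => L a N i x _ L4 iN hx _; exact: h.
Qed.

(** The i-th level is of order [t_i ^ (n/p)], on a shell of measure at least
    [(rho / t_i) ^ n]: the product of the level and of the p-th root of the
    measure is bounded below independently of [i]. *)
Lemma TLL_norm_lacunary_ge up s r p : 1 < p -> (1 <= r)%E ->
  exists2 L : nat, (4 <= L)%N & exists2 c : R, 0 < c & forall a N,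
  ((c * N%:R)%:E <= TLL_norm psi s r p 1
     (distr_of (lacunary_power psi hn up L a (n%:R / p - weight up s) N)))%E.
Proof.
move=> p1 r1; have p0 : 0 < p by exact: lt_trans p1.
have n0 : 0 < n%:R :> R by rewrite ltr0n.
have [A A0 [rho rho0 [L0 hA]]] := sequence_norm_ge up s p1 r1.
(* [L >= p] gives [2 ^ (L n/p) >= 2], which separates consecutive levels by a
   factor 2. *)
pose L := maxn (maxn L0 4) (Num.bound p).
have L4 : (4 <= L)%N by rewrite /L !leq_max leqnn orbT.
have LL0 : (L0 <= L)%N by rewrite /L !leq_max leqnn.
have Lp : p <= L%:R.
  by apply: ltW (lt_le_trans (archi_boundP (ltW p0)) _); rewrite ler_nat leq_max leqnn orbT.
pose q : R := n%:R / p; have q0 : 0 < q by rewrite divr_gt0.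
have Lq : 1 <= L%:R * q.
  rewrite /q mulrCA -ler_pdivrMl// mulr1.
  apply: (@le_trans _ _ 1); first by rewrite invf_le1// ler1n.
  by rewrite ler_pdivlMr// mul1r.
exists L => //; exists (A / 2 * rho `^ q); first by rewrite !mulr_gt0 ?powR_gt0.
move=> a N; set f := distr_of _.
have nm : nice (lacunary_power psi hn up L a (n%:R / p - weight up s) N).
  exact: nice_lacunary_power.
pose t i := freq up L a i : R; have t0 i : 0 < t i by exact: freq_gt0.
have rt i : 0 < rho / t i by rewrite divr_gt0.
apply: le_trans (@lorentz_p1_ge R n p (sequence_norm psi s r f) N
  (fun i => A * t i `^ q) (fun i => (rho / t i) ^+ n) p1 _ _ _ _ _).
- rewrite lee_fin (eq_bigr (fun=> A / 2 * rho `^ q)); last first.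
    move=> i _; rewrite -[X in _ * X](_ : (rho / t i) `^ q = _); last first.
      by rewrite -powR_mulrn ?(ltW (rt i))// -powRrM.
    rewrite powRM ?(ltW rho0) ?invr_ge0 ?(ltW (t0 i))// -[(t i)^-1]powR_inv1 ?(ltW (t0 i))//.
    rewrite -powRrM mulN1r powRN; field.
    by rewrite gt_eqF// powR_gt0.
  by rewrite sumr_const card_ord mulr_natr.
- by move=> b b0; exact: measurable_TLL_level.
- by move=> i _; rewrite mulr_gt0// powR_gt0.
- by move=> i; rewrite exprn_ge0// ltW.
- move=> i iN; exists (cube (rho / t i) `\` cube (rho / t i / 2)); split.
  + by apply: measurableD; exact: measurable_cube.
  + move=> x [h1 h2]; rewrite gee0_abs ?Lnorm_ge0//.
    apply: hA => //; rewrite ltNge; apply/negP => h3; exact: h2.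
  + exact: annulus_measure.
- apply/trivIsetP => i j /= iN jN.
  wlog ij : i j iN jN / (i < j)%N.
    move=> w; rewrite neq_ltn => /orP[h|h]; first by apply: w => //; rewrite ltn_eqF.
    by rewrite setIC; apply: w => //; rewrite ltn_eqF.
  move=> _; apply/seteqP; split => // x; rewrite /= !in_itv/= => -[/andP[h1 h2] /andP[h3 h4]].
  have := @freq_powR_double R up L a i j q ij q0 Lq; rewrite -/(t i) -/(t j).
  case: up {f nm hA} t t0 rt iN jN h1 h2 h3 h4 => t t0 rt iN jN h1 h2 h3 h4 h.
    by have := ler_wpM2l (ltW A0) h; lra.
  by have := ler_wpM2l (ltW A0) h; lra.
Qed.

End lorentz_lower_bound.

(** * Necessary relations between the parameters *)

Section necessity.
Context {R : realType}.

Lemma inve_ge1_le1 (r : \bar R) : (1 <= r)%E ->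
  exists2 v : R, 0 <= v <= 1 & (r^-1 = v%:E)%E.
Proof.
case: r => [r||//]; last by exists 0; rewrite ?lexx ?ler01// invey.
rewrite lee_fin => r1; have r0 : 0 < r by exact: lt_le_trans r1.
exists r^-1; last by rewrite inver gt_eqF.
by rewrite invr_ge0 (ltW r0) invf_le1.
Qed.

(** Includes [r = +oo], whose inverse is 0. *)
Lemma ge1_of_inve (r : \bar R) (v : R) : 0 <= v <= 1 -> (r^-1 = v%:E)%E -> (1 <= r)%E.
Proof.
move=> /andP[v0 v1]; case: r => [r||]; last by rewrite inveNy.
  rewrite inver; case: eqVneq => // r0 [e]; rewrite lee_fin.
  have vp : 0 < v by rewrite lt_neqAle v0 andbT eq_sym -e invr_eq0.
  by rewrite -[r]invrK e invf_ge1.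
by rewrite leey.
Qed.

Lemma interpolated_exponent_ge1 (theta : R) (r1 r2 r : \bar R) : 0 < theta < 1 ->
  (1 <= r1)%E -> (1 <= r2)%E ->
  (r^-1 = (1 - theta)%:E / r1 + theta%:E / r2)%E -> (1 <= r)%E.
Proof.
move=> /andP[t0 t1] /inve_ge1_le1[v1 /andP[h1 h1'] ->] /inve_ge1_le1[v2 /andP[h2 h2'] ->].
rewrite -!EFinM -EFinD; apply: ge1_of_inve; apply/andP; split; nra.
Qed.

Lemma powR_scale_bounded (L : nat) (e M : R) : (0 < L)%N ->
  (forall a : nat, (2 ^+ (L * a.+1)) `^ e <= M) -> e <= 0.
Proof.
move=> L0 h; rewrite leNgt; apply/negP => e0.
have M0 : 0 <= M by apply: le_trans (h 0%N); exact: powR_ge0.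
pose a := Num.bound (M `^ e^-1).
have := archi_boundP (powR_ge0 M e^-1); rewrite -/a ltNge => /negP; apply.
have ha : a%:R <= 2 ^+ (L * a.+1) :> R.
  rewrite -natrX ler_nat; apply: ltnW; apply: leq_trans (ltn_expl a (isT : 1 < 2)%N) _.
  by rewrite leq_exp2l// (leq_trans (leqnSn a))// leq_pmull.
apply: le_trans ha _; rewrite -[leLHS]powRr1 ?exprn_ge0// -[X in _ `^ X](mulfV (lt0r_neq0 e0)) powRrM.
by apply: ge0_ler_powR; rewrite ?nnegrE ?powR_ge0 ?invr_ge0 ?(ltW e0).
Qed.

Context {n : nat} (psi : nat -> 'rV[R]_n -> R[i]).
Hypothesis hpsi : littlewood_paley psi.
Hypothesis hn : (0 < n)%N.

(** Test the inequality on lacunary superpositions: one term at a scale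
    tending to infinity or to 0 gives the sign, many terms give the exclusion. *)
Lemma interpolation_necessary (up : bool) (s s1 s2 p p1 p2 theta C : R) (r1 r2 r : \bar R) :
  1 < p -> 1 < p1 -> 1 < p2 -> (1 <= r1)%E -> (1 <= r2)%E -> (1 <= r)%E ->
  0 < theta < 1 -> 0 < C ->
  (forall f : ('rV[R]_n -> R[i]) -> R[i],
     TLL psi s1 r1 p1 +oo%E f -> TLL psi s2 r2 p2 +oo%E f ->
     (TLL_norm psi s r p 1 f <=
      C%:E * (TLL_norm psi s1 r1 p1 +oo f `^ (1 - theta)
              * TLL_norm psi s2 r2 p2 +oo f `^ theta))%E) ->
  let a1 := weight up s1 - n%:R / p1 - (weight up s - n%:R / p) in
  let a2 := weight up s2 - n%:R / p2 - (weight up s - n%:R / p) in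
  (if up then 0 <= (1 - theta) * a1 + theta * a2 else (1 - theta) * a1 + theta * a2 <= 0) /\
  ~ (a1 = 0 /\ a2 = 0).
Proof.
move=> p_gt1 p1_gt1 p2_gt1 hr1 hr2 hr /andP[t0 t1] C0 H a1 a2.
have [L L4 [c c0 low]] := TLL_norm_lacunary_ge hpsi hn up s p_gt1 hr.
set beta := n%:R / p - weight up s in low.
have [C1 C10 h1] := TLL_norm_lacunary_le hpsi hn up s1 beta L4 p1_gt1 hr1.
have [C2 C20 h2] := TLL_norm_lacunary_le hpsi hn up s2 beta L4 p2_gt1 hr2.
have e1 : beta + weight up s1 - n%:R / p1 = a1 by rewrite /beta /a1; ring.
have e2 : beta + weight up s2 - n%:R / p2 = a2 by rewrite /beta /a2; ring.
rewrite e1 in h1; rewrite e2 in h2.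
have L0 : (0 < L)%N by exact: leq_trans L4.
have t1' : 0 < 1 - theta by rewrite subr_gt0.
pose M := C * (C1 `^ (1 - theta) * C2 `^ theta).
have M0 : 0 < M by rewrite !mulr_gt0 ?powR_gt0.
have key a N B1 B2 : 0 < B1 -> 0 < B2 ->
    (forall i, (i < N)%N -> freq up L a i `^ a1 <= B1) ->
    (forall i, (i < N)%N -> freq up L a i `^ a2 <= B2) ->
    c * N%:R <= M * (B1 `^ (1 - theta) * B2 `^ theta).
  move=> B10 B20 hB1 hB2; have k1 := h1 a N B1 B10 hB1; have k2 := h2 a N B2 B20 hB2.
  set f := distr_of _ in k1 k2.
  have nf : tempered f by apply: tempered_distr_of; exact: nice_lacunary_power.
  have k : (TLL_norm psi s r p 1 f <= C%:E * (TLL_norm psi s1 r1 p1 +oo f `^ (1 - theta)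
              * TLL_norm psi s2 r2 p2 +oo f `^ theta))%E.
    by apply: H; split => //; [exact: le_lt_trans k1 (ltry _)|exact: le_lt_trans k2 (ltry _)].
  rewrite -lee_fin; apply: le_trans (low a N) _; apply: le_trans k _.
  have -> : M * (B1 `^ (1 - theta) * B2 `^ theta) =
     C * ((C1 * B1) `^ (1 - theta) * (C2 * B2) `^ theta).
    by rewrite !powRM ?(ltW C10) ?(ltW C20) ?(ltW B10) ?(ltW B20)// /M; ring.
  rewrite EFinM lee_pmul2l// ?lte_fin// EFinM -!poweR_EFin.
  apply: lee_pmul; rewrite ?poweR_ge0//.
    apply: gt0_ler_poweR; rewrite ?(ltW t1')// in_itv/= leey andbT ?lorentz_weak_ge0//.
    by rewrite lee_fin mulr_ge0// ltW.
  apply: gt0_ler_poweR; rewrite ?(ltW t0)// in_itv/= leey andbT ?lorentz_weak_ge0//.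
  by rewrite lee_fin mulr_ge0// ltW.
split; last first.
  move=> [z1 z2]; have : forall N : nat, c * N%:R <= M.
    move=> N; have := key 0%N N 1 1 ltr01 ltr01; rewrite z1 z2 !powR1 !mulr1; apply.
      by move=> i _; rewrite powRr0.
    by move=> i _; rewrite powRr0.
  move/(_ (Num.bound (M / c))); rewrite leNgt => /negP; apply.
  by rewrite mulrC -ltr_pdivrMr// archi_boundP// divr_ge0 ?ltW.
set D := (1 - theta) * a1 + theta * a2.
(* One term, with each power of its frequency as its own bound. *)
have one a : (scale up (L * a.+1)) `^ (- D) <= M / c.
  have T0 : 0 < freq up L a 0 :> R by exact: freq_gt0.
  have := key a 1%N _ _ (powR_gt0 a1 T0) (powR_gt0 a2 T0).
  rewrite mulr1 -!powRrM -powRD ?(gt_eqF T0) ?implybT//.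
  rewrite [a1 * _]mulrC [a2 * _]mulrC -/D => h.
  have {}h : c <= M * freq up L a 0 `^ D by apply: h => -[].
  rewrite ler_pdivlMr// powRN mulrC ler_pdivrMr ?powR_gt0 ?scale_gt0//.
  by move: h; rewrite /freq addn1.
clearbody D; case: up {key h1 h2 low a1 a2 e1 e2 beta} one => one.
  rewrite -oppr_le0; exact: (powR_scale_bounded L0 one).
apply: (powR_scale_bounded L0) => a; apply: le_trans (one a).
rewrite /scale -powR_inv1 ?exprn_ge0// -powRrM mulN1r opprK//.
Qed.

End necessity.

Theorem theorem3p6 (R : realType) (n : nat) (hn : (0 < n)%N)
    (psi : nat -> 'rV[R]_n -> R[i]) (hpsi : littlewood_paley psi)
    (s s1 s2 p p1 p2 theta : R) (r1 r2 : \bar R)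
    (hp : 1 < p) (hp1 : 1 < p1) (hp2 : 1 < p2)
    (hr1 : (1 <= r1)%E) (hr2 : (1 <= r2)%E)
    (htheta : 0 < theta < 1)
    (ss : R) (hss : ss = (1 - theta) * s1 + theta * s2)
    (ps : R) (hps : 1 / ps = (1 - theta) / p1 + theta / p2)
    (rs : \bar R)
    (hrs : (rs^-1 = (1 - theta)%:E / r1 + theta%:E / r2)%E) :
  (exists C : R, 0 < C /\
     forall f : ('rV[R]_n -> R[i]) -> R[i],
       TLL psi s1 r1 p1 +oo%E f -> TLL psi s2 r2 p2 +oo%E f ->
       (TLL_norm psi s rs p 1 f <=
        C%:E * (TLL_norm psi s1 r1 p1 +oo f `^ (1 - theta)
                * TLL_norm psi s2 r2 p2 +oo f `^ theta))%E) ->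
  [\/ [/\ ss = s, ps = p, p1 <> p2 & s2 - s1 <> n%:R / p2 - n%:R / p1],
      [/\ s < ss, ps = p & p1 <> p2],
      [/\ ss - s = n%:R / ps - n%:R / p, 0 < n%:R / ps - n%:R / p
        & s2 - s1 <> n%:R / p2 - n%:R / p1]
    | n%:R / ps - n%:R / p < ss - s /\ 0 < n%:R / ps - n%:R / p].
Proof.
move=> [C [C0 H]].
have hr := interpolated_exponent_ge1 htheta hr1 hr2 hrs.
have [/= hup nup] := interpolation_necessary hpsi hn true hp hp1 hp2 hr1 hr2 hr htheta C0 H.
have [/= hdn ndn] := interpolation_necessary hpsi hn false hp hp1 hp2 hr1 hr2 hr htheta C0 H.
have n0 : 0 < n%:R :> R by rewrite ltr0n.
have np : n%:R / ps = (1 - theta) * (n%:R / p1) + theta * (n%:R / p2).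
  by rewrite -[ps^-1]mul1r hps; ring.
have inj (u v : R) : n%:R / u = n%:R / v -> u = v.
  by move=> /(mulfI (lt0r_neq0 n0)) /invr_inj.
have {inj} injps : n%:R / ps = n%:R / p -> ps = p := inj _ _.
have p_neq : n%:R / ps = n%:R / p -> p1 <> p2.
  move=> e p12; apply: ndn; rewrite -p12 in np *; split; lra.
have Dup : (1 - theta) * (s1 - n%:R / p1 - (s - n%:R / p)) +
    theta * (s2 - n%:R / p2 - (s - n%:R / p)) = (ss - s) - (n%:R / ps - n%:R / p).
  by rewrite hss np; ring.
have Ddn : (1 - theta) * (0 - n%:R / p1 - (0 - n%:R / p)) +
    theta * (0 - n%:R / p2 - (0 - n%:R / p)) = - (n%:R / ps - n%:R / p).
  by rewrite np; ring.
rewrite Dup in hup; rewrite Ddn in hdn.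
have s_neq : ss - s = n%:R / ps - n%:R / p -> s2 - s1 <> n%:R / p2 - n%:R / p1.
  move=> e e12; apply: nup; rewrite e subrr in Dup.
  have a12 : s2 - n%:R / p2 - (s - n%:R / p) = s1 - n%:R / p1 - (s - n%:R / p) by lra.
  move: Dup; rewrite a12 -mulrDl subrK mul1r => a1.
  by [].
(* The four alternatives: [n/p_* - n/p] is zero or positive, and [s_* - s] equals it or
   exceeds it. *)
have d0 : 0 <= n%:R / ps - n%:R / p by rewrite -oppr_le0.
move: d0; rewrite le_eqVlt eq_sym => /orP[/eqP d0|d0].
  have e : n%:R / ps = n%:R / p by apply/eqP; rewrite -subr_eq0 d0.
  have ep := injps e; have pn := p_neq e.
  move: hup; rewrite d0 subr0 le_eqVlt eq_sym => /orP[/eqP s0|s0].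
    by constructor 1; split => //; [apply/eqP; rewrite -subr_eq0 s0|apply: s_neq; rewrite s0 d0].
  by constructor 2; split => //; rewrite -subr_gt0.
move: hup; rewrite le_eqVlt eq_sym => /orP[/eqP s0|s0].
  by constructor 3; split => //; [apply/eqP; rewrite -subr_eq0 s0|apply: s_neq; apply/eqP; rewrite -subr_eq0 s0].
by constructor 4; split => //; rewrite -subr_gt0.
Qed.
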